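(* Let the copula $C$ of $(U^1,\dots,U^d)$ be differentiable with continuous partial derivatives, and let $f:[0,1]^d\to\mathbb R$ be right-continuous and of bounded variation in the sense of Hardy–Krause. Then the LHSD estimator satisfies $$\frac1{\sqrt n}\sum_{i=1}^n\Big(f(V^1_{i,n},\dots,V^d_{i,n})-\mathbb E[f(U^1,\dots,U^d)]\Big)\xrightarrow{d}N(0,\sigma^2_{LHSD}),$$ where $$\sigma^2_{LHSD}=\int_{[0,1]^{2d}}\mathbb E\big[G_C(u^1,\dots,u^d)\,G_C(\bar u^1,\dots,\bar u^d)\big]\,d\widehat f(u^1,\dots,u^d)\,d\widehat f(\bar u^1,\dots,\bar u^d).$$
   Context: Let $d\ge2$ and $(U^1,\dots,U^d)$ a random vector with uniform marginals on $[0,1]$ and copula $C$; let $(U^1_i,\dots,U^d_i)$, $i\ge1$, be i.i.d. copies. For $n\ge1$, the rank statistics are $r^j_{i,n}=\sum_{k=1}^n\mathbf 1_{\{U^j_k\le U^j_i\}}$, and the Latin hypercube sample with dependence (LHSD) is $V^j_{i,n}=\frac{r^j_{i,n}-1}{n}+\frac{\eta^j_{i,n}}{n}$, $i=1,\dots,n$, $j=1,\dots,d$, where $\eta^j_{i,n}$ are arbitrary random variables with values in $[0,1]$. Let $B_C$ be a centred Gaussian field on $[0,1]^d$ with covariance $\mathbb E[B_C(u)B_C(\bar u)]=C(u\wedge\bar u)-C(u)C(\bar u)$ ($\wedge$ = componentwise minimum) and $G_C(u)=B_C(u)-\sum_{j=1}^d\partial_jC(u)B_C(1,\dots,1,u^j,1,\dots,1)$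 ($u^j$ in the $j$-th slot). Right-continuity: $f(u_n)\to f(u)$ whenever each coordinate of $u_n$ decreases to that of $u$. Hardy–Krause variation: $V(f)=\sum_{k=1}^d\sum_{1\le i_1<\dots<i_k\le d}V^{(k)}(f;i_1,\dots,i_k)$ with $V^{(k)}$ the Vitali variation of $f$ restricted to the face $\{u: u_j=1 \text{ for } j\notin\{i_1,\dots,i_k\}\}$; bounded variation means $V(f)<\infty$. $\widehat f(u)=0$ if some coordinate of $u$ equals $1$, and $\widehat f(u)=f(u)$ otherwise; $d\widehat f$ denotes Lebesgue–Stieltjes integration with respect to the signed measure induced by $\widehat f$. *)

(* Defs.v *)
From HB Require Import structures.
From mathcomp Require Import all_boot all_order all_algebra.
From mathcomp Require Import all_classical all_reals all_analysis.
Unset Printing Implicit Defensive.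
Import Order.TTheory GRing.Theory Num.Theory.
Import numFieldNormedType.Exports.
Local Open Scope ring_scope.
Local Open Scope classical_set_scope.

Definition cube {R : realType} (d : nat) : set ('I_d -> R) :=
  [set u | forall j, 0 <= u j <= 1].

Definition orthant {R : realType} {d : nat} (b : 'I_d -> R) : set ('I_d -> R) :=
  [set v | forall j, v j <= b j].

Definition orthants (R : realType) (d : nat) : set (set ('I_d -> R)) :=
  (@orthant R d) @` setT.
Arguments orthants : clear implicits.

Definition borelRd (R : realType) (d : nat) := g_sigma_algebraType (orthants R d).

Definition vec_preimage {R : realType} {T : Type} {d : nat}
  (X : 'I_d -> T -> R) (B : set ('I_d -> R)) : set T :=
  [set x | B (fun j => X j x)].

Definition iid_vectors {R : realType} {dT : measure_display} {T : measurableType dT}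
  (P : probability T R) {d : nat} (U : nat -> 'I_d -> T -> R) : Prop :=
  [/\ (forall i j, measurable_fun setT (U i j)),
      (forall i (B : set ('I_d -> R)), <<s orthants R d >> B ->
         P (vec_preimage (U i) B) = P (vec_preimage (U 0%N) B)) &
      (forall (S : seq nat) (B : nat -> set ('I_d -> R)), uniq S ->
         (forall i, <<s orthants R d >> (B i)) ->
         P (\bigcap_(i in [set` S]) vec_preimage (U i) (B i)) =
         (\prod_(i <- S) P (vec_preimage (U i) (B i)))%E)].

(* each coordinate of U_0 (hence of every U_i) is uniform on [0,1] *)
Definition uniform_marginals {R : realType} {dT : measure_display} {T : measurableType dT}
  (P : probability T R) {d : nat} (U : nat -> 'I_d -> T -> R) : Prop :=
  forall (j : 'I_d) (t : R), 0 <= t <= 1 -> P [set x | U 0%N j x <= t] = t%:E.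

Definition copula {R : realType} {dT : measure_display} {T : measurableType dT}
  (P : probability T R) {d : nat} (U : nat -> 'I_d -> T -> R) (u : 'I_d -> R) : R :=
  fine (P (vec_preimage (U 0%N) (orthant u))).

Definition upd {R : realType} {d : nat} (u : 'I_d -> R) (j : 'I_d) (t : R) : 'I_d -> R :=
  fun k => if k == j then t else u k.

(* l is the j-th partial derivative of F at u (one-sided at faces of [0,1]^d) *)
Definition is_partial_cube {R : realType} {d : nat} (F : ('I_d -> R) -> R)
  (j : 'I_d) (u : 'I_d -> R) (l : R) : Prop :=
  (fun h : R => (F (upd u j (u j + h)) - F u) / h)
    @ within [set h : R | h != 0 /\ 0 <= u j + h <= 1] (nbhs (0 : R)) --> l.

Definition continuous_on_cube {R : realType} {d : nat} (g : ('I_d -> R) -> R) : Prop :=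
  forall u, cube d u -> forall e : R, 0 < e ->
    exists2 delta : R, 0 < delta &
      forall v, cube d v -> (forall j, `|v j - u j| < delta) -> `|g v - g u| < e.

Definition right_continuous_cube {R : realType} {d : nat} (f : ('I_d -> R) -> R) : Prop :=
  forall (u : 'I_d -> R) (un : nat -> 'I_d -> R),
    cube d u -> (forall n, cube d (un n)) ->
    (forall n j, un n.+1 j <= un n j) ->
    (forall j, (fun n => un n j) @ \oo --> u j) ->
    (fun n => f (un n)) @ \oo --> f u.

Definition grid {R : realType} {d : nat} (m : nat) (p : 'I_d -> nat -> R) : Prop :=
  forall j, [/\ p j 0%N = 0, p j m.+1 = 1 & forall k, (k <= m)%N -> p j k <= p j k.+1].

Definition face_corner {R : realType} {d m : nat} (S : {set 'I_d})
  (p : 'I_d -> nat -> R) (l : {ffun 'I_d -> 'I_m.+1}) (e : {set 'I_d}) : 'I_d -> R :=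
  fun j => if j \in S then p j (l j + (j \in e))%N else 1.

Definition cell_delta {R : realType} {d m : nat} (f : ('I_d -> R) -> R) (S : {set 'I_d})
  (p : 'I_d -> nat -> R) (l : {ffun 'I_d -> 'I_m.+1}) : R :=
  \sum_(e : {set 'I_d} | e \subset S) (-1) ^+ #|S :\: e| * f (face_corner S p l e).

Definition vitali_sum {R : realType} {d : nat} (f : ('I_d -> R) -> R) (S : {set 'I_d})
  (m : nat) (p : 'I_d -> nat -> R) : R :=
  \sum_(l : {ffun 'I_d -> 'I_m.+1} | [forall j, (j \notin S) ==> (l j == ord0)])
     `|cell_delta f S p l|.

(* Vitali variation V^(k)(f; S) of f restricted to the face {u_j = 1, j \notin S} *)
Definition vitali_var {R : realType} {d : nat} (f : ('I_d -> R) -> R) (S : {set 'I_d})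
  : \bar R :=
  ereal_sup [set x | exists m p, @grid R d m p /\ x = (vitali_sum f S m p)%:E].

Definition HK_var {R : realType} {d : nat} (f : ('I_d -> R) -> R) : \bar R :=
  (\sum_(S : {set 'I_d} | S != finset.set0) vitali_var f S)%E.

Definition fhat {R : realType} {d : nat} (f : ('I_d -> R) -> R) (u : 'I_d -> R) : R :=
  if [exists j, u j == 1] then 0 else f u.

(* (mp, mn) is a pair of finite measures on [0,1]^d whose difference is the
   signed measure induced by fhat f, i.e. (mp - mn)([0,u]) = fhat f u *)
Definition induced_by {R : realType} {d : nat} (F : ('I_d -> R) -> R)
  (mp mn : {measure set (borelRd R d) -> \bar R}) : Prop :=
  [/\ mp (~` cube d) = 0%E, mn (~` cube d) = 0%E,
      (mp setT < +oo)%E, (mn setT < +oo)%E &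
      forall u : 'I_d -> R, cube d u ->
        fine (mp (cube d `&` orthant u)) - fine (mn (cube d `&` orthant u)) = F u].

Definition minv {R : realType} {d : nat} (u v : 'I_d -> R) : 'I_d -> R :=
  fun j => Num.min (u j) (v j).

Definition on_axis {R : realType} {d : nat} (j : 'I_d) (u : 'I_d -> R) : 'I_d -> R :=
  fun k => if k == j then u j else 1.

(* E[B_C(u) B_C(v)] *)
Definition covB {R : realType} {d : nat} (C : ('I_d -> R) -> R) (u v : 'I_d -> R) : R :=
  C (minv u v) - C u * C v.

(* E[G_C(u) G_C(v)], obtained by expanding
   G_C(u) = B_C(u) - \sum_j dC_j(u) B_C(on_axis j u) bilinearly *)
Definition covG {R : realType} {d : nat} (C : ('I_d -> R) -> R)
  (dC : 'I_d -> ('I_d -> R) -> R) (u v : 'I_d -> R) : R :=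
  covB C u v
  - \sum_(k < d) dC k v * covB C u (on_axis k v)
  - \sum_(j < d) dC j u * covB C (on_axis j u) v
  + \sum_(j < d) \sum_(k < d) dC j u * dC k v * covB C (on_axis j u) (on_axis k v).

Definition dint {R : realType} {d : nat} (m1 m2 : {measure set (borelRd R d) -> \bar R})
  (K : ('I_d -> R) -> ('I_d -> R) -> R) : R :=
  Rintegral m1 (cube d) (fun u => Rintegral m2 (cube d) (fun v => K u v)).

Definition dint_signed {R : realType} {d : nat} (mp mn : {measure set (borelRd R d) -> \bar R})
  (K : ('I_d -> R) -> ('I_d -> R) -> R) : R :=
  dint mp mp K - dint mp mn K - dint mn mp K + dint mn mn K.

Definition rank_stat {R : realType} {T : Type} {d : nat} (U : nat -> 'I_d -> T -> R)
  (n i : nat) (j : 'I_d) (x : T) : nat :=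
  count (fun k => U k j x <= U i j x) (iota 0 n).

Definition LHSD {R : realType} {T : Type} {d : nat} (U : nat -> 'I_d -> T -> R)
  (eta : nat -> nat -> 'I_d -> T -> R) (n i : nat) (x : T) : 'I_d -> R :=
  fun j => ((rank_stat U n i j x)%:R - 1) / n%:R + eta n i j x / n%:R.

Definition LHSD_stat {R : realType} {dT : measure_display} {T : measurableType dT}
  (P : probability T R) {d : nat} (U : nat -> 'I_d -> T -> R)
  (eta : nat -> nat -> 'I_d -> T -> R) (f : ('I_d -> R) -> R) (n : nat) (x : T) : R :=
  (Num.sqrt n%:R)^-1 *
  \sum_(i < n) (f (LHSD U eta n i x) - Rintegral P setT (fun y => f (fun j => U 0%N j y))).

(* convergence in distribution of X_n to N(0, s2) (= law of sqrt(s2) Z, Z ~ N(0,1)) *)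
Definition conv_in_law_normal {R : realType} {dT : measure_display} {T : measurableType dT}
  (P : probability T R) (X : nat -> T -> R) (s2 : R) : Prop :=
  forall h : R -> R, continuous h -> (exists M : R, forall y, `|h y| <= M) ->
    (fun n => Rintegral P setT (fun x => h (X n x)))
      @ \oo --> Rintegral lebesgue_measure setT
                   (fun z => h (Num.sqrt s2 * z) * normal_pdf 0 1 z).

(* Main.v *)
(* Let mu = mp - mn be the signed measure induced by fhat f, and w n = sqrt n. As fhat f vanishes
   on the upper faces of the cube, inclusion-exclusion turns fhat f (x) = mu [0, x] into
   fhat f (x) = (-1)^d mu {u | x < u}. Almost surely the sample has no ties, so at most d of the
   points V_i have a coordinate equal to 1, and up to O(1 / w n) the estimator is (-1)^d times the
   integral over u, with respect to mu, of w n (L_n(u) / n - C(u)), where L_n(u) counts the V_i < u.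
   The rank transformation replaces L_n(u) by the number of U_i below a point s whose coordinates
   satisfy F_j(s_j) ~ u_j, F_j being the j-th empirical distribution function; as
   s_j - u_j ~ -(F_j(u_j) - u_j) and C is differentiable, the integrand differs from
   (w n)^-1 sum_i [1{U_i <= u} - C(u) - sum_j dC_j(u) (1{U_i^j <= u_j} - u_j)]
   by an error which tends to 0 in L^1 for each u and is bounded in L^1 uniformly in u. For fixed u
   this only needs Chebyshev bounds at finitely many points of a grid of mesh e / w n around u. By
   Fubini the estimator is then L^1-close to a normalized sum of bounded centred i.i.d. variables;
   their variance is the double integral of covG, and the central limit theorem is proved by
   Lindeberg's replacement method.

   The measures mp and mn are images of Lebesgue measure on an interval. Extend f by 0 from [0,1[^d
   to ]-1,1]^d and bisect this box repeatedly; the increments of the extension over the cells form an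
   additive function of bounded variation, hence a difference of two nonnegative additive functions.
   Cutting an interval in proportion to the masses of the cells sends each of its points to a
   decreasing sequence of cells, whose upper corners converge to the image of the point. *)
Require Import Defs.
From HB Require Import structures.
From mathcomp Require Import all_boot all_order all_algebra.
From mathcomp Require Import all_classical all_reals all_analysis.
From mathcomp Require Import measurable_realfun ring lra zify.
Import Order.TTheory GRing.Theory Num.Theory.
Import numFieldNormedType.Exports.
Local Open Scope ring_scope.
Local Open Scope classical_set_scope.

(** * Integrals of bounded measurable functions *)

(** All integrands are bounded and measurable ([bmf]) and all measures finite, so that integrals are
    real numbers and linearity, Fubini and bounded convergence apply without integrability
    arguments. The obstacle is that the compensated point s depends on the whole sample, so the
    fluctuation of the empirical distribution at s is not that of a fixed point. Uniform control
    over the cube is avoided: integration against mu asks only for convergence in mean at each u,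
    with a bound uniform in u for domination, and for fixed u the point s may be rounded to one of
    finitely many deterministic points. Near the faces of the cube, where thresholds are clamped,
    the rounding works because the empirical distribution functions are exact at 0 and 1 off a null
    event. Null events enter through [nul], a function of integral 0, multiples of which are added
    to upper bounds. [f] and [dC] are controlled on the cube only, hence the projection [clamp]. The
    variance formula is obtained from the limiting i.i.d. summand [zstat] by Fubini, which also
    shows that it is nonnegative. *)

Definition bmf {dT} {T : measurableType dT} {R : realType} (f : T -> R) : Prop :=
  measurable_fun setT f /\ exists M : R, forall x, `|f x| <= M.

Notation Rint m f := (Rintegral m setT f).

Section bounded_measurable.
Context {dT : measure_display} {T : measurableType dT} {R : realType}.
Implicit Types (f g : T -> R).

Lemma bmf_bound f : bmf f -> exists2 M : R, 0 <= M & forall x, `|f x| <= M.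
Proof.
move=> [_ [M fM]]; exists (Num.max M 0); first by rewrite le_max lexx orbT.
by move=> x; rewrite le_max fM.
Qed.

Lemma bmf_cst (c : R) : bmf (fun _ : T => c).
Proof. by split; [exact: measurable_cst|exists `|c|]. Qed.

Lemma bmfD f g : bmf f -> bmf g -> bmf (fun x => f x + g x).
Proof.
move=> [mf [M fM]] [mg [N gN]]; split; first exact: measurable_funD.
by exists (M + N) => x; rewrite (le_trans (ler_normD _ _)) ?lerD.
Qed.

Lemma bmfN f : bmf f -> bmf (fun x => - f x).
Proof.
move=> [mf [M fM]]; split; first exact: measurableT_comp (@oppr_measurable R setT) mf.
by exists M => x; rewrite normrN.
Qed.

Lemma bmfB f g : bmf f -> bmf g -> bmf (fun x => f x - g x).
Proof. by move=> hf hg; apply: bmfD => //; exact: bmfN. Qed.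

Lemma bmfM f g : bmf f -> bmf g -> bmf (fun x => f x * g x).
Proof.
move=> [mf [M fM]] [mg [N gN]]; split; first exact: measurable_funM.
by exists (M * N) => x; rewrite normrM ler_pM.
Qed.

Lemma bmfZ (c : R) f : bmf f -> bmf (fun x => c * f x).
Proof. by move=> hf; apply: bmfM => //; exact: bmf_cst. Qed.

Lemma bmf_norm f : bmf f -> bmf (fun x => `|f x|).
Proof.
move=> [mf [M fM]]; split; first exact: measurableT_comp.
by exists M => x; rewrite normr_id.
Qed.

Lemma bmf_sum {I : Type} (s : seq I) (Q : pred I) (F : I -> T -> R) :
  (forall i, Q i -> bmf (F i)) -> bmf (fun x => \sum_(i <- s | Q i) F i x).
Proof.
move=> hF; elim: s => [|i s IH].
  by under eq_fun do rewrite big_nil; exact: bmf_cst.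
under eq_fun do rewrite big_cons.
case: (boolP (Q i)) => // Qi; apply: bmfD => //; exact: hF.
Qed.

Lemma bmf_indic (A : set T) : measurable A -> bmf (\1_A : T -> R).
Proof.
move=> mA; split; first exact: measurable_indic.
by exists 1 => x; rewrite indicE; case: (_ \in _); rewrite ?normr1 ?normr0.
Qed.

Lemma bmf_indicb (b : T -> bool) : measurable [set x | b x] -> bmf (fun x => (b x)%:R : R).
Proof.
move=> mb; rewrite (_ : (fun x => _) = \1_[set x | b x]); first exact: bmf_indic.
by apply/funext => x; rewrite indicE; congr (nat_of_bool _)%:R; apply/idP/idP; rewrite inE.
Qed.

Lemma bmf_comp {dS} {S : measurableType dS} (h : S -> T) f :
  measurable_fun setT h -> bmf f -> bmf (fun x => f (h x)).
Proof.
move=> mh [mf [M fM]]; split; first exact: measurableT_comp.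
by exists M.
Qed.

Lemma bmf_ext f g : bmf f -> f =1 g -> bmf g.
Proof. by move=> hf /funext <-. Qed.

Lemma bmf_lim (f_ : nat -> T -> R) f (M : R) :
  (forall n, measurable_fun setT (f_ n)) -> (forall n x, `|f_ n x| <= M) ->
  (forall x, (fun n => f_ n x) @ \oo --> f x) -> bmf f.
Proof.
move=> mf fM cf; split.
  by apply: (measurable_fun_cvg mf) => // x _; exact: cf.
exists M => x.
apply: (cvgr_to_le (cvg_norm (cf x))).
by apply: nearW => n; exact: fM.
Qed.

Variable m : {finite_measure set T -> \bar R}.

Lemma bmf_integrable f : bmf f -> m.-integrable setT (EFin \o f).
Proof.
move=> [mf [M fM]]; apply: measurable_bounded_integrable => //.
  by rewrite ltey_eq fin_num_measure.
exists M; split; first exact: num_real.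
by move=> N MN x _ /=; rewrite (le_trans (fM x))// ltW.
Qed.
Local Hint Resolve bmf_integrable : core.

Lemma RintD f g : bmf f -> bmf g -> Rint m (fun x => f x + g x) = Rint m f + Rint m g.
Proof. by move=> hf hg; rewrite RintegralD//; exact: bmf_integrable. Qed.

Lemma RintB f g : bmf f -> bmf g -> Rint m (fun x => f x - g x) = Rint m f - Rint m g.
Proof. by move=> hf hg; rewrite RintegralB//; exact: bmf_integrable. Qed.

Lemma RintZ (c : R) f : bmf f -> Rint m (fun x => c * f x) = c * Rint m f.
Proof. by move=> hf; rewrite RintegralZl//; exact: bmf_integrable. Qed.

Lemma Rint_sum {I : Type} (s : seq I) (Q : pred I) (F : I -> T -> R) :
  (forall i, Q i -> bmf (F i)) ->
  Rint m (fun x => \sum_(i <- s | Q i) F i x) = \sum_(i <- s | Q i) Rint m (F i).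
Proof.
move=> hF; elim: s => [|i s IH].
  by under eq_fun do rewrite big_nil; rewrite big_nil Rintegral_cst// mul0r.
rewrite big_cons; under eq_fun do rewrite big_cons.
case: (boolP (Q i)) => // Qi.
rewrite RintD ?IH//; first exact: hF.
exact: bmf_sum.
Qed.

Lemma Rint_le f g : bmf f -> bmf g -> (forall x, f x <= g x) -> Rint m f <= Rint m g.
Proof. by move=> hf hg fg; apply: le_Rintegral => //; exact: bmf_integrable. Qed.

Lemma Rint_norm f : bmf f -> `|Rint m f| <= Rint m (fun x => `|f x|).
Proof. by move=> hf; apply: le_normr_Rintegral => //; exact: bmf_integrable. Qed.

Lemma Rint_ge0 f : (forall x, 0 <= f x) -> 0 <= Rint m f.
Proof. by move=> f0; apply: Rintegral_ge0. Qed.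

Lemma Rint_indic (A : set T) : measurable A -> Rint m (\1_A : T -> R) = fine (m A).
Proof. by move=> mA; rewrite /Rintegral integral_indic// setIT. Qed.

Lemma Rint_indicb (b : T -> bool) : measurable [set x | b x] ->
  Rint m (fun x => (b x)%:R : R) = fine (m [set x | b x]).
Proof.
move=> mb; rewrite -Rint_indic//; congr Rintegral.
by apply/funext => x; rewrite indicE; congr (nat_of_bool _)%:R; apply/idP/idP; rewrite inE.
Qed.

Lemma Rint_cvg (f_ : nat -> T -> R) f (M : R) :
  (forall n, measurable_fun setT (f_ n)) -> (forall n x, `|f_ n x| <= M) ->
  (forall x, (fun n => f_ n x) @ \oo --> f x) ->
  (fun n => Rint m (f_ n)) @ \oo --> Rint m f.
Proof.
move=> mf fM cf.
have hf := bmf_lim _ _ _ mf fM cf.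
have hfn n : bmf (f_ n) by split => //; exists M.
have : [/\ m.-integrable setT (EFin \o f),
   [sequence \int[m]_x (`|(EFin \o f_ n) x - (EFin \o f) x|)]_n @ \oo --> 0 &
   [sequence \int[m]_x ((EFin \o f_ n) x)]_n @ \oo --> \int[m]_x ((EFin \o f) x)]%E.
  apply: (@dominated_convergence _ _ _ m setT measurableT (fun n => EFin \o f_ n) _
    (EFin \o cst M)).
  - by move=> n; exact/measurable_EFinP.
  - by apply/measurable_EFinP; case: hf.
  - apply: aeW => x _; apply/fine_cvgP; split; [exact: nearW|exact: cf].
  - exact: finite_measure_integrable_cst.
  - by apply: aeW => x n _; rewrite /= lee_fin.
case=> _ _ /= c.
rewrite /Rintegral; apply: fine_cvg; rewrite fineK//.
apply: integrable_fin_num => //; exact: bmf_integrable.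
Qed.

End bounded_measurable.

Lemma finite_measure_pack {dT} {T : measurableType dT} {R : realType}
  (m : {measure set T -> \bar R}) : (m setT < +oo)%E ->
  exists m' : {finite_measure set T -> \bar R}, forall A, m' A = m A.
Proof.
move=> mT.
have mE : m =1 mfrestr measurableT mT by move=> A; rewrite /= /mfrestr/= /mrestr setIT.
by exists (mfrestr measurableT mT) => A; rewrite mE.
Qed.

Lemma eq_Rint {dT} {T : measurableType dT} {R : realType}
  (m1 m2 : {measure set T -> \bar R}) (f g : T -> R) :
  (forall A, measurable A -> m1 A = m2 A) -> f =1 g -> Rint m1 f = Rint m2 g.
Proof.
move=> h /funext <-; rewrite /Rintegral; congr fine.
by apply: eq_measure_integral => A mA _; exact: h.
Qed.

Lemma Rint_pushforward {d1 d2} {T1 : measurableType d1} {T2 : measurableType d2}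
  {R : realType} (X : T1 -> T2) (mX : measurable_fun setT X) 
  (m : {finite_measure set T1 -> \bar R}) (f : T2 -> R) :
  bmf f -> Rint (measure_function_pushforward__canonical__measure_function_Measure m mX) f = Rint m (fun x => f (X x)).
Proof.
move=> hf; rewrite /Rintegral; congr fine.
rewrite integral_pushforward//; first by apply/measurable_EFinP; case: hf.
apply: (bmf_integrable m); exact: bmf_comp.
Qed.

(** * Fubini's theorem and independence *)

Section fubini.
Context {d1 d2 : measure_display} {T1 : measurableType d1} {T2 : measurableType d2}
  {R : realType}.
Variables (m1 : {finite_measure set T1 -> \bar R}) (m2 : {finite_measure set T2 -> \bar R}).

(** Measurability is read off Fubini's theorem for the product of [m1] and [m2], so a finite measure
    on the parameter space has to be supplied; a Dirac mass serves when none is at hand. *)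
Lemma bmf_Rint (F : T1 * T2 -> R) : bmf F -> bmf (fun x => Rint m2 (fun y => F (x, y))).
Proof.
move=> hF; have [mF [M FM]] := hF; split; last first.
  exists (M * fine (m2 setT)) => x.
  have hFx : bmf (fun y => F (x, y)).
    by split; [exact: measurableT_comp|exists M].
  rewrite (le_trans (Rint_norm _ _ hFx))//.
  rewrite -(Rintegral_cst m2 measurableT M); apply: Rint_le => //.
  - exact: bmf_norm.
  - exact: bmf_cst.
have iF : (m1 \x m2)%E.-integrable setT (EFin \o F).
  apply: measurable_bounded_integrable => //.
    rewrite -setXTT [X in (X < _)%E](product_measure1E m1 m2)//.
    by apply: lte_mul_pinfty; rewrite ?ltey_eq ?fin_num_measure// ?fin_num_fun_lty//.
  exists M; split; first exact: num_real.
  by move=> N MN x _ /=; rewrite (le_trans (FM x))// ltW.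
rewrite /Rintegral; apply: measurableT_comp => //.
exact: (@measurable_fubini_F _ _ _ _ _ m1 m2 _ iF).
Qed.

End fubini.

Lemma measurable_pair_T {d1 d2 d3} {T : measurableType d1} {T1 : measurableType d2}
  {T2 : measurableType d3} (f : T -> T1) (g : T -> T2) :
  measurable_fun setT f -> measurable_fun setT g -> measurable_fun setT (fun x => (f x, g x)).
Proof. by move=> mf mg; exact: measurable_fun_pair. Qed.

Lemma bmf_pairr {d1 d2} {T1 : measurableType d1} {T2 : measurableType d2} {R : realType}
  (F : T1 * T2 -> R) x : bmf F -> bmf (fun y => F (x, y)).
Proof. by move=> hF; apply: (bmf_comp (fun y => (x, y))) => //; exact: pair1_measurable. Qed.

Lemma bmf_pairl {d1 d2} {T1 : measurableType d1} {T2 : measurableType d2} {R : realType}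
  (F : T1 * T2 -> R) y : bmf F -> bmf (fun x => F (x, y)).
Proof. by move=> hF; apply: (bmf_comp (fun x => (x, y))) => //; exact: pair2_measurable. Qed.

Section fubini_swap.
Context {d1 d2 : measure_display} {T1 : measurableType d1} {T2 : measurableType d2}
  {R : realType}.
Variables (m1 : {finite_measure set T1 -> \bar R}) (m2 : {finite_measure set T2 -> \bar R}).

Lemma bmf_integrable_prod (F : T1 * T2 -> R) : bmf F ->
  (m1 \x m2)%E.-integrable setT (EFin \o F).
Proof.
move=> [mF [M FM]]; apply: measurable_bounded_integrable => //.
  rewrite -setXTT [X in (X < _)%E](product_measure1E m1 m2)//.
  by apply: lte_mul_pinfty; rewrite ?ltey_eq ?fin_num_measure// ?fin_num_fun_lty//.
exists M; split; first exact: num_real.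
by move=> N MN x _ /=; rewrite (le_trans (FM x))// ltW.
Qed.

Lemma Rint_prod (F : T1 * T2 -> R) : bmf F ->
  Rint (m1 \x m2)%E F = Rint m1 (fun x => Rint m2 (fun y => F (x, y))).
Proof.
move=> hF; rewrite /Rintegral; congr fine.
rewrite -(integral12_prod_meas1 (bmf_integrable_prod _ hF)).
apply: eq_integral => x _; rewrite /fubini_F /= fineK//.
by apply: (integrable_fin_num measurableT); apply: (bmf_integrable m2); exact: bmf_pairr.
Qed.

Lemma Rint_fubini (F : T1 * T2 -> R) : bmf F ->
  Rint m1 (fun x => Rint m2 (fun y => F (x, y))) =
  Rint m2 (fun y => Rint m1 (fun x => F (x, y))).
Proof.
move=> hF; rewrite -Rint_prod// /Rintegral; congr fine.
rewrite -(integral21_prod_meas1 (bmf_integrable_prod _ hF)).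
apply: eq_integral => x _; rewrite /fubini_G /= fineK//.
by apply: (integrable_fin_num measurableT); apply: (bmf_integrable m1); exact: bmf_pairl.
Qed.

End fubini_swap.

(** The joint law of [(X, Y)] and the product of the two laws agree on rectangles, hence coincide;
    Fubini on the product, transported back to [T], gives the iterated integral. *)
Lemma Rint_indep {dT d1 d2} {T : measurableType dT} {T1 : measurableType d1}
  {T2 : measurableType d2} {R : realType} (P : probability T R) (X : T -> T1) (Y : T -> T2)
  (F : T1 * T2 -> R) :
  measurable_fun setT X -> measurable_fun setT Y ->
  (forall A B, measurable A -> measurable B ->
    P ((X @^-1` A) `&` (Y @^-1` B)) = (P (X @^-1` A) * P (Y @^-1` B))%E) ->
  bmf F ->
  Rint P (fun x => F (X x, Y x)) = Rint P (fun x => Rint P (fun y => F (X x, Y y))).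
Proof.
move=> mX mY ind hF.
have mXY := measurable_pair_T X Y mX mY.
have fP : (P setT < +oo)%E by rewrite probability_setT ltry.
pose mu1 := measure_function_pushforward__canonical__measure_function_Measure P mX.
pose mu2 := measure_function_pushforward__canonical__measure_function_Measure P mY.
have [m1 m1E] := finite_measure_pack mu1 fP.
have [m2 m2E] := finite_measure_pack mu2 fP.
pose mu := measure_function_pushforward__canonical__measure_function_Measure P mXY.
rewrite -(Rint_pushforward (fun x => (X x, Y x)) mXY P F hF).
transitivity (Rint (m1 \x m2)%E F).
  apply: eq_Rint => // A mA; symmetry.
  apply: (@product_measure_unique _ _ _ _ _ m1 m2 mu) => // {A mA} A B mA mB.
  transitivity (mu1 A * mu2 B)%E; first exact: ind.
  by congr (_ * _)%E; apply: esym; [exact: m1E|exact: m2E].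
rewrite Rint_prod//.
transitivity (Rint m1 (fun x => Rint P (fun y => F (x, Y y)))).
  congr Rintegral; apply/funext => x.
  rewrite -(Rint_pushforward Y mY P (fun y => F (x, y)))//; last exact: bmf_pairr.
  by apply: eq_Rint => // A _; exact: m2E.
rewrite -(Rint_pushforward X mX P (fun x => Rint P (fun y => F (x, Y y)))).
  by apply: eq_Rint => // A _; exact: m1E.
have hF' : bmf (fun z : T1 * T => F (z.1, Y z.2)).
  apply: (bmf_comp (fun z : T1 * T => (z.1, Y z.2))) => //.
  apply: measurable_pair_T => //; exact: measurableT_comp.
exact: (bmf_Rint m1 P _ hF').
Qed.

(** * Sequences of i.i.d. variables *)

Definition iid_seq {dT dS} {T : measurableType dT} {S : measurableType dS} {R : realType}
  (P : probability T R) (V : nat -> T -> S) : Prop :=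
  [/\ (forall i, measurable_fun setT (V i)),
      (forall i B, measurable B -> P (V i @^-1` B) = P (V 0%N @^-1` B)) &
      (forall (s : seq nat) (B : nat -> set S), uniq s -> (forall i, measurable (B i)) ->
         P (\bigcap_(i in [set` s]) (V i @^-1` B i)) = \prod_(i <- s) P (V i @^-1` B i))%E].

Section iid.
Context {dT dS : measure_display} {T : measurableType dT} {S : measurableType dS} {R : realType}.
Variables (P : probability T R) (V : nat -> T -> S).
Hypothesis iidV : iid_seq P V.

Lemma iid_measurable i : measurable_fun setT (V i).
Proof. by case: iidV. Qed.

Lemma iid_Rint i (g : S -> R) : bmf g -> Rint P (fun x => g (V i x)) = Rint P (fun x => g (V 0%N x)).
Proof.
move=> hg; have [mV idV _] := iidV.
rewrite -(Rint_pushforward _ (mV i) P g hg) -(Rint_pushforward _ (mV 0%N) P g hg).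
by apply: eq_Rint => // A mA; exact: idV.
Qed.

Lemma iid_Rint2 i j (F : S * S -> R) : i != j -> bmf F ->
  Rint P (fun x => F (V i x, V j x)) =
  Rint P (fun x => Rint P (fun y => F (V 0%N x, V 0%N y))).
Proof.
move=> ij hF; have [mV idV indV] := iidV.
apply: (eq_trans (Rint_indep P (V i) (V j) F (mV i) (mV j) _ hF)).
  move=> A B mA mB.
  have := indV [:: i; j] (fun k => if k == i then A else B).
  rewrite /= !big_cons big_nil eqxx (negbTE (_ : j != i)) 1?eq_sym// mule1 => <-.
  - congr (P _); apply/seteqP; split => [x [xA xB] k|x h].
      by rewrite /= !inE => /orP[] /eqP ->; rewrite ?eqxx// (negbTE (_ : j != i)) 1?eq_sym.
    split; have := h i; have := h j; rewrite /= !inE !eqxx orbT.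
      by move=> _ /(_ isT).
    by rewrite (negbTE (_ : j != i)) 1?eq_sym// => /(_ isT).
  - by rewrite inE ij.
  - by move=> k; case: ifP.
rewrite -(iid_Rint i (fun u => Rint P (fun y => F (u, V 0%N y)))).
  congr Rintegral; apply/funext => x.
  exact: (iid_Rint j (fun v => F (V i x, v)) (bmf_pairr _ _ hF)).
have hF' : bmf (fun z : S * T => F (z.1, V 0%N z.2)).
  apply: (bmf_comp (fun z : S * T => (z.1, V 0%N z.2))) => //.
  apply: measurable_pair_T => //; exact: measurableT_comp.
pose mu := measure_function_pushforward__canonical__measure_function_Measure P (mV 0%N).
have fP : (mu setT < +oo)%E by rewrite /mu/= /pushforward preimage_setT probability_setT ltry.
have [m mE] := finite_measure_pack mu fP.
exact: (bmf_Rint m P _ hF').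
Qed.

(** The intersections of preimages under the first [n] variables form a pi-system [G], whose members
    are independent of [V n]. Uniqueness of measures extends this to the sigma-algebra generated by
    [G], for which the partial sum is measurable. *)
Lemma iid_indep_sum (z : S -> R) n A B : measurable_fun setT z -> measurable A -> measurable B ->
  P ((fun x => \sum_(i < n) z (V i x)) @^-1` A `&` V n @^-1` B) =
  (P ((fun x => \sum_(i < n) z (V i x)) @^-1` A)%R * P (V n @^-1` B))%E.
Proof.
move=> mz mA mB; have [mV idV indV] := iidV.
pose G : set (set T) := [set E | exists2 C : nat -> set S, (forall i, measurable (C i)) &
  E = \bigcap_(i in [set` iota 0 n]) (V i @^-1` C i)].
have GI : setI_closed G.
  move=> E1 E2 [C1 mC1 ->] [C2 mC2 ->].
  exists (fun i => C1 i `&` C2 i); first by move=> i; exact: measurableI.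
  by rewrite -bigcapI; apply: eq_bigcapr => i _; rewrite preimage_setI.
have GT : G setT.
  exists (fun _ => setT) => //.
  by apply/seteqP; split.
have Gm E : G E -> measurable E.
  case=> C mC ->; apply: fin_bigcap_measurable => // i _.
  by rewrite -[X in measurable X]setTI; apply: mV.
have Gsub E : <<s G >> E -> measurable E.
  by apply: smallest_sub => //; exact: sigma_algebra_measurable.
have mBn : measurable (V n @^-1` B) by rewrite -[X in measurable X]setTI; apply: mV.
pose T' := g_sigma_algebraType G.
(* [T'] is [T] with the coarser sigma-algebra generated by [G]; pushing forward along the identity
   restricts a measure to it. *)
have mid : measurable_fun (setT : set T) (id : T -> T').
  by move=> _ E mE; rewrite setTI; exact: Gsub.
pose m0 := measure_function_pushforward__canonical__measure_function_Measure (mrestr P mBn) mid.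
have h0 : 0 <= fine (P (V n @^-1` B)) by rewrite fine_ge0.
pose c := NngNum h0.
pose m2 := measure_function_pushforward__canonical__measure_function_Measure (mscale c P) mid.
have pF : P (V n @^-1` B) \is a fin_num by rewrite fin_num_measure.
have key E : <<s G >> E -> P (E `&` V n @^-1` B) = (P (V n @^-1` B) * P E)%E.
  move=> hE.
  have := @measure_unique _ R T' G (fun _ => setT) erefl GI (fun _ => GT) _ m0 m2 _ _ E hE.
  rewrite /m0 /m2 /= /pushforward /mscale /mrestr /= fineK//; apply => //.
  - by apply/seteqP; split => // x _; exists 0%N.
  - move=> F [C mC ->]; rewrite preimage_id.
    have := indV (rcons (iota 0 n) n) (fun k => if k == n then B else C k).
    rewrite -cats1 big_cat big_seq1 eqxx /=.
    have -> : \bigcap_(i in [set` iota 0 n ++ [:: n]]) V i @^-1` (if i == n then B else C i) =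
      \bigcap_(i in [set` iota 0 n]) V i @^-1` C i `&` V n @^-1` B.
      apply/seteqP; split => x.
        move=> h; split.
          move=> i /= ii; have := h i; rewrite /= mem_cat ii => /(_ isT).
          by move: ii; rewrite mem_iota /= add0n => /ltn_eqF ->.
        by have := h n; rewrite /= mem_cat !inE eqxx orbT => /(_ isT).
      move=> [h1 h2] i; rewrite /= mem_cat inE => /orP[ii|/eqP ->]; last by rewrite eqxx.
      by have := h1 i ii; move: ii; rewrite mem_iota /= add0n => /ltn_eqF ->.
    move=> ->; last 2 first.
    + rewrite cats1 rcons_uniq iota_uniq mem_iota /= add0n ltnn//.
    + by move=> i; case: ifP.
    rewrite muleC; congr (_ * _)%E.
    rewrite -indV ?iota_uniq//; last by move=> i; case: ifP.
    by congr (P _); apply: eq_bigcapr => i; rewrite /= mem_iota /= add0n => /ltn_eqF ->.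
  - move=> _; rewrite preimage_setT setTI.
    by rewrite ltey_eq fin_num_measure.
rewrite muleC; apply: key.
have mVG i : (i < n)%N -> measurable_fun (setT : set T') (V i : T' -> S).
  move=> ni _ E mE; rewrite setTI; apply: sub_sigma_algebra.
  exists (fun k => if k == i then E else setT); first by move=> k; case: ifP.
  apply/seteqP; split => x.
    by move=> h k kn /=; case: ifP => // /eqP ->.
  by move=> /(_ i); rewrite /= mem_iota /= add0n ni eqxx => /(_ isT).
have : measurable_fun (setT : set T') (fun x : T' => \sum_(i < n) z (V i x)).
  apply: measurable_sum => i; apply: measurableT_comp => //; exact: mVG.
by move=> /(_ measurableT A mA); rewrite setTI.
Qed.

Lemma iid_Rint_sum (z : S -> R) n (F : R * R -> R) : bmf z -> bmf F ->
  Rint P (fun x => F (\sum_(i < n) z (V i x), z (V n x))) =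
  Rint P (fun x => Rint P (fun y => F (\sum_(i < n) z (V i x), z (V 0%N y)))).
Proof.
move=> hz hF; have [mV idV indV] := iidV; have [mz _] := hz.
have mSum : measurable_fun setT (fun x => \sum_(i < n) z (V i x)).
  by apply: measurable_sum => i; apply: measurableT_comp.
have hF' : bmf (fun p : R * S => F (p.1, z p.2)).
  apply: (bmf_comp (fun p : R * S => (p.1, z p.2))) => //.
  by apply: measurable_pair_T => //; exact: measurableT_comp.
apply: (eq_trans (Rint_indep P (fun x => \sum_(i < n) z (V i x)) (V n) (fun p => F (p.1, z p.2)) mSum (mV n) _ hF')); last first.
  congr Rintegral; apply/funext => x /=.
  exact: (iid_Rint n (fun v => F (\sum_(i < n) z (V i x), z v)) (bmf_pairr _ _ hF')).
by move=> A B mA mB; exact: iid_indep_sum.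
Qed.

End iid.

(** * The central limit theorem *)

Lemma EFin_Rint {dT} {T : measurableType dT} {R : realType}
  (m : {finite_measure set T -> \bar R}) (f : T -> R) :
  bmf f -> ((Rint m f)%:E = \int[m]_x (f x)%:E)%E.
Proof.
by move=> hf; rewrite fineK//; apply: (integrable_fin_num measurableT); exact: bmf_integrable.
Qed.

(** * Convolution of normal laws *)

Section gaussian_convolution.
Context {R : realType}.
Implicit Types (g h : R -> R) (m s x a b w z : R).
Local Notation mu := (@lebesgue_measure R).
Local Notation gam := (@normal_prob R 0 1).

Lemma measurable_normal_pdf2 (m w : R * R -> R) s : s != 0 ->
  measurable_fun setT m -> measurable_fun setT w ->
  measurable_fun setT (fun p => normal_pdf (m p) s (w p)).
Proof.
move=> s0 mm mw.
rewrite (_ : (fun p => _) = fun p => normal_peak s * expR (- (w p - m p) ^+ 2 / (s ^+ 2 *+ 2))).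
  apply: measurable_funM => //; apply: measurableT_comp => //.
  apply: measurable_funM => //; apply: measurableT_comp => //.
  by apply: measurable_funX; exact: measurable_funB.
by apply/funext => p; rewrite normal_pdfE.
Qed.

Lemma integral_normal_prob g : bmf g ->
  (\int[gam]_x (g x)%:E = \int[mu]_x (g x * normal_pdf 0 1 x)%:E)%E.
Proof.
move=> hg; have [mg _] := hg.
under [RHS]eq_integral do rewrite EFinM.
rewrite -(Radon_Nikodym_change_of_variables (normal_prob_dominates 0 1))//=; last exact: bmf_integrable.
apply: ae_eq_integral => //.
- apply: emeasurable_funM => //; first exact/measurable_EFinP.
  apply: (measurable_int mu).
  by apply: Radon_Nikodym_integrable; exact: normal_prob_dominates.
- apply: emeasurable_funM => //=; first exact/measurable_EFinP.
  by apply/measurableT_comp => //=; exact: measurable_normal_pdf.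
- apply: ae_eqe_mul2l => /=.
  rewrite Radon_NikodymE//=; first exact: normal_prob_dominates.
  move=> abmu.
  case: cid => /= h [h1 h2 h3].
  apply: integral_ae_eq => //=.
  + by apply/measurableT_comp =>//; exact: measurable_normal_pdf.
  + by move=> E E01 mE; rewrite -h3.
Qed.

Lemma Rint_normal_prob g : bmf g -> Rint gam g = Rint mu (fun x => g x * normal_pdf 0 1 x).
Proof. by move=> hg; rewrite /Rintegral integral_normal_prob. Qed.

Lemma normal_pdf_affine x a z : 0 < a -> a * normal_pdf x a (x + a * z) = normal_pdf 0 1 z.
Proof.
move=> a0; rewrite !normal_pdfE ?gt_eqF// /normal_peak /normal_fun.
rewrite mulrA; congr (_ * expR _); last by field; rewrite gt_eqF.
rewrite expr1n mul1r -mulrnAr sqrtrM ?sqr_ge0// sqrtr_sqr gtr0_norm// invfM mulrA.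
by rewrite divff ?gt_eqF// mul1r.
Qed.

Lemma integral_affine_normal g x a : 0 < a -> continuous g -> (forall y, 0 <= g y) ->
  (\int[mu]_z (g (x + a * z) * normal_pdf 0 1 z)%:E =
   \int[mu]_w (g w * normal_pdf x a w)%:E)%E.
Proof.
move=> a0 cg g0; set F := fun z : R => x + a * z.
have dF (z : R) : is_derive z 1 F a.
  rewrite /F; apply: is_derive_eq.
  rewrite ?/GRing.scale/=.
  by rewrite add0r mul1r mulr1.
have dFE : F^`() = cst a by apply/funext => z; rewrite derive1E; exact: derive_val.
rewrite (@increasing_ge0_integration_by_substitutionT _ F (fun w => g w * normal_pdf x a w)).
- apply: eq_integral => z _; congr EFin; rewrite dFE.
  change (g (x + a * z) * normal_pdf 0 1 z = g (x + a * z) * normal_pdf x a (x + a * z) * a).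
  by rewrite -(normal_pdf_affine x a z a0) mulrCA mulrC.
- by move=> y z yz; rewrite /F ltrD2l ltr_pM2l.
- by rewrite dFE; exact: cst_continuous.
- by rewrite dFE; exact: is_cvg_cst.
- by rewrite dFE; exact: is_cvg_cst.
- by move=> z; exact: ex_derive.
- apply/cvgrNyPle => A; near=> t; rewrite /F -lerBrDl -ler_pdivlMl//.
- apply/cvgryPge => A; near=> t; rewrite /F -lerBlDl -ler_pdivrMl//.
- move=> w; apply: cvgM; first exact: cg.
  by apply: continuous_normal_pdf; rewrite gt_eqF.
- by move=> w; rewrite mulr_ge0// normal_pdf_ge0.
Unshelve. all: by end_near. Qed.

(** Completion of the square. For independent standard normal [Z] and [Y], the joint density of [Z]
    and [W = x + a Z + b Y] factors as the law of [Z] times that of [W] given [Z], and as the law of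
    [W] times that of [Z] given [W]. *)
Lemma normal_pdf_mul x a b w z : 0 < a -> 0 < b ->
  let c := Num.sqrt (a ^+ 2 + b ^+ 2) in
  normal_pdf (x + a * z) b w * normal_pdf 0 1 z =
  normal_pdf x c w * normal_pdf (a * (w - x) / c ^+ 2) (b / c) z.
Proof.
move=> a0 b0 c.
have cc : c ^+ 2 = a ^+ 2 + b ^+ 2 by rewrite sqr_sqrtr// addr_ge0 ?sqr_ge0.
have cc0 : 0 < a ^+ 2 + b ^+ 2 by rewrite addr_gt0 ?exprn_gt0.
have c0 : 0 < c by rewrite sqrtr_gt0.
have bc0 : 0 < b / c by rewrite divr_gt0.
rewrite !normal_pdfE ?gt_eqF// /normal_peak /normal_fun.
rewrite [LHS]mulrACA [RHS]mulrACA -!expRD; congr (_ * expR _).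
  rewrite -!invfM -!sqrtrM; first (congr (_^-1)).
    by congr Num.sqrt; rewrite expr_div_n cc; field; rewrite gt_eqF.
  - by rewrite /= mulrn_wge0// mulr_ge0 ?sqr_ge0// pi_ge0.
  - by rewrite mulrn_wge0// mulr_ge0 ?sqr_ge0// pi_ge0.
rewrite expr_div_n cc; field.
by rewrite !gt_eqF.
Qed.

(** After an affine change of variables Tonelli exchanges the integrals, which is where [0 <= g] is
    used; by [normal_pdf_mul] the inner integral is then that of a probability density. *)
Lemma gauss_convolution_ge0 g x a b : 0 < a -> 0 < b -> bmf g -> continuous g ->
  (forall y, 0 <= g y) ->
  Rint gam (fun z => Rint gam (fun y => g (x + a * z + b * y))) =
  Rint gam (fun z => g (x + Num.sqrt (a ^+ 2 + b ^+ 2) * z)).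
Proof.
move=> a0 b0 hg cg g0; set c := Num.sqrt _.
have c0 : 0 < c by rewrite sqrtr_gt0 addr_gt0 ?exprn_gt0.
have maff (u v : R) : measurable_fun setT (fun z : R => u + v * z).
  by apply: measurable_funD => //; exact: measurable_funM.
have haff u v : bmf (fun z => g (u + v * z)) by apply: bmf_comp.
have T1 u v : 0 < v -> ((Rint gam (fun z => g (u + v * z)))%:E =
    \int[mu]_w (g w * normal_pdf u v w)%:E)%E.
  move=> v0; rewrite -integral_affine_normal// -integral_normal_prob//.
  exact: (EFin_Rint gam _ (haff _ _)).
have hG : bmf (fun p : R * R => g (x + a * p.1 + b * p.2)).
  apply: bmf_comp => //; apply: measurable_funD.
    by apply: measurable_funD => //; apply: measurable_funM.
  by apply: measurable_funM.
have hN := bmf_Rint gam gam _ hG.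
apply: EFin_inj; rewrite T1// (EFin_Rint gam _ hN).
rewrite (integral_normal_prob _ hN).
transitivity (\int[mu]_z \int[mu]_w (g w * (normal_pdf (x + a * z) b w * normal_pdf 0 1 z))%:E)%E.
  apply: eq_integral => z _; rewrite EFinM /= T1//.
  transitivity (\int[mu]_w ((g w * normal_pdf (x + a * z) b w)%:E * (normal_pdf 0 1 z)%:E))%E;
    last by apply: eq_integral => w _; rewrite -EFinM mulrA.
  rewrite ge0_integralZr//.
  - apply/measurable_EFinP; apply: measurable_funM; first by case: hg.
    exact: measurable_normal_pdf.
  - by move=> w _; rewrite lee_fin mulr_ge0// normal_pdf_ge0.
  - by rewrite lee_fin normal_pdf_ge0.
rewrite (@fubini_tonelli _ _ _ _ _ mu mu (fun p : R * R =>
  (g p.2 * (normal_pdf (x + a * p.1) b p.2 * normal_pdf 0 1 p.1))%:E)%E)/=.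
- apply: eq_integral => w _.
  under eq_integral do rewrite normal_pdf_mul// mulrA EFinM.
  rewrite ge0_integralZl//.
  + by rewrite integral_normal_pdf mule1.
  + by apply/measurable_EFinP; exact: measurable_normal_pdf.
  + by move=> z _; rewrite lee_fin normal_pdf_ge0.
  + by rewrite lee_fin mulr_ge0// normal_pdf_ge0.
- apply/measurable_EFinP; apply: measurable_funM.
    by apply: measurableT_comp => //; case: hg.
  apply: measurable_funM; apply: measurable_normal_pdf2; rewrite ?gt_eqF//.
  by apply: measurable_funD => //; exact: measurable_funM.
- by move=> p; rewrite lee_fin !mulr_ge0 ?normal_pdf_ge0.
Qed.

Lemma gauss_convolution g x a b : 0 <= a -> 0 <= b -> bmf g -> continuous g ->
  Rint gam (fun z => Rint gam (fun y => g (x + a * z + b * y))) =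
  Rint gam (fun z => g (x + Num.sqrt (a ^+ 2 + b ^+ 2) * z)).
Proof.
move=> a0 b0 hg cg.
have cE (c : R) : Rint gam (fun=> c) = c.
  by rewrite Rintegral_cst// [fine _](_ : _ = 1) ?mulr1//; exact: (congr1 fine (@probability_setT _ _ _ gam)).
have [->|an0] := eqVneq a 0.
  rewrite expr0n add0r sqrtr_sqr ger0_norm// -[RHS]cE.
  by congr Rintegral; apply/funext => z; congr Rintegral; apply/funext => y; rewrite mul0r addr0.
have [->|bn0] := eqVneq b 0.
  rewrite expr0n addr0 sqrtr_sqr ger0_norm//.
  by congr Rintegral; apply/funext => z; rewrite -[RHS]cE; congr Rintegral; apply/funext => y; rewrite mul0r addr0.
have {}a0 : 0 < a by rewrite lt_neqAle eq_sym an0.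
have {}b0 : 0 < b by rewrite lt_neqAle eq_sym bn0.
have [M M0 gM] := bmf_bound _ hg.
(* Adding the bound [M] makes [g] nonnegative and raises both sides by [M]. *)
have h1 := gauss_convolution_ge0 (fun y => g y + M) x a b a0 b0.
have maff (u v : R) : measurable_fun setT (fun z : R => u + v * z).
  by apply: measurable_funD => //; exact: measurable_funM.
have haff u v : bmf (fun z => g (u + v * z)) by apply: bmf_comp.
have hG : bmf (fun p : R * R => g (x + a * p.1 + b * p.2)).
  apply: bmf_comp => //; apply: measurable_funD.
    by apply: measurable_funD => //; apply: measurable_funM.
  by apply: measurable_funM.
have hN := bmf_Rint gam gam _ hG.
have hM := @bmf_cst _ R R M.
move: h1; rewrite [RHS](RintD gam _ _ (haff _ _) hM) cE.
under [in LHS]eq_fun do rewrite (RintD gam _ _ (haff _ _) hM) cE.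
rewrite (RintD gam _ _ hN hM) cE => h1; apply: (addIr M); apply: h1.
- exact: bmfD.
- by move=> y; apply: cvgD; [exact: cg|exact: cvg_cst].
- by move=> y; rewrite -lerBlDr sub0r; have := gM y; rewrite ler_norml => /andP[].
Qed.

End gaussian_convolution.

(** * Truncated moments of the standard normal law *)

Section truncated_moments.
Context {R : realType}.
Local Notation mu := (@lebesgue_measure R).
Local Notation gam := (@normal_prob R 0 1).
Implicit Types (N z : R) (k : nat).

Definition itv_ind N z : R := (- N <= z <= N)%R%:R.

Lemma measurable_itv_ind N : measurable_fun setT (itv_ind N).
Proof.
rewrite (_ : itv_ind N = \1_`[- N, N]); first exact: measurable_indic.
apply/funext => z; rewrite indicE /itv_ind; congr (nat_of_bool _)%:R.
by apply/idP/idP; rewrite inE/= in_itv.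
Qed.

Lemma itv_ind01 N z : 0 <= itv_ind N z <= 1.
Proof. by rewrite /itv_ind; case: (- N <= z <= N)%R; rewrite ?lexx ?ler01. Qed.

Lemma bmf_itv_ind N : bmf (itv_ind N).
Proof.
split; first exact: measurable_itv_ind.
by exists 1 => z; have /andP[h0 h1] := itv_ind01 N z; rewrite ger0_norm.
Qed.

Lemma bmf_pow_itv_ind N k : 0 <= N -> bmf (fun z => z ^+ k * itv_ind N z).
Proof.
move=> N0; split.
  by apply: measurable_funM; [exact: measurable_funX|exact: measurable_itv_ind].
exists (N ^+ k) => z; rewrite /itv_ind; case: (boolP (- N <= z <= N)%R) => [|_]; last first.
  by rewrite mulr0 normr0 exprn_ge0.
by rewrite -ler_norml mulr1 normrX => h; rewrite lerXn2r ?nnegrE.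
Qed.

Lemma Rint_itv_ind N (f : R -> R) : bmf (fun z => f z * itv_ind N z) ->
  Rint gam (fun z => f z * itv_ind N z) =
  Rintegral mu `[- N, N] (fun z => f z * normal_pdf 0 1 z).
Proof.
move=> hf; rewrite Rint_normal_prob// [RHS]Rintegral_mkcond; congr Rintegral.
apply/funext => z; rewrite /patch /itv_ind mem_setE in_itv/=.
by case: (_ <= _ <= _); rewrite ?mulr1// mulr0 mul0r.
Qed.

Lemma normal_pdf01 : normal_pdf 0 1 = fun z : R => normal_peak 1 * expR (- (z * z) / 2).
Proof.
apply/funext => z; rewrite normal_pdfE ?oner_neq0// /normal_fun subr0 expr1n -expr2.
by [].
Qed.

Lemma is_derive_pow_normal k z :
  is_derive z 1 (fun z : R => - (z ^+ k * normal_pdf 0 1 z))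
   ((z ^+ k.+1 - k%:R * z ^+ k.-1) * normal_pdf 0 1 z).
Proof.
rewrite normal_pdf01.
have h1 : is_derive z 1 (fun z : R => z ^+ k) (k%:R * z ^+ k.-1).
  rewrite (_ : (fun z : R => z ^+ k) = (id : R -> R) ^+ k); last first.
    by apply/funext => y; rewrite exprfctE.
  by apply: is_derive_eq; rewrite /GRing.scale/= mulr1.
have h2 : is_derive z 1 (fun z : R => - (z * z) / 2) (- z).
  by apply: is_derive_eq; rewrite /GRing.scale/=; lra.
have h3 := @is_derive1_comp R expR (fun z : R => - (z * z) / 2) z _ _ (is_derive_expR _) h2.
have h4 := is_deriveN (is_deriveM h1 (is_deriveZ (normal_peak 1) h3)).
apply: (is_derive_eq h4).
change (- (z ^+ k * (normal_peak 1 * (expR (- (z * z) / 2) * - z)) +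
   normal_peak 1 * expR (- (z * z) / 2) * (k%:R * z ^+ k.-1)) =
  (z ^+ k.+1 - k%:R * z ^+ k.-1) * (normal_peak 1 * expR (- (z * z) / 2))).
rewrite exprS; set u := expR _; set v := z ^+ k; set w := z ^+ k.-1; set c := normal_peak 1.
ring.
Qed.

Lemma itv_FTC k N : 0 < N ->
  Rintegral mu `[- N, N] (fun z => (z ^+ k.+1 - k%:R * z ^+ k.-1) * normal_pdf 0 1 z) =
  ((- 1) ^+ k - 1) * N ^+ k * normal_pdf 0 1 N.
Proof.
move=> N0.
have cphi : continuous (fun z : R => (z ^+ k.+1 - k%:R * z ^+ k.-1) * normal_pdf 0 1 z).
  move=> z; apply: cvgM; last by apply: continuous_normal_pdf; rewrite oner_neq0.
  apply: cvgB; first exact: exprn_continuous.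
  by apply: cvgM; [exact: cvg_cst|exact: exprn_continuous].
have cF : continuous (fun z : R => - (z ^+ k * normal_pdf 0 1 z)).
  move=> z; apply: cvgN; apply: cvgM; first exact: exprn_continuous.
  by apply: continuous_normal_pdf; rewrite oner_neq0.
rewrite /Rintegral (@continuous_FTC2 _ _ (fun z : R => - (z ^+ k * normal_pdf 0 1 z))).
- rewrite /= !normal_pdfE ?oner_neq0// /normal_fun !subr0 sqrrN.
  rewrite (exprNn N k); set v := N ^+ k; set t := (-1) ^+ k; set u := expR _; set w := normal_peak 1.
  ring.
- by rewrite gtrN.
- exact: continuous_subspaceT.
- split.
  + by move=> z _; apply: ex_derive; exact: is_derive_pow_normal.
  + by apply: cvg_at_right_filter; exact: cF.
  + by apply: cvg_at_left_filter; exact: cF.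
- move=> z _; rewrite derive1E; apply: derive_val; exact: is_derive_pow_normal.
Qed.

(** Integration by parts, the primitive being [- z ^+ k * normal_pdf 0 1 z]. Truncation keeps the
    powers bounded, at the price of a boundary term that vanishes for even [k]. At [k = 0] the
    default exponent [k.-1 = 0] comes with the factor 0. *)
Lemma truncated_moment k N : 0 < N ->
  Rint gam (fun z => z ^+ k.+1 * itv_ind N z) - k%:R * Rint gam (fun z => z ^+ k.-1 * itv_ind N z) =
  ((- 1) ^+ k - 1) * N ^+ k * normal_pdf 0 1 N.
Proof.
move=> N0; have N0' := ltW N0.
rewrite -itv_FTC// -Rint_itv_ind; last first.
  apply: (bmf_ext (fun z => z ^+ k.+1 * itv_ind N z - k%:R * (z ^+ k.-1 * itv_ind N z))).
    by apply: bmfB; [|apply: bmfZ]; exact: bmf_pow_itv_ind.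
  by move=> z; ring.
rewrite -RintZ; last exact: bmf_pow_itv_ind.
rewrite -RintB; last 2 first.
- exact: bmf_pow_itv_ind.
- by apply: bmfZ; exact: bmf_pow_itv_ind.
by congr Rintegral; apply/funext => z; ring.
Qed.

Lemma cvg_itv_ind : (fun n : nat => Rint gam (itv_ind n%:R)) @ \oo --> (1 : R).
Proof.
have e1 : Rint gam (fun=> 1) = 1.
  by rewrite Rintegral_cst// mul1r; exact: (congr1 fine (@probability_setT _ _ _ gam)).
rewrite -[X in _ --> X]e1.
apply: (Rint_cvg gam _ _ 1).
- by move=> n; exact: measurable_itv_ind.
- by move=> n x; have /andP[h0 h1] := itv_ind01 n%:R x; rewrite ger0_norm.
- move=> x; apply: cvg_near_cst; near=> n.
  rewrite /itv_ind -ler_norml (_ : (_ <= _) = true)//.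
  by near: n; exact: nbhs_infty_ger.
Unshelve. all: by end_near. Qed.

(** The inequality [1 + t <= expR t] at [t = n^2 / 2] bounds the term by a multiple of [1 / n.+1].
    It is the boundary term of the second truncated moment. *)
Lemma cvg_mul_normal_pdf : (fun n : nat => n%:R * normal_pdf 0 1 n%:R) @ \oo --> (0 : R).
Proof.
set c : R := normal_peak 1.
have c0 : 0 <= c by exact: normal_peak_ge0.
apply: (@squeeze_cvgr _ _ _ _ (fun n : nat => 0 : R) (fun n => 4 * c * n.+1%:R^-1)).
- apply: nearW => n; rewrite mulr_ge0 ?normal_pdf_ge0//=.
  rewrite normal_pdf01 -/c ler_pdivlMr// mulNr expRN.
  have := expR_ge1Dx (n%:R * n%:R / 2 : R); set e := expR _ => he.
  have n0 : 0 <= n%:R :> R by [].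
  have e0 : 0 < e by exact: expR_gt0.
  have -> : n%:R * (c / e) * n.+1%:R = c * (n%:R * (n%:R + 1)) / e.
    by rewrite -natr1; field; rewrite gt_eqF.
  rewrite ler_pdivrMr//.
  have h : n%:R * (n%:R + 1) <= 4 * e.
    by move: he n0; set t : R := n%:R => he n0; have := sqr_ge0 (t - 1); rewrite expr2 => h; lra.
  by have := ler_wpM2l c0 h; lra.
- exact: cvg_cst.
- rewrite -[X in _ --> X](mulr0 (4 * c)); apply: cvgM; first exact: cvg_cst.
  exact: cvg_harmonic.
Qed.

End truncated_moments.

(** [g1] and [g2] play the parts of the first two derivatives. Only the Taylor bound is recorded: it
    passes to averages of [g] by mere integration, without differentiation under the integral
    sign. *)
Definition smooth3 {R : realType} (g g1 g2 : R -> R) (M : R) : Prop :=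
  [/\ bmf g, bmf g1, bmf g2, continuous g &
   forall x z, `|g (x + z) - (g x + g1 x * z + g2 x * (z ^+ 2 / 2))| <= M * `|z| ^+ 3].

(** The expansion is integrated over [[-n, n]] and [n] tends to infinity; outside, [g] is bounded by
    [B]. The constant is [2 = (1 + 3) / 2], from [|z|^3 <= (z^2 + z^4) / 2] and the moments 1 and 3
    of orders two and four. *)
Lemma normal_taylor2 {R : realType} (g g1 g2 : R -> R) (M a x : R) :
  smooth3 g g1 g2 M -> 0 <= a -> 0 <= M ->
  `|Rint (@normal_prob R 0 1) (fun z => g (x + a * z)) - (g x + g2 x * (a ^+ 2 / 2))|
  <= 2 * M * a ^+ 3.
Proof.
move=> [hg hg1 hg2 cg hT] a0 M0.
set gam := normal_prob 0 1.
have [B B0 gB] := bmf_bound _ hg.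
pose m k (n : nat) := Rint gam (fun z : R => z ^+ k * itv_ind n%:R z).
have m0 n : m 0%N n = Rint gam (itv_ind n%:R).
  by congr Rintegral; apply/funext => z; rewrite expr0 mul1r.
pose eps (n : nat) := (n%:R : R) * normal_pdf 0 1 (n%:R : R).
have m1 n : m 1%N n.+1 = 0.
  have := @truncated_moment R 0 n.+1%:R (ltr0Sn _ _).
  by rewrite mul0r subr0 expr0 subrr !mul0r.
have m2 n : m 2%N n.+1 = m 0%N n.+1 - 2 * eps n.+1.
  have := @truncated_moment R 1 n.+1%:R (ltr0Sn _ _).
  by rewrite mul1r /= -/(m 2 n.+1) -/(m 0 n.+1) !expr1 /eps; lra.
have m4 n : m 4%N n.+1 <= 3 * m 2%N n.+1.
  have := @truncated_moment R 3 n.+1%:R (ltr0Sn _ _).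
  rewrite /= -/(m 4 n.+1) -/(m 2 n.+1).
  have : 0 <= n.+1%:R ^+ 3 * normal_pdf 0 1 (n.+1%:R : R) by rewrite mulr_ge0 ?exprn_ge0 ?normal_pdf_ge0.
  rewrite -mulrA; set q := _ * _ => q0; rewrite !exprS expr0; lra.
have eps0 n : 0 <= eps n by rewrite mulr_ge0 ?normal_pdf_ge0.
have h1 n : m 0%N n <= 1.
  rewrite m0 -[leRHS](_ : Rint gam (fun=> 1) = 1); last first.
    by rewrite Rintegral_cst// mul1r; exact: (congr1 fine (@probability_setT _ _ _ gam)).
  apply: Rint_le; [exact: bmf_itv_ind|exact: bmf_cst|].
  by move=> z; have /andP[] := itv_ind01 n%:R z.
have hga : bmf (fun z => g (x + a * z)).
  by apply: bmf_comp => //; apply: measurable_funD => //; exact: measurable_funM.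
have hp k n : bmf (fun z : R => z ^+ k * itv_ind n%:R z) by exact: bmf_pow_itv_ind.
pose Q n := g x * m 0%N n + g1 x * a * m 1%N n + g2 x * (a ^+ 2 / 2) * m 2%N n.
have key n : `|Rint gam (fun z => g (x + a * z)) - Q n| <=
    M * a ^+ 3 / 2 * (m 2%N n + m 4%N n) + B * (1 - m 0%N n).
  have hI := bmf_itv_ind (n%:R : R).
  have hq : bmf (fun z : R => g x * (z ^+ 0 * itv_ind n%:R z) +
       (g1 x * a * (z ^+ 1 * itv_ind n%:R z)) + g2 x * (a ^+ 2 / 2) * (z ^+ 2 * itv_ind n%:R z)).
    by apply: bmfD; [apply: bmfD|]; apply: bmfZ; exact: hp.
  have QE : Q n = Rint gam (fun z : R => g x * (z ^+ 0 * itv_ind n%:R z) +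
       (g1 x * a * (z ^+ 1 * itv_ind n%:R z)) + g2 x * (a ^+ 2 / 2) * (z ^+ 2 * itv_ind n%:R z)).
    have p0 := bmfZ (g x) _ (hp 0%N n).
    have p1 := bmfZ (g1 x * a) _ (hp 1%N n).
    have p2 := bmfZ (g2 x * (a ^+ 2 / 2)) _ (hp 2%N n).
    by rewrite /Q (RintD gam _ _ (bmfD _ _ p0 p1) p2) (RintD gam _ _ p0 p1) (RintZ gam _ _ (hp 0%N n)) (RintZ gam _ _ (hp 1%N n)) (RintZ gam _ _ (hp 2%N n)).
  rewrite QE -(RintB gam _ _ hga hq); apply: (le_trans (Rint_norm gam _ (bmfB _ _ hga hq))).
  have hr : bmf (fun z : R => M * a ^+ 3 / 2 * (z ^+ 2 * itv_ind n%:R z + z ^+ 4 * itv_ind n%:R z) +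
      B * (1 - z ^+ 0 * itv_ind n%:R z)).
    apply: bmfD; apply: bmfZ; first exact: bmfD.
    by apply: bmfB => //; exact: bmf_cst.
  rewrite [leRHS](_ : _ = Rint gam (fun z : R => M * a ^+ 3 / 2 * (z ^+ 2 * itv_ind n%:R z + z ^+ 4 * itv_ind n%:R z) +
      B * (1 - z ^+ 0 * itv_ind n%:R z))); last first.
    have q1 := bmfD _ _ (hp 2%N n) (hp 4%N n).
    have q2 := bmfB _ _ (bmf_cst 1) (hp 0%N n).
    rewrite (RintD gam _ _ (bmfZ _ _ q1) (bmfZ _ _ q2)) (RintZ gam _ _ q1) (RintZ gam _ _ q2).
    rewrite (RintD gam _ _ (hp _ _) (hp _ _)) (RintB gam _ _ (bmf_cst 1) (hp _ _)).
    rewrite [Rint gam (fun=> 1)](_ : _ = 1)//.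
    by rewrite Rintegral_cst// mul1r; exact: (congr1 fine (@probability_setT _ _ _ gam)).
  apply: Rint_le => //; first by apply: bmf_norm; exact: bmfB.
  move=> z; rewrite /itv_ind; case: (- n%:R <= z <= n%:R)%R => /=.
    rewrite expr0 expr1 !mulr1 subrr mulr0 addr0.
    have := hT x (a * z).
    rewrite normrM (ger0_norm a0) exprMn => h.
    have -> : g x + g1 x * a * z + g2 x * (a ^+ 2 / 2) * z ^+ 2 =
      g x + g1 x * (a * z) + g2 x * ((a ^+ 2 * z ^+ 2) / 2) by ring.
    apply: (le_trans h).
    have -> : M * (a * `|z|) ^+ 3 = (M * a ^+ 3) * (`|z| ^+ 3) by ring.
    have p0 : 0 <= M * a ^+ 3 by rewrite mulr_ge0 ?exprn_ge0.
    rewrite [leRHS](_ : _ = M * a ^+ 3 * ((z ^+ 2 + z ^+ 4) / 2)); last by ring.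
    apply: ler_wpM2l => //.
    have -> : z ^+ 4 = (`|z| ^+ 2) ^+ 2 by rewrite real_normK ?num_real// -exprM.
    have -> : z ^+ 2 = `|z| ^+ 2 by rewrite real_normK ?num_real.
    have := normr_ge0 z; set t := `|z| => t0.
    have : 0 <= t ^+ 2 * (t - 1) ^+ 2 by rewrite mulr_ge0 ?sqr_ge0.
    by lra.
  by rewrite !mulr0 !addr0 mulr0 subr0 subr0 mulr1 add0r gB.
have cm0 : (fun n => m 0%N n.+1) @ \oo --> (1 : R).
  rewrite (cvg_shiftS (m 0%N)) (_ : m 0%N = fun n => Rint gam (itv_ind n%:R)); last exact/funext.
  exact: cvg_itv_ind.
have ceps : (fun n => eps n.+1) @ \oo --> (0 : R).
  by rewrite (cvg_shiftS eps); exact: cvg_mul_normal_pdf.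
have cQ : (fun n => Q n.+1) @ \oo --> g x + g2 x * (a ^+ 2 / 2).
  rewrite (_ : (fun n => Q n.+1) = (fun n => g x * m 0%N n.+1 + g2 x * (a ^+ 2 / 2) * (m 0%N n.+1 - 2 * eps n.+1))); last first.
    by apply/funext => n; rewrite /Q m1 m2; ring.
  rewrite [X in _ --> X](_ : _ = g x * 1 + g2 x * (a ^+ 2 / 2) * (1 - 2 * 0)); last by ring.
  apply: cvgD; first by apply: cvgM; [exact: cvg_cst|].
  apply: cvgM; first exact: cvg_cst.
  by apply: cvgB => //; apply: cvgM; [exact: cvg_cst|].
have cR : (fun n => 2 * M * a ^+ 3 + B * (1 - m 0%N n.+1)) @ \oo --> 2 * M * a ^+ 3.
  rewrite [X in _ --> X](_ : _ = 2 * M * a ^+ 3 + B * (1 - 1)); last by ring.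
  apply: cvgD; first exact: cvg_cst.
  by apply: cvgM; [exact: cvg_cst|apply: cvgB => //; exact: cvg_cst].
have cL : (fun n => `|Rint gam (fun z => g (x + a * z)) - Q n.+1|) @ \oo -->
  `|Rint gam (fun z => g (x + a * z)) - (g x + g2 x * (a ^+ 2 / 2))|.
  by apply: cvg_norm; apply: cvgB => //; exact: cvg_cst.
apply: (ler_cvg_to cL cR); apply: nearW => n.
apply: (le_trans (key n.+1)); rewrite lerD2r.
have p0 : 0 <= M * a ^+ 3 by rewrite mulr_ge0 ?exprn_ge0.
have : m 2%N n.+1 + m 4%N n.+1 <= 4.
  by have := m4 n; have := m2 n; have := h1 n.+1; have := eps0 n.+1; lra.
move: p0; set p := M * a ^+ 3 => p0 h.
rewrite -[leRHS]mulrA -/p mulrAC.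
by rewrite -mulrA [leRHS](_ : _ = p * (4 / 2)); [apply: ler_wpM2l => //; lra|lra].
Qed.

(** * Approximation by functions with a cubic Taylor remainder *)

Section smooth_functions.
Context {R : realType}.
Implicit Types (g h : R -> R) (x z : R).

(** Taylor's bound serves for [|z| <= 1]; for larger [z] the difference is at most
    [2 * B0 <= 2 * B0 * |z|]. *)
Lemma taylor3_lipschitz g g1 g2 (M : R) :
  (exists B, forall x, `|g x| <= B) -> (exists B, forall x, `|g1 x| <= B) ->
  (exists B, forall x, `|g2 x| <= B) -> 0 <= M ->
  (forall x z, `|g (x + z) - (g x + g1 x * z + g2 x * (z ^+ 2 / 2))| <= M * `|z| ^+ 3) ->
  exists2 L, 0 <= L & forall x z, `|g (x + z) - g x| <= L * `|z|.
Proof.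
move=> [B0 h0] [B1 h1] [B2 h2] M0 hT.
have b0 : 0 <= B0 := le_trans (normr_ge0 _) (h0 0).
have b1 : 0 <= B1 := le_trans (normr_ge0 _) (h1 0).
have b2 : 0 <= B2 := le_trans (normr_ge0 _) (h2 0).
exists (B1 + B2 + M + 2 * B0); first by rewrite !addr_ge0// mulr_ge0.
move=> x z; have [z1|z1] := lerP `|z| 1.
  have := hT x z; set r := (X in `|X| <= _) => hr.
  have -> : g (x + z) - g x = r + g1 x * z + g2 x * (z ^+ 2 / 2) by rewrite /r; ring.
  have t0 := normr_ge0 z.
  have e1 : `|g1 x * z| <= B1 * `|z| by rewrite normrM ler_wpM2r.
  have e2 : `|g2 x * (z ^+ 2 / 2)| <= B2 * `|z|.
    rewrite normrM; apply: ler_pM => //.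
    rewrite normrM normrX [`|2^-1|]ger0_norm//.
    by move: z1 t0; set t := `|z| => z1 t0; nra.
  have e3 : M * `|z| ^+ 3 <= M * `|z|.
    apply: ler_wpM2l => //; rewrite -[leRHS]mulr1 exprS ler_wpM2l//.
    by rewrite exprn_ile1.
  apply: (le_trans (ler_normD _ _)); apply: (le_trans (lerD (ler_normD _ _) (lexx _))).
  have : 0 <= B0 * `|z| by rewrite mulr_ge0.
  by lra.
apply: (le_trans (ler_normB _ _)).
have := h0 (x + z); have := h0 x.
have : B0 <= B0 * `|z| by rewrite ler_peMr// ltW.
have : 0 <= (B1 + B2 + M) * `|z| by rewrite mulr_ge0// !addr_ge0.
by lra.
Qed.

Lemma lipschitz_continuous g L :
  (forall x z, `|g (x + z) - g x| <= L * `|z|) -> continuous g.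
Proof.
move=> hL x; apply/cvgrPdist_lt => e e0.
have L1 : 0 < `|L| + 1 by rewrite ltr_wpDl.
near=> y.
have := hL x (y - x); rewrite (addrC x) subrK distrC => h; apply: (le_lt_trans h).
apply: (@le_lt_trans _ _ ((`|L| + 1) * `|y - x|)).
  by apply: ler_wpM2r => //; rewrite (le_trans (ler_norm _))// lerDl.
rewrite mulrC -ltr_pdivlMr//.
rewrite distrC; near: y; apply: cvgr_dist_lt => //; exact: divr_gt0.
Unshelve. all: by end_near. Qed.

Lemma smooth3_build g g1 g2 (M : R) : bmf g -> bmf g1 -> bmf g2 -> 0 <= M ->
  (forall x z, `|g (x + z) - (g x + g1 x * z + g2 x * (z ^+ 2 / 2))| <= M * `|z| ^+ 3) ->
  smooth3 g g1 g2 M.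
Proof.
move=> hg hg1 hg2 M0 hT; split => //.
have [L _ hL] := taylor3_lipschitz g g1 g2 M hg.2 hg1.2 hg2.2 M0 hT.
exact: (lipschitz_continuous _ L).
Qed.

Definition smooth_test g := exists g1 g2 M, 0 <= M /\ smooth3 g g1 g2 M.

Lemma smooth_test_cst (c : R) : smooth_test (fun=> c).
Proof.
exists (fun=> 0), (fun=> 0), 0; split => //.
apply: smooth3_build => //; try exact: bmf_cst.
by move=> x z; rewrite !mul0r !addr0 subrr normr0.
Qed.

Lemma smooth_testD g h : smooth_test g -> smooth_test h -> smooth_test (fun x => g x + h x).
Proof.
move=> [g1 [g2 [M [M0 [hg hg1 hg2 _ gT]]]]] [h1 [h2 [N [N0 [hh hh1 hh2 _ hT]]]]].
exists (fun x => g1 x + h1 x), (fun x => g2 x + h2 x), (M + N); split; first exact: addr_ge0.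
apply: smooth3_build; rewrite ?addr_ge0//; try exact: bmfD.
move=> x z; rewrite [X in `|X|](_ : _ = (g (x + z) - (g x + g1 x * z + g2 x * (z ^+ 2 / 2))) +
  (h (x + z) - (h x + h1 x * z + h2 x * (z ^+ 2 / 2)))); last by ring.
by rewrite (le_trans (ler_normD _ _))// mulrDl lerD.
Qed.

Lemma smooth_test_affine (c b a : R) g : smooth_test g ->
  smooth_test (fun x => c * g (b * x + a)).
Proof.
move=> [g1 [g2 [M [M0 [hg hg1 hg2 _ gT]]]]].
have maff : measurable_fun setT (fun x : R => b * x + a).
  by apply: measurable_funD => //; exact: measurable_funM.
exists (fun x => c * b * g1 (b * x + a)), (fun x => c * b ^+ 2 * g2 (b * x + a)),
  (`|c| * (M * `|b| ^+ 3)).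
split; first by rewrite !mulr_ge0// exprn_ge0.
apply: smooth3_build.
- by apply: bmfZ; exact: bmf_comp.
- by apply: bmfZ; exact: bmf_comp.
- by apply: bmfZ; exact: bmf_comp.
- by rewrite !mulr_ge0// exprn_ge0.
- move=> x z; rewrite [b * (x + z) + a](_ : _ = b * x + a + b * z); last by ring.
  rewrite [X in `|X|](_ : _ = c * (g (b * x + a + b * z) - (g (b * x + a) + g1 (b * x + a) * (b * z)
    + g2 (b * x + a) * ((b * z) ^+ 2 / 2)))); last by ring.
  rewrite normrM -[leRHS]mulrA; apply: ler_wpM2l => //.
  by apply: (le_trans (gT _ _)); rewrite normrM exprMn mulrA.
Qed.

Definition tpow (k : nat) (x : R) : R := Num.max x 0 ^+ k.

(** The second derivative [6 * tpow 1] of [tpow 3] is Lipschitz with constant 6, so the remainder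
    has constant [6 / 3! = 1]. The cases are the signs of [x] and [x + z]. *)
Lemma tpow_taylor x z :
  `|tpow 3 (x + z) - (tpow 3 x + 3 * tpow 2 x * z + 6 * tpow 1 x * (z ^+ 2 / 2))| <= `|z| ^+ 3.
Proof.
rewrite /tpow /Num.max.
have [x0|x0] := ltP x 0; have [y0|y0] := ltP (x + z) 0.
- by rewrite !expr0n /= !mulr0 !mul0r !addr0 subrr normr0 exprn_ge0.
- rewrite !expr0n /= !mulr0 !mul0r !addr0 subr0 ger0_norm ?exprn_ge0//.
  have z0 : 0 <= z by lra.
  by rewrite ger0_norm// lerXn2r// ?nnegrE//; lra.
- have z0 : z <= 0 by lra.
  rewrite expr0n/= (ler0_norm z0) ler_norml.
  have u0 : 0 <= (- (x + z)) ^+ 3 by rewrite exprn_ge0//; lra.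
  have u1 : (- (x + z)) ^+ 3 <= (- z) ^+ 3 by rewrite lerXn2r// ?nnegrE; lra.
  by move: u0 u1; rewrite !exprS !expr0 => u0 u1; apply/andP; split; lra.
- rewrite [X in `|X|](_ : _ = z ^+ 3); last by field.
  by rewrite normrX.
Qed.

(** Third backward difference, with step 1, of the truncated power: for [k] from 1 to 3 it vanishes
    left of 0 and is constant right of 3. At [k = 3] its sixth part is the integral of the quadratic
    B-spline with knots 0, 1, 2, 3. *)
Definition sdiff (k : nat) (x : R) : R :=
  tpow k x - 3 * tpow k (x - 1) + 3 * tpow k (x - 2) - tpow k (x - 3).

Lemma measurable_tpow k (a : R) : measurable_fun setT (fun x => tpow k (x - a)).
Proof.
apply: measurable_funX; apply: (@measurable_maxr _ _ _ _ (fun x => x - a) (fun=> 0)) => //.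
exact: measurable_funB.
Qed.

Lemma bmf_sdiff k : (0 < k <= 3)%N -> bmf (sdiff k).
Proof.
move=> k3; split.
  rewrite /sdiff; have h a := measurable_tpow k a.
  apply: measurable_funB => //; apply: measurable_funD; last exact: measurable_funM.
  apply: measurable_funB; last exact: measurable_funM.
  by have := h 0; under eq_fun do rewrite subr0.
(* Any bound will do: on [[0, 3]] the powers are at most 27, and beyond 3 the polynomials cancel to
   a constant. *)
exists 300 => x; rewrite /sdiff /tpow /Num.max.
case: k k3 => [//|[|[|[|//]]]] _; rewrite !exprS !expr0 ler_norml.
- by do 4! (case: ltP => ?; try (exfalso; lra)); apply/andP; split; lra.
- by do 4! (case: ltP => ?; try (exfalso; lra)); apply/andP; split; nra.
- by do 4! (case: ltP => ?; try (exfalso; lra)); apply/andP; split; nra.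
Qed.

Definition sstep (x : R) : R := sdiff 3 x / 6.

Lemma sstep_le0 x : x <= 0 -> sstep x = 0.
Proof.
move=> x0; rewrite /sstep /sdiff /tpow /Num.max; rewrite !exprS !expr0.
by do 4! (case: ltP => ?; try (exfalso; lra)); nra.
Qed.

Lemma sstep_ge3 x : 3 <= x -> sstep x = 1.
Proof.
move=> x0; rewrite /sstep /sdiff /tpow /Num.max; rewrite !exprS !expr0.
by do 4! (case: ltP => ?; try (exfalso; lra)); field.
Qed.

Lemma sstep01 x : 0 <= sstep x <= 1.
Proof.
rewrite /sstep /sdiff /tpow /Num.max; rewrite !exprS !expr0.
case: (ltP x 0) => x0; case: (ltP (x - 1) 0) => x1; case: (ltP (x - 2) 0) => x2;
  case: (ltP (x - 3) 0) => x3; try (exfalso; lra); apply/andP; split; try lra.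
- have : 0 <= x * x * x by rewrite !mulr_ge0.
  by lra.
- have p1 : 0 <= x * x * (1 - x) by rewrite !mulr_ge0//; lra.
  have p2 : 0 <= x * (1 - x) by rewrite mulr_ge0//; lra.
  by lra.
- have p1 : 0 <= (x - 1) * (x - 1) * (2 - x) by rewrite !mulr_ge0//; lra.
  have p2 : 0 <= (x - 1) * (x - 1) by rewrite mulr_ge0.
  by lra.
- have p1 : 0 <= (x - 2) * (x - 2) * (x + 1) by rewrite mulr_ge0 -?expr2 ?sqr_ge0//; lra.
  have p2 : 0 <= (x - 1) * (2 - x) by rewrite mulr_ge0//; lra.
  by lra.
- have p1 : 0 <= (3 - x) * (3 - x) * (x - 2) by rewrite !mulr_ge0//; lra.
  have p2 : 0 <= (3 - x) * (x - 2) by rewrite mulr_ge0//; lra.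
  by lra.
- have p1 : 0 <= (3 - x) * (3 - x) * (3 - x) by rewrite !mulr_ge0//; lra.
  by lra.
Qed.

Lemma smooth_sstep : smooth_test sstep.
Proof.
exists (fun x => 2^-1 * sdiff 2 x), (fun x => sdiff 1 x), 2; split => //.
apply: smooth3_build => //.
- apply: (bmf_ext (fun x => 6^-1 * sdiff 3 x)); first by apply: bmfZ; exact: bmf_sdiff.
  by move=> x; rewrite mulrC.
- by apply: bmfZ; exact: bmf_sdiff.
- exact: bmf_sdiff.
- move=> x z.
  have e0 := tpow_taylor x z.
  have e1 := tpow_taylor (x - 1) z.
  have e2 := tpow_taylor (x - 2) z.
  have e3 := tpow_taylor (x - 3) z.
  move: e0 e1 e2 e3; rewrite /sstep /sdiff.
  rewrite -!(addrAC x z).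
  rewrite !ler_norml => /andP[? ?] /andP[? ?] /andP[? ?] /andP[? ?].
  by apply/andP; split; lra.
Qed.

(** Induction on the number of cells. On [[t, t + dl]] the step [sstep], rescaled by [3 / dl],
    interpolates between [h t] and [h (t + dl)]; values of [g] remain convex combinations of two
    values of [h], which preserves the bound [M0]. The error is [e] for the variation of [h] on the
    cell plus [e] for that of [g]. *)
Lemma step_approx h (M0 e t0 dl : R) (n : nat) :
  0 < dl -> (forall x, `|h x| <= M0) ->
  (forall x y, t0 <= x <= t0 + n%:R * dl -> `|y - x| <= dl -> `|h y - h x| <= e) ->
  exists2 g, smooth_test g &
   [/\ forall x, t0 + n%:R * dl <= x -> g x = h (t0 + n%:R * dl),
       forall x, `|g x| <= M0 &
       forall x, t0 <= x <= t0 + n%:R * dl -> `|h x - g x| <= 2 * e].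
Proof.
move=> dl0 hM; elim: n => [|n IH] hu.
  exists (fun=> h t0); first exact: smooth_test_cst.
  split => [x|x|x]; rewrite ?mul0r ?addr0//.
  move=> /andP[h1 h2]; have -> : x = t0 by apply/eqP; rewrite eq_le h1 h2.
  rewrite subrr normr0 mulr_ge0//.
  by have := hu t0 t0; rewrite mul0r addr0 lexx !subrr normr0 => /(_ isT (ltW dl0)).
have [x y xy xyd|g sg [g1 g2 g3]] := IH.
  apply: hu => //; move: xy => /andP[-> /le_trans -> //].
  by rewrite lerD2l; apply: ler_wpM2r; [exact: ltW|rewrite ler_nat].
set t := t0 + n%:R * dl in g1 g3 *.
have tS : t0 + n.+1%:R * dl = t + dl by rewrite /t -natr1; ring.
rewrite tS in hu *.
have tt0 : t0 <= t by rewrite lerDl mulr_ge0// ltW.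
exists (fun x => g x + (h (t + dl) - h t) * sstep (3 / dl * x + (- 3 * t / dl))).
  by apply: smooth_testD => //; apply: smooth_test_affine; exact: smooth_sstep.
have sE x : 3 / dl * x + (- 3 * t / dl) = 3 * ((x - t) / dl) by ring.
have sl x : x <= t -> sstep (3 / dl * x + (- 3 * t / dl)) = 0.
  move=> xt; apply: sstep_le0; rewrite sE pmulr_rle0//.
  by rewrite pmulr_lle0 ?invr_gt0// subr_le0.
have sg1 x : t + dl <= x -> sstep (3 / dl * x + (- 3 * t / dl)) = 1.
  move=> xt; apply: sstep_ge3; rewrite sE -[leLHS]mulr1 ler_pM2l// ler_pdivlMr// mul1r.
  by rewrite lerBrDl.
split.
- move=> x xt; rewrite sg1// g1; first by ring.
  by apply: le_trans xt; rewrite lerDl ltW.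
- move=> x; have [xt|xt] := lerP x t; first by rewrite sl// mulr0 addr0.
  rewrite (g1 _ (ltW xt)); have := sstep01 (3 / dl * x + (- 3 * t / dl)).
  set th := sstep _ => /andP[th0 th1].
  have := hM (t + dl); have := hM t; rewrite !ler_norml => /andP[? ?] /andP[? ?].
  by apply/andP; split; nra.
- move=> x /andP[x0 x1]; have [xt|xt] := lerP x t.
    by rewrite sl// mulr0 addr0; apply: g3; rewrite x0.
  rewrite (g1 _ (ltW xt)); have := sstep01 (3 / dl * x + (- 3 * t / dl)).
  set th := sstep _ => /andP[th0 th1].
  have a1 : `|h x - h t| <= e.
    apply: hu; first by rewrite tt0 lerDl ltW.
    by rewrite ler_norml; apply/andP; split; lra.
  have a2 : `|h (t + dl) - h t| <= e.
    apply: hu; first by rewrite tt0 lerDl ltW.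
    by rewrite ler_norml; apply/andP; split; lra.
  rewrite opprD addrA (le_trans (ler_normB _ _))//.
  rewrite [leRHS](_ : _ = e + e); last by ring.
  apply: lerD => //; rewrite normrM (ger0_norm th0).
  rewrite -[leRHS]mulr1; apply: ler_pM => //.
Qed.

Lemma uniform_continuous_itv h (K e : R) : continuous h -> 0 < e ->
  exists2 dl, 0 < dl & forall x y, - K <= x <= K -> `|y - x| <= dl -> `|h y - h x| <= e.
Proof.
move=> ch e0.
have cK : compact `[- K, K] by exact: segment_compact.
have := (compact_near_coveringP _).1 cK R (0^'+)%classic
  (fun dl x => forall y, `|y - x| <= dl -> `|h y - h x| <= e) _.
case.
  move=> x _.
  have e20 : 0 < e / 2 by rewrite divr_gt0.
  have /cvgrPdist_le/(_ _ e20) := ch x.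
  move=> /nbhs_ballP[eta /= eta0 heta].
  exists (ball x (eta / 2), [set dl | dl < eta / 2]) => /=.
    split; first by apply: nbhsx_ballx; rewrite divr_gt0.
    by apply: nbhs_right_lt; rewrite divr_gt0.
  move=> [u dl] /= [xu dle] y yu.
  have h1 : `|h x - h u| <= e / 2.
    by apply: heta; apply: le_ball xu; rewrite ler_pdivrMr// ler_pMr// ler1n.
  have h2 : `|h x - h y| <= e / 2.
    apply: heta; rewrite /ball/=; move: xu; rewrite /ball/= => xu.
    rewrite -(subrKA u) (le_lt_trans (ler_normD _ _))// [ltRHS](splitr eta).
    by rewrite ltrD// distrC (le_lt_trans yu).
  rewrite -(subrKA (h x)) (le_trans (ler_normD _ _))// [leRHS](splitr e) lerD//.
  by rewrite distrC.
move=> dl /= dl0 hdl.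
exists (dl / 2); first by rewrite divr_gt0.
move=> x y xK; apply: (hdl (dl / 2)).
- by rewrite /= sub0r normrN gtr0_norm ?divr_gt0// ltr_pdivrMr// ltr_pMr// ltr1n.
- by rewrite divr_gt0.
- by rewrite /= in_itv.
Qed.

Lemma smooth_test_approx h (M0 K e : R) : continuous h -> (forall x, `|h x| <= M0) ->
  0 < K -> 0 < e ->
  exists2 g, smooth_test g & (forall x, `|g x| <= M0) /\
    forall x, - K <= x <= K -> `|h x - g x| <= e.
Proof.
move=> ch hM K0 e0.
have e20 : 0 < e / 2 by rewrite divr_gt0.
have [dl0 dl00 hdl] := uniform_continuous_itv h K (e / 2) ch e20.
pose n := (Num.truncn (2 * K / dl0)).+1.
have nlt : 2 * K / dl0 < n%:R by exact: truncnS_gt.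
pose dl := 2 * K / n%:R.
have n0 : 0 < n%:R :> R by rewrite ltr0n.
have dlp : 0 < dl by rewrite divr_gt0// mulr_gt0.
have dle : dl <= dl0.
  by rewrite /dl ler_pdivrMr// [leRHS]mulrC -ler_pdivrMr// ltW.
have KE : - K + n%:R * dl = K by rewrite /dl; field; rewrite gt_eqF.
have [|g sg [_ g2 g3]] := step_approx h M0 (e / 2) (- K) dl n dlp hM.
  move=> x y; rewrite KE => xK xy; apply: hdl => //; exact: le_trans dle.
exists g => //; split => // x; rewrite -{2}KE => /g3; rewrite mulrC divfK//.
Qed.

End smooth_functions.

Lemma Rint1 {dT} {T : measurableType dT} {R : realType} (P : probability T R) (c : R) :
  Rint P (fun=> c) = c.
Proof. by rewrite Rintegral_cst// [fine _](_ : _ = 1) ?mulr1//; exact: (congr1 fine (@probability_setT _ _ _ P)). Qed.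

Lemma dist_chain {R : realFieldType} (a b c d f e : R) :
  `|b - c| <= e / 8 -> `|a - b| <= 2 * (e / 8) -> `|c - d| <= e / 8 -> `|d - f| <= 2 * (e / 8) ->
  0 < e -> `|a - f| <= e.
Proof.
move=> h1 h2 h3 h4 e0.
have := ler_distD b a f; have := ler_distD c b f; have := ler_distD d c f.
lra.
Qed.

(** * Lindeberg's replacement method *)

Section clt.
Context {dT dS : measure_display} {T : measurableType dT} {S : measurableType dS} {R : realType}.
Variables (P : probability T R) (V : nat -> T -> S) (z : S -> R).
Hypothesis iidV : iid_seq P V.
Hypothesis hz : bmf z.
Hypothesis z0 : Rint P (fun x => z (V 0%N x)) = 0.

Local Notation gam := (@normal_prob R 0 1).
Local Notation s2 := (Rint P (fun x => z (V 0%N x) ^+ 2)).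
Local Notation Sum n x := (\sum_(i < n) z (V i x)).

Lemma bmf_zV i : bmf (fun x => z (V i x)).
Proof. by apply: bmf_comp => //; exact: iid_measurable iidV i. Qed.

Lemma bmf_Sum n : bmf (fun x => Sum n x).
Proof. by apply: bmf_sum => i _; exact: bmf_zV. Qed.

Lemma variance_sum n : Rint P (fun x => (Sum n x) ^+ 2) = n%:R * s2.
Proof.
elim: n => [|n IH].
  under eq_fun do rewrite big_ord0 expr0n.
  by rewrite Rint1 mul0r.
have hz2 : bmf (fun x => z (V n x) * z (V n x)) by apply: bmfM; exact: bmf_zV.
have hS2 : bmf (fun x => Sum n x * Sum n x) by apply: bmfM; exact: bmf_Sum.
have hc : bmf (fun x => \sum_(i < n) (z (V i x) * z (V n x))).
  by apply: bmf_sum => i _; apply: bmfM; exact: bmf_zV.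
rewrite (_ : (fun x => _) = fun x => Sum n x * Sum n x +
   2 * (\sum_(i < n) (z (V i x) * z (V n x))) + z (V n x) * z (V n x)); last first.
  by apply/funext => x; rewrite big_ord_recr /= -big_distrl /=; ring.
rewrite (RintD P _ _ (bmfD _ _ hS2 (bmfZ 2 _ hc)) hz2) (RintD P _ _ hS2 (bmfZ 2 _ hc)) (RintZ P _ _ hc).
have -> : Rint P (fun x => Sum n x * Sum n x) = n%:R * s2.
  by rewrite -IH; congr Rintegral; apply/funext => x; rewrite expr2.
have -> : Rint P (fun x => z (V n x) * z (V n x)) = s2.
  rewrite (iid_Rint _ _ iidV n (fun v => z v * z v)); last exact: bmfM.
  by congr Rintegral.
rewrite Rint_sum; last by move=> i _; apply: bmfM; exact: bmf_zV.
rewrite big1 => [|i _]; first by rewrite mulr0 addr0 -natr1; ring.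
rewrite (iid_Rint2 _ _ iidV i n (fun p => z p.1 * z p.2)) /=.
- rewrite -[RHS](Rint1 P); congr Rintegral; apply/funext => x.
  by rewrite RintZ ?z0 ?mulr0//; exact: bmf_zV.
- by rewrite neq_ltn ltn_ord.
- apply: bmfM; first exact: (bmf_comp fst).
  exact: (bmf_comp snd).
Qed.

Lemma bmf_average c g : bmf g -> bmf (fun x : R => Rint P (fun y => g (x + c * z (V 0%N y)))).
Proof.
move=> hg.
have hF : bmf (fun p : R * T => g (p.1 + c * z (V 0%N p.2))).
  apply: (bmf_comp (fun p : R * T => p.1 + c * z (V 0%N p.2))) => //.
  apply: measurable_funD => //; apply: measurable_funM => //.
  exact: (measurableT_comp (proj1 (bmf_zV 0)) measurable_snd).
exact: (bmf_Rint gam P _ hF).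
Qed.

Lemma bmf_shift (c : R) (g : R -> R) x : bmf g -> bmf (fun y => g (x + c * z (V 0%N y))).
Proof.
move=> hg; apply: (bmf_comp (fun y => x + c * z (V 0%N y))) => //.
apply: measurable_funD => //; apply: measurable_funM => //.
by have [] := bmf_zV 0.
Qed.

(** Averaging over one more independent summand keeps the same [M]; this prevents the errors of
    successive replacements from growing. *)
Lemma smooth3_average c g g1 g2 M : 0 <= M -> smooth3 g g1 g2 M ->
  smooth3 (fun x : R => Rint P (fun y => g (x + c * z (V 0%N y))))
    (fun x => Rint P (fun y => g1 (x + c * z (V 0%N y))))
    (fun x => Rint P (fun y => g2 (x + c * z (V 0%N y)))) M.
Proof.
move=> M0 [hg hg1 hg2 cg hT].
apply: smooth3_build => //; try exact: bmf_average.
move=> x w.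
have a0 := bmf_shift c g (x + w) hg.
have a1 := bmf_shift c g x hg.
have a2 := bmf_shift c g1 x hg1.
have a3 := bmf_shift c g2 x hg2.
have b2 : bmf (fun y => w * g1 (x + c * z (V 0%N y))) by exact: bmfZ.
have b3 : bmf (fun y => w ^+ 2 / 2 * g2 (x + c * z (V 0%N y))) by exact: bmfZ.
rewrite [Rint P (fun y => g1 _) * w]mulrC [_ * (w ^+ 2 / 2)]mulrC -(RintZ P w _ a2) -(RintZ P (w ^+ 2 / 2) _ a3).
rewrite -(RintD P _ _ a1 b2) -(RintD P _ _ (bmfD _ _ a1 b2) b3) -(RintB P _ _ a0 (bmfD _ _ (bmfD _ _ a1 b2) b3)).
apply: (le_trans (Rint_norm P _ (bmfB _ _ a0 (bmfD _ _ (bmfD _ _ a1 b2) b3)))).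
rewrite -[leRHS](Rint1 P); apply: Rint_le.
- exact/bmf_norm/(bmfB _ _ a0 (bmfD _ _ (bmfD _ _ a1 b2) b3)).
- exact: bmf_cst.
- move=> y; have := hT (x + c * z (V 0%N y)) w.
  by rewrite (addrAC x w) [g1 _ * w]mulrC [g2 _ * _]mulrC.
Qed.

(** As [z] has mean 0 the linear term disappears, and the expansion agrees to second order with that
    of a normal variable of variance [c ^+ 2 * s2]. *)
Lemma average_taylor2 c g g1 g2 M B x : 0 <= c -> 0 <= M -> (forall v, `|z v| <= B) ->
  smooth3 g g1 g2 M ->
  `|Rint P (fun y => g (x + c * z (V 0%N y))) - (g x + g2 x * (c ^+ 2 * s2 / 2))| <= M * (c * B) ^+ 3.
Proof.
move=> c0 M0 zB [hg hg1 hg2 cg hT].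
have a0 := bmf_shift c g x hg.
have hzV := bmf_zV 0.
have a1 : bmf (fun y => g1 x * c * z (V 0%N y)) by exact: bmfZ.
have hz2 : bmf (fun y => z (V 0%N y) ^+ 2).
  by apply: (bmf_ext (fun y => z (V 0%N y) * z (V 0%N y))) => //; exact: bmfM.
have a2 : bmf (fun y => g2 x * c ^+ 2 / 2 * z (V 0%N y) ^+ 2) by exact: bmfZ.
have ac := @bmf_cst _ T R (g x).
have -> : g x + g2 x * (c ^+ 2 * s2 / 2) = Rint P (fun y => g x + g1 x * c * z (V 0%N y) + g2 x * c ^+ 2 / 2 * z (V 0%N y) ^+ 2).
  rewrite (RintD P _ _ (bmfD _ _ ac a1) a2) (RintD P _ _ ac a1) (RintZ P _ _ hzV) (RintZ P _ _ hz2) z0 Rint1.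
  by ring.
rewrite -(RintB P _ _ a0 (bmfD _ _ (bmfD _ _ ac a1) a2)).
apply: (le_trans (Rint_norm P _ (bmfB _ _ a0 (bmfD _ _ (bmfD _ _ ac a1) a2)))).
rewrite -[leRHS](Rint1 P); apply: Rint_le.
- exact/bmf_norm/(bmfB _ _ a0 (bmfD _ _ (bmfD _ _ ac a1) a2)).
- exact: bmf_cst.
- move=> y; rewrite -[g1 x * c * _]mulrA.
  have := hT x (c * z (V 0%N y)).
  rewrite [g2 x * ((c * _) ^+ 2 / 2)](_ : _ = g2 x * c ^+ 2 / 2 * z (V 0%N y) ^+ 2); last by ring.
  move=> h; apply: (le_trans h); apply: ler_wpM2l => //.
  rewrite normrM (ger0_norm c0); apply: lerXn2r; rewrite ?nnegrE ?mulr_ge0//.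
    exact: le_trans (zB (V 0%N y)).
  exact: ler_wpM2l.
Qed.

Lemma s2_ge0 : 0 <= s2.
Proof. by apply: Rint_ge0 => x; exact: sqr_ge0. Qed.

(** Induction on [n] for all test functions at once. Independence turns the last summand into an
    averaging of [g], and [gauss_convolution] splits one normal variable off the other side; the
    induction hypothesis applies to the averaged function. The one exchange that remains costs the
    two cubic remainders, as the second-order expansions coincide. *)
Lemma lindeberg_step c B n g g1 g2 M x : 0 <= c -> 0 <= M -> (forall v, `|z v| <= B) ->
  smooth3 g g1 g2 M ->
  `|Rint P (fun y => g (x + c * Sum n y)) -
    Rint gam (fun w => g (x + Num.sqrt n%:R * (c * Num.sqrt s2) * w))|
  <= n%:R * (M * (c * B) ^+ 3 + 2 * M * (c * Num.sqrt s2) ^+ 3).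
Proof.
move=> c0 M0 zB; set s := c * Num.sqrt s2; set K := (X in _ <= n%:R * X).
have s0 : 0 <= s by rewrite mulr_ge0// sqrtr_ge0.
have sE : s ^+ 2 = c ^+ 2 * s2 by rewrite exprMn sqr_sqrtr// s2_ge0.
elim: n g g1 g2 x => [|n IH] g g1 g2 x sg.
  rewrite mul0r sqrtr0.
  under eq_fun do rewrite big_ord0 mulr0 addr0.
  under [X in _ - Rintegral _ _ X]eq_fun do rewrite !mul0r addr0.
  by rewrite !Rint1 subrr normr0.
have [hg hg1 hg2 cg hT] := sg.
pose Ag (u : R) := Rint P (fun y => g (u + c * z (V 0%N y))).
have sAg : smooth3 Ag _ _ M := smooth3_average c g g1 g2 M M0 sg.
have [hAg _ _ cAg _] := sAg.
have -> : Rint P (fun y => g (x + c * Sum n.+1 y)) = Rint P (fun y => Ag (x + c * Sum n y)).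
  under eq_fun do rewrite big_ord_recr /= mulrDr addrA.
  rewrite (iid_Rint_sum _ _ iidV z n (fun p => g (x + c * p.1 + c * p.2)) hz)//.
  apply: (bmf_comp (fun p : R * R => x + c * p.1 + c * p.2)) => //.
  by apply: measurable_funD; [apply: measurable_funD => //|]; apply: measurable_funM.
have maff (u v : R) : measurable_fun setT (fun w : R => u + v * w).
  by apply: measurable_funD => //; exact: measurable_funM.
set r := Num.sqrt n%:R * s.
have r0 : 0 <= r by rewrite mulr_ge0// sqrtr_ge0.
have -> : Rint gam (fun w => g (x + Num.sqrt n.+1%:R * s * w)) =
    Rint gam (fun w => Rint gam (fun y => g (x + r * w + s * y))).
  rewrite gauss_convolution//; congr Rintegral; apply/funext => w; congr (g (x + _ * w)).
  have -> : r ^+ 2 + s ^+ 2 = n.+1%:R * s ^+ 2 by rewrite exprMn sqr_sqrtr// -natr1; ring.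
  by rewrite sqrtrM// sqrtr_sqr ger0_norm.
have hTg : bmf (fun w => Rint gam (fun y => g (x + r * w + s * y))).
  have hG : bmf (fun p : R * R => g (x + r * p.1 + s * p.2)).
    apply: (bmf_comp (fun p : R * R => x + r * p.1 + s * p.2)) => //.
    by apply: measurable_funD; [apply: measurable_funD => //|]; apply: measurable_funM.
  exact: (bmf_Rint gam gam _ hG).
have hAr : bmf (fun w => Ag (x + r * w)) by exact: (bmf_comp (fun w => x + r * w)).
rewrite -(subrKA (Rint gam (fun w => Ag (x + r * w)))) (le_trans (ler_normD _ _))//.
rewrite -natr1 mulrDl mul1r; apply: lerD; first exact: (IH _ _ _ x sAg).
rewrite -(RintB gam _ _ hAr hTg).
apply: (le_trans (Rint_norm gam _ (bmfB _ _ hAr hTg))).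
rewrite -[leRHS](Rint1 gam); apply: Rint_le.
- exact/bmf_norm/(bmfB _ _ hAr hTg).
- exact: bmf_cst.
- move=> w; set u := x + r * w.
  have e1 := average_taylor2 c g g1 g2 M B u c0 M0 zB sg.
  have e2 := normal_taylor2 g g1 g2 M s u sg s0 M0.
  rewrite sE in e2.
  rewrite -(subrKA (g u + g2 u * (c ^+ 2 * s2 / 2))) (le_trans (ler_normD _ _))//.
  by rewrite lerD// distrC.
Qed.

Lemma clt_smooth g : smooth_test g ->
  (fun n => Rint P (fun y => g ((Num.sqrt n%:R)^-1 * Sum n y))) @ \oo -->
  Rint gam (fun w => g (Num.sqrt s2 * w)).
Proof.
move=> [g1 [g2 [M [M0 sg]]]].
have [B B0 zB] := bmf_bound _ hz.
rewrite -(cvg_shiftS (fun n => Rint P _)).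
set L := Rint gam _.
set K := M * B ^+ 3 + 2 * M * Num.sqrt s2 ^+ 3.
have K0 : 0 <= K by rewrite addr_ge0// !mulr_ge0// exprn_ge0// sqrtr_ge0.
have bound n : `|L - Rint P (fun y => g ((Num.sqrt n.+1%:R)^-1 * Sum n.+1 y))| <= K / Num.sqrt n.+1%:R.
  set q := Num.sqrt n.+1%:R.
  have q0 : 0 < q by rewrite sqrtr_gt0.
  have c0 : 0 <= q^-1 by rewrite invr_ge0 ltW.
  have := lindeberg_step q^-1 B n.+1 g g1 g2 M 0 c0 M0 zB sg.
  rewrite -/q distrC.
  have -> : (fun y => g (0 + q^-1 * Sum n.+1 y)) = (fun y => g (q^-1 * Sum n.+1 y)).
    by apply/funext => y; rewrite add0r.
  have -> : Rint gam (fun w => g (0 + q * (q^-1 * Num.sqrt s2) * w)) = L.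
    by congr Rintegral; apply/funext => w; rewrite add0r mulrA divff ?gt_eqF// mul1r.
  have qq : n.+1%:R = q ^+ 2 by rewrite sqr_sqrtr.
  rewrite [n.+1%:R]qq => h; apply: (le_trans h).
  by rewrite le_eqVlt; apply/orP; left; apply/eqP; rewrite /K; field; rewrite gt_eqF.
apply/cvgrPdist_le => e e0.
near=> n; apply: (le_trans (bound n)).
have hq : 0 < Num.sqrt n.+1%:R :> R by rewrite sqrtr_gt0.
rewrite ler_pdivrMr// mulrC -ler_pdivrMr//.
rewrite -[leLHS]ger0_norm ?divr_ge0 ?(ltW e0)// -sqrtr_sqr ler_wsqrtr//.
rewrite (@le_trans _ _ n%:R)// ?ler_nat//.
by near: n; exact: nbhs_infty_ger.
Unshelve. all: by end_near. Qed.

(** A perturbation tending to 0 in mean is harmless because smooth tests are Lipschitz. Passing to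
    bounded continuous tests requires tightness: outside [[-K, K]] the two tests differ by at most
    [2 * M0], and the mass there is controlled by the mean of [|X n|] on one side and by the normal
    law on the other. *)
Theorem clt_perturbed (X : nat -> T -> R) : (forall n, bmf (X n)) ->
  (fun n => Rint P (fun x => `|X n x - (Num.sqrt n%:R)^-1 * Sum n x|)) @ \oo --> (0 : R) ->
  conv_in_law_normal P X s2.
Proof.
move=> hX XS h ch [M0 hM].
have M00 : 0 <= M0 := le_trans (normr_ge0 _) (hM 0).
have mh : measurable_fun setT h by exact: continuous_measurable_fun.
have hh : bmf h by split => //; exists M0.
pose s := Num.sqrt s2.
have s0 : 0 <= s by exact: sqrtr_ge0.
have msw : measurable_fun setT (fun w : R => s * w) by exact: measurable_funM.
have hhs : bmf (fun w => h (s * w)) by exact: (bmf_comp (fun w => s * w)).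
rewrite [X in _ --> X](_ : _ = Rint gam (fun w => h (s * w))); last by rewrite Rint_normal_prob.
pose Sn n x := (Num.sqrt n%:R)^-1 * Sum n x.
have hS n : bmf (Sn n) by apply: bmfZ; exact: bmf_Sum.
have hD n : bmf (fun x => `|X n x - Sn n x|) by apply: bmf_norm; exact: bmfB.
have ES2 n : Rint P (fun x => Sn n x ^+ 2) <= s2.
  rewrite (_ : (fun x => _) = fun x => (Num.sqrt n%:R)^-1 ^+ 2 * (Sum n x * Sum n x)); last first.
    by apply/funext => x; rewrite /Sn exprMn -[in RHS]expr2.
  rewrite RintZ; last by apply: bmfM; exact: bmf_Sum.
  rewrite (_ : (fun x => _ * _) = fun x => Sum n x ^+ 2); last by apply/funext => x; rewrite expr2.
  rewrite variance_sum exprVn sqr_sqrtr//.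
  case: n => [|n]; first by rewrite !mul0r mulr0 s2_ge0.
  by rewrite mulKf.
(* From [|X| <= |X - S| + 1 + S^2], whose mean is eventually at most [1 + 1 + s2]. *)
have EX : \forall n \near \oo, Rint P (fun x => `|X n x|) <= 2 + s2.
  have /cvgrPdist_le/(_ _ ltr01) := XS.
  apply: filterS => n; rewrite sub0r normrN => hn.
  have {}hn : Rint P (fun x => `|X n x - Sn n x|) <= 1 := le_trans (ler_norm _) hn.
  have hS2 : bmf (fun x => Sn n x ^+ 2).
    by apply: (bmf_ext (fun x => Sn n x * Sn n x)) => //; exact: bmfM.
  have h1 : bmf (fun x => `|X n x - Sn n x| + 1) by apply: bmfD => //; exact: bmf_cst.
  apply: (@le_trans _ _ (Rint P (fun x => `|X n x - Sn n x| + 1 + Sn n x ^+ 2))).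
    apply: Rint_le; [exact: bmf_norm|exact: bmfD|].
    move=> x; rewrite -[X in `|X| <= _](subrK (Sn n x)) (le_trans (ler_normD _ _))// -addrA lerD2l.
    rewrite -[Sn n x ^+ 2]real_normK ?num_real//.
    by have := sqr_ge0 (`|Sn n x| - 1); have := sqr_ge0 `|Sn n x|; lra.
  rewrite (RintD P _ _ h1 hS2) (RintD P _ _ (hD n) (bmf_cst 1)) Rint1.
  by have := ES2 n; lra.
apply/cvgrPdist_le => e e0.
(* The four comparisons joined by [dist_chain] spend [e1] six times in all. *)
pose e1 := e / 8.
have e10 : 0 < e1 by rewrite divr_gt0.
have [K [K0 KE KG]] : exists K, [/\ 0 < K, 2 * M0 * (2 + s2) / K <= e1 &
    2 * M0 * (1 - Rint gam (fun w => itv_ind K (s * w))) <= e1].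
  have cI : (fun n : nat => Rint gam (fun w => itv_ind n%:R (s * w))) @ \oo --> (1 : R).
    rewrite -[X in _ --> X](Rint1 gam 1).
    apply: (Rint_cvg gam _ _ 1).
    - by move=> n; apply: measurableT_comp => //; exact: measurable_itv_ind.
    - by move=> n x; have /andP[h0 h1] := itv_ind01 n%:R (s * x); rewrite ger0_norm.
    - move=> x; apply: cvg_near_cst; near=> n.
      rewrite /itv_ind -ler_norml (_ : (_ <= _) = true)//.
      by near: n; exact: nbhs_infty_ger.
  have e2 : 0 < e1 / (2 * M0 + 1) by rewrite divr_gt0// ltr_wpDl// mulr_ge0.
  have : \forall n \near \oo, `|1 - Rint gam (fun w => itv_ind n%:R (s * w))| <= e1 / (2 * M0 + 1).
    by move/cvgrPdist_le : cI; exact.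
  have : \forall n \near \oo, (0 < n)%N by exact: nbhs_infty_gt.
  have : \forall n \near \oo, 2 * M0 * (2 + s2) / e1 <= n%:R by exact: nbhs_infty_ger.
  move=> H1 H2 H3.
  have [n [[A1 A2] A3]] := filter_ex (filterI (filterI H1 H2) H3).
  exists n%:R; rewrite ltr0n; split => //.
    by rewrite ler_pdivrMr ?ltr0n// [leRHS]mulrC -ler_pdivrMr.
  move: A3; rewrite ler_pdivlMr ?ltr_wpDl ?mulr_ge0// => A3.
  apply: le_trans A3.
  have := ler_norm (1 - Rint gam (fun w => itv_ind n%:R (s * w))).
  have := normr_ge0 (1 - Rint gam (fun w => itv_ind n%:R (s * w))).
  set t := `|_|; set u := 1 - _ => t0 ut.
  have : M0 * u <= M0 * t by exact: ler_wpM2l.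
  by lra.
have [g sg [gM gK]] := smooth_test_approx h M0 K e1 ch hM K0 e10.
have [g1 [g2 [M [MM0 [hg hg1 hg2 cg gT]]]]] := sg.
have [L L0 gL] := taylor3_lipschitz g g1 g2 M hg.2 hg1.2 hg2.2 MM0 gT.
have env y : `|h y - g y| <= e1 + 2 * M0 * (1 - itv_ind K y).
  rewrite /itv_ind; case: (boolP (- K <= y <= K)%R) => [yK|_] /=.
    by rewrite subrr mulr0 addr0; exact: gK.
  rewrite subr0 mulr1 (le_trans (ler_normB _ _))//.
  by have := hM y; have := gM y; have := ltW e10; lra.
(* Markov's inequality in pointwise form: the indicator of [K < |y|] is at most [|y| / K]. *)
have env' y : `|h y - g y| <= e1 + 2 * M0 / K * `|y|.
  rewrite [_ / K * _](_ : _ = 2 * M0 * (`|y| / K)); last by ring.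
  apply: (le_trans (env y)); rewrite lerD2l; apply: ler_wpM2l; first exact: mulr_ge0.
  rewrite /itv_ind -ler_norml; case: (leP `|y| K) => yK /=.
    by rewrite subrr divr_ge0// ltW.
  by rewrite subr0 ler_pdivlMr// mul1r ltW.
have hgs : bmf (fun w => g (s * w)) by exact: (bmf_comp (fun w => s * w)).
have G1 : `|Rint gam (fun w => h (s * w)) - Rint gam (fun w => g (s * w))| <= 2 * e1.
  rewrite -(RintB gam _ _ hhs hgs); apply: (le_trans (Rint_norm gam _ (bmfB _ _ hhs hgs))).
  have hI : bmf (fun w => itv_ind K (s * w)) by apply: (bmf_comp (fun w => s * w)) => //; exact: bmf_itv_ind.
  have hI' : bmf (fun w => 2 * M0 * (1 - itv_ind K (s * w))).
    by apply: bmfZ; apply: bmfB => //; exact: bmf_cst.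
  apply: (@le_trans _ _ (Rint gam (fun w => e1 + 2 * M0 * (1 - itv_ind K (s * w))))).
    apply: Rint_le => //; first exact/bmf_norm/(bmfB _ _ hhs hgs).
    by apply: bmfD => //; exact: bmf_cst.
  rewrite (RintD gam _ _ (bmf_cst e1) hI') Rint1 (RintZ gam _ _ (bmfB _ _ (bmf_cst 1) hI)).
  by rewrite (RintB gam _ _ (bmf_cst 1) hI) Rint1; lra.
have C1 := clt_smooth g sg.
have near1 : \forall n \near \oo, `|Rint gam (fun w => g (s * w)) - Rint P (fun x => g (Sn n x))| <= e1.
  by move/cvgrPdist_le : C1; exact.
have e3 : 0 < e1 / (L + 1) by rewrite divr_gt0// ltr_wpDl.
have near2 : \forall n \near \oo, Rint P (fun x => `|X n x - Sn n x|) <= e1 / (L + 1).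
  have /cvgrPdist_le/(_ _ e3) := XS.
  by apply: filterS => n; rewrite sub0r normrN; exact: le_trans (ler_norm _).
near=> n.
have n1 : `|Rint gam (fun w => g (s * w)) - Rint P (fun x => g (Sn n x))| <= e1 by near: n.
have n2 : Rint P (fun x => `|X n x - Sn n x|) <= e1 / (L + 1) by near: n.
have n3 : Rint P (fun x => `|X n x|) <= 2 + s2 by near: n.
have hgS : bmf (fun x => g (Sn n x)) by apply: bmf_comp => //; case: (hS n).
have hgX : bmf (fun x => g (X n x)) by apply: bmf_comp => //; case: (hX n).
have hhX : bmf (fun x => h (X n x)) by apply: bmf_comp => //; case: (hX n).
have G2 : `|Rint P (fun x => g (Sn n x)) - Rint P (fun x => g (X n x))| <= e1.
  rewrite -(RintB P _ _ hgS hgX); apply: (le_trans (Rint_norm P _ (bmfB _ _ hgS hgX))).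
  apply: (@le_trans _ _ (Rint P (fun x => L * `|X n x - Sn n x|))).
    apply: Rint_le; [exact/bmf_norm/(bmfB _ _ hgS hgX)|exact: bmfZ|].
    by move=> x; have := gL (Sn n x) (X n x - Sn n x); rewrite (addrC (Sn n x)) subrK distrC.
  rewrite RintZ//.
  have r0 : 0 <= Rint P (fun x => `|X n x - Sn n x|) by exact: Rint_ge0.
  move: n2; rewrite ler_pdivlMr ?ltr_wpDl//; lra.
have G3 : `|Rint P (fun x => g (X n x)) - Rint P (fun x => h (X n x))| <= 2 * e1.
  rewrite -(RintB P _ _ hgX hhX); apply: (le_trans (Rint_norm P _ (bmfB _ _ hgX hhX))).
  have hXn : bmf (fun x => `|X n x|) by exact: bmf_norm.
  have hXm : bmf (fun x => 2 * M0 / K * `|X n x|) by exact: bmfZ.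
  apply: (@le_trans _ _ (Rint P (fun x => e1 + 2 * M0 / K * `|X n x|))).
    apply: Rint_le; [exact/bmf_norm/(bmfB _ _ hgX hhX)|by apply: bmfD => //; exact: bmf_cst|].
    by move=> x; rewrite distrC.
  rewrite (RintD P _ _ (bmf_cst e1) hXm) Rint1 (RintZ P _ _ hXn).
  have : 2 * M0 / K * Rint P (fun x => `|X n x|) <= 2 * M0 / K * (2 + s2).
    by apply: ler_wpM2l => //; rewrite !mulr_ge0// invr_ge0 ltW.
  move: KE; rewrite mulrAC => KE; lra.
exact: (dist_chain _ _ _ _ _ _ n1 G1 G2 G3 e0).
Unshelve. all: by end_near. Qed.

End clt.

(** * Measurability on the Borel cube *)

Lemma upd_id {R : realType} {d : nat} (u : 'I_d -> R) j : upd u j (u j) = u.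
Proof. by apply/funext => k; rewrite /upd; case: eqP => [->|]. Qed.

Section boolean_measurability.
Context {dT : measure_display} {T : measurableType dT} {R : realType}.

Lemma bmf_bool (b : T -> bool) : measurable_fun setT b -> bmf (fun x => (b x)%:R : R).
Proof.
move=> mb; apply: bmf_indicb.
by have := mb measurableT [set true] I; rewrite setTI.
Qed.

Lemma measurable_forall (I : finType) (b : I -> T -> bool) :
  (forall i, measurable_fun setT (b i)) -> measurable_fun setT (fun x => [forall i, b i x]).
Proof.
move=> mb.
rewrite (_ : (fun x => _) = fun x => all (fun i => b i x) (enum I)); last first.
  apply/funext => x; apply/forallP/allP => [h i _|h i]; first exact: h.
  by apply: h; rewrite mem_enum.
elim: (enum I) => [|i s IH] /=; first exact: measurable_cst.
exact: measurable_and.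
Qed.

End boolean_measurability.

Definition vle {R : realType} {d : nat} (u v : 'I_d -> R) : bool := [forall j, u j <= v j].
Definition vlt {R : realType} {d : nat} (u v : 'I_d -> R) : bool := [forall j, u j < v j].
Definition in_cube {R : realType} {d : nat} (u : 'I_d -> R) : bool := [forall j, 0 <= u j <= 1].
(** Projection onto [[0, 1]]. Hypotheses that concern the cube only become, after composition with
    it, statements about functions on the whole space. *)
Definition clamp1 {R : realType} (t : R) : R := Num.max 0 (Num.min 1 t).
Definition clamp {R : realType} {d : nat} (u : 'I_d -> R) : 'I_d -> R := fun j => clamp1 (u j).

Section clamp.
Context {R : realType} {d : nat}.
Implicit Types (u v : 'I_d -> R) (t : R).

Lemma vleP u v : reflect (forall j, u j <= v j) (vle u v).
Proof. exact: forallP. Qed.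

Lemma vltP u v : reflect (forall j, u j < v j) (vlt u v).
Proof. exact: forallP. Qed.

Lemma in_cubeP u : reflect (cube d u) (in_cube u).
Proof. exact: forallP. Qed.

Lemma clamp1_01 t : 0 <= clamp1 t <= 1.
Proof. by rewrite /clamp1 le_max lexx /= ge_max ler01 ge_min lexx. Qed.

Lemma clamp1_id t : 0 <= t <= 1 -> clamp1 t = t.
Proof. by move=> /andP[t0 t1]; rewrite /clamp1 min_r// max_r. Qed.

Lemma cube_clamp u : cube d (clamp u).
Proof. by move=> j; exact: clamp1_01. Qed.

Lemma clamp_id u : cube d u -> clamp u = u.
Proof. by move=> hu; apply/funext => j; exact: clamp1_id. Qed.

End clamp.

Section borelRd.
Context {R : realType} {d : nat}.
Local Notation Rd := (borelRd R d).

Lemma measurable_orthant (b : 'I_d -> R) : measurable (orthant b : set Rd).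
Proof. by apply: sub_sigma_algebra; exists b. Qed.

(** The half-space [u j <= x] is a countable union of orthants whose other bounds are all equal to
    an integer [n], since every point lies below a large enough [n]. *)
Lemma measurable_coord (j : 'I_d) : measurable_fun setT (fun u : Rd => u j : R).
Proof.
apply: (@measurability _ _ Rd R setT _ _ (RGenOInfty.measurableE R)) => _ [_ [x ->] <-].
rewrite setTI (_ : _ @^-1` _ = ~` \bigcup_n orthant (fun k => if k == j then x else n%:R)).
  apply: measurableC; apply: bigcup_measurable => n _; exact: measurable_orthant.
apply/seteqP; split => [u /=|u /= h].
  rewrite in_itv/= andbT => ux [n _ /(_ j)]; rewrite eqxx => le.
  by have := lt_le_trans ux le; rewrite ltxx.
rewrite in_itv/= andbT ltNge; apply/negP => ux; apply: h.
pose n := \max_(k < d) (Num.truncn `|u k|).+1.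
exists n => // k; case: eqP => [->//|_].
apply: (le_trans (ler_norm _)); apply: (le_trans (ltW (truncnS_gt _))).
by rewrite ler_nat /n (bigD1 k)//= leq_maxl.
Qed.

Lemma measurable_vec {dT} {T : measurableType dT} (X : T -> Rd) :
  (forall j, measurable_fun setT (fun x => X x j : R)) -> measurable_fun setT X.
Proof.
move=> mX.
apply: (@measurability _ _ T Rd setT X (orthants R d) erefl) => _ [_ [b _ <-] <-].
rewrite setTI.
have : measurable_fun setT (fun x => [forall j, (X x j : R) <= b j]).
  by apply: measurable_forall => j; apply: measurable_fun_ler => //; exact: mX.
move=> /(_ measurableT [set true] I); rewrite setTI => h.
have -> // : X @^-1` orthant b = (fun x => [forall j, (X x j : R) <= b j]) @^-1` [set true].
by apply/seteqP; split => x /= hx; [apply/forallP|apply/forallP].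
Qed.

Lemma measurable_clamp1 : measurable_fun setT (@clamp1 R).
Proof.
have h : measurable_fun setT (fun t : R => Num.min 1 t).
  rewrite (_ : (fun t => _) = cst 1 \min (id : R -> R))//.
  exact: measurable_minr.
rewrite (_ : clamp1 = cst 0 \max (fun t : R => Num.min 1 t))//.
exact: measurable_maxr.
Qed.

Lemma measurable_clamp : measurable_fun setT (clamp : Rd -> Rd).
Proof.
apply: measurable_vec => j; apply: measurableT_comp (measurable_clamp1) _; exact: measurable_coord.
Qed.

Lemma measurable_in_cube : measurable_fun setT (in_cube : Rd -> bool).
Proof.
apply: measurable_forall => j; apply: measurable_and;
  by apply: measurable_fun_ler => //; exact: measurable_coord.
Qed.

Lemma measurable_cube : measurable (cube d : set Rd).
Proof.
have := measurable_in_cube measurableT [set true] I; rewrite setTI.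
by rewrite (_ : _ @^-1` _ = cube d)//; apply/seteqP; split => x /= /in_cubeP.
Qed.

Lemma bmf_vle {dT} {T : measurableType dT} (X Y : T -> Rd) :
  measurable_fun setT X -> measurable_fun setT Y -> bmf (fun x => (vle (X x) (Y x))%:R : R).
Proof.
move=> mX mY; apply: bmf_bool; apply: measurable_forall => j; apply: measurable_fun_ler.
- exact: (measurableT_comp (measurable_coord j) mX).
- exact: (measurableT_comp (measurable_coord j) mY).
Qed.

Lemma bmf_vlt {dT} {T : measurableType dT} (X Y : T -> Rd) :
  measurable_fun setT X -> measurable_fun setT Y -> bmf (fun x => (vlt (X x) (Y x))%:R : R).
Proof.
move=> mX mY; apply: bmf_bool; apply: measurable_forall => j; apply: measurable_fun_ltr.
- exact: (measurableT_comp (measurable_coord j) mX).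
- exact: (measurableT_comp (measurable_coord j) mY).
Qed.

(** For [0 <= t < 1], the first point strictly above [t] on the grid of mesh [2 ^- n]; the minimum
    with 1 keeps it in the cube. By strictness, a sequence tending to [t] is eventually below it. *)
Definition dyadic_up (n : nat) (t : R) : R :=
  Num.min 1 ((Num.truncn (t * 2 ^+ n)).+1%:R / 2 ^+ n).

Lemma dyadic_up_01 n t : 0 <= dyadic_up n t <= 1.
Proof. by rewrite /dyadic_up le_min ler01 divr_ge0//= ge_min lexx. Qed.

Lemma dyadic_up_ge n t : t <= 1 -> t <= dyadic_up n t.
Proof.
move=> t1; rewrite /dyadic_up le_min t1/= ler_pdivlMr ?exprn_gt0//.
exact/ltW/truncnS_gt.
Qed.

Lemma dyadic_up_le n t : 0 <= t -> dyadic_up n t <= t + (2 ^+ n)^-1.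
Proof.
move=> t0; rewrite /dyadic_up ge_min; apply/orP; right.
rewrite ler_pdivrMr ?exprn_gt0// mulrDl mulVf ?gt_eqF ?exprn_gt0//.
by rewrite -natr1 lerD2r truncn_le// mulr_ge0// exprn_ge0.
Qed.

Lemma dyadic_up_decr n t : 0 <= t -> dyadic_up n.+1 t <= dyadic_up n t.
Proof.
move=> t0; rewrite /dyadic_up le_min ge_min lexx /= ge_min; apply/orP; right.
set m := Num.truncn (t * 2 ^+ n); rewrite ler_pdivrMr ?exprn_gt0//.
rewrite [leRHS](_ : _ = (m.+1 * 2)%:R); last first.
  by rewrite natrM exprS; field; rewrite gt_eqF// exprn_gt0.
rewrite exprS ler_nat.
have h : t * (2 * 2 ^+ n) < (m.+1 * 2)%:R.
  by rewrite natrM mulrCA mulrC ltr_pM2r// truncnS_gt.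
suff : (Num.truncn (t * (2 * 2 ^+ n)) < m.+1 * 2)%N by [].
rewrite -(ltr_nat R); apply: le_lt_trans h.
by rewrite truncn_le// !mulr_ge0// exprn_ge0.
Qed.

Lemma cvg_dyadic_up t : 0 <= t <= 1 -> (fun n => dyadic_up n t) @ \oo --> t.
Proof.
move=> /andP[t0 t1].
apply: (@squeeze_cvgr _ _ _ _ (fun n : nat => t) (fun n => t + (2 ^+ n)^-1)).
- by apply: nearW => n; rewrite dyadic_up_ge//= dyadic_up_le.
- exact: cvg_cst.
- rewrite -[X in _ --> X]addr0; apply: cvgD; first exact: cvg_cst.
  rewrite (_ : (fun n => _) = fun n => (2^-1 : R) ^+ n); last by apply/funext => n; rewrite exprVn.
  by apply: cvg_expr; rewrite ger0_norm// invf_lt1// ltr1n.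
Qed.

(** By right-continuity the function is the pointwise limit of its values at the points
    [dyadic_up n]; each approximation takes finitely many values, on products of dyadic
    intervals. *)
Lemma right_continuous_bmf (f : Rd -> R) : right_continuous_cube f ->
  (exists M, forall u, cube d u -> `|f u| <= M) -> bmf (fun u : Rd => f (clamp u)).
Proof.
move=> rf [M fM].
pose fn n (u : Rd) := f (fun j => dyadic_up n (clamp1 (u j))).
apply: (bmf_lim fn _ M) => [n|n u|u]; last 2 first.
- by apply: fM => j; exact: dyadic_up_01.
- apply: (rf (clamp u) (fun n j => dyadic_up n (clamp1 (u j)))).
  + exact: cube_clamp.
  + by move=> n j; exact: dyadic_up_01.
  + by move=> n j; apply: dyadic_up_decr; have /andP[] := clamp1_01 (u j).
  + by move=> j; apply: cvg_dyadic_up; exact: clamp1_01.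
pose N := (2 ^ n).+1.
pose k (u : Rd) j := Num.truncn (clamp1 (u j) * 2 ^+ n).
have kN u j : (k u j < N)%N.
  rewrite /N ltnS -(ler_nat R) natrX; have /andP[c0 c1] := clamp1_01 (u j).
  apply: (@le_trans _ _ (clamp1 (u j) * 2 ^+ n)).
    by rewrite truncn_le// mulr_ge0// exprn_ge0.
  by rewrite ler_piMl// exprn_ge0.
have fnE u : fn n u = \sum_(q : {ffun 'I_d -> 'I_N})
    f (fun j => Num.min 1 ((q j).+1%:R / 2 ^+ n)) * ([forall j, k u j == q j])%:R.
  pose q0 := [ffun j => Ordinal (kN u j)].
  rewrite (bigD1 q0)//= big1 ?addr0.
    rewrite (_ : [forall j, _]) ?mulr1; last by apply/forallP => j; rewrite ffunE.
    by congr f; apply/funext => j; rewrite ffunE.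
  move=> q qq0; rewrite (_ : [forall j, _] = false) ?mulr0//.
  apply/negbTE/forallP => h; move/eqP : qq0; apply; apply/ffunP => j.
  by apply/val_inj; rewrite ffunE /=; apply/esym/eqP/h.
rewrite (funext fnE); apply: measurable_sum => q; apply: measurable_funM => //.
apply: (proj1 (bmf_bool (fun u => [forall j, k u j == q j]) _)).
apply: measurable_forall => j.
rewrite (_ : (fun u => _) = fun u : Rd => ((q j)%:R <= clamp1 (u j) * 2 ^+ n) && (clamp1 (u j) * 2 ^+ n < (q j).+1%:R)).
  have mc : measurable_fun setT (fun u : Rd => clamp1 (u j) * 2 ^+ n).
    apply: measurable_funM => //; apply: measurableT_comp measurable_clamp1 _; exact: measurable_coord.
  by apply: measurable_and; [exact: measurable_fun_ler|exact: measurable_fun_ltr].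
apply/funext => u; rewrite /k -truncn_eq ?mulr_ge0 ?exprn_ge0//.
by have /andP[] := clamp1_01 (u j).
Qed.

End borelRd.

Lemma iid_vectors_seq {R : realType} {dT} {T : measurableType dT} (P : probability T R) {d : nat}
  (U : nat -> 'I_d -> T -> R) : iid_vectors P U ->
  iid_seq P (fun i x => (fun j => U i j x) : borelRd R d).
Proof.
move=> [mU idU indU]; split => [i|i B mB|s B us mB].
- by apply: measurable_vec => j; exact: mU.
- exact: idU.
- exact: indU.
Qed.

(** * Linearization of the rank counts *)

Section ranks.
Context {R : realType}.
Variables (n : nat) (x v : nat -> R).
Local Notation rk i := (count (fun k => x k <= x i) (iota 0 n)).
Local Notation cnt t := (count (fun k => x k <= t) (iota 0 n)).
Hypothesis v_lo : forall i, (i < n)%N -> ((rk i)%:R - 1) / n%:R <= v i.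
Hypothesis v_hi : forall i, (i < n)%N -> v i <= (rk i)%:R / n%:R.

Lemma rank_le i (t : R) : x i <= t -> (rk i <= cnt t)%N.
Proof. by move=> xt; apply: sub_count => k /= /le_trans; apply. Qed.

Lemma rank_gt i (t : R) : (i < n)%N -> t < x i -> (cnt t < rk i)%N.
Proof.
move=> ni xt.
have /perm_to_rem p : i \in iota 0 n by rewrite mem_iota.
rewrite (permP p) (permP p (fun k => x k <= x i)) /= lexx leNgt xt /= add0n add1n ltnS.
by apply: sub_count => k /= h; exact: le_trans h (ltW xt).
Qed.

Lemma rank_pos i : (i < n)%N -> (0 < rk i)%N.
Proof. by move=> ni; rewrite -has_count; apply/hasP; exists i; rewrite ?mem_iota. Qed.

(** Ranks are monotone, so [rk i <= cnt t]; the strict inequality on [cnt t] leaves room for [v i]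
    at the upper end of its cell. *)
Lemma lhs_lt i (t u : R) : (i < n)%N -> x i <= t -> (cnt t)%:R < n%:R * u -> v i < u.
Proof.
move=> ni xt cu; have n0 : 0 < n%:R :> R by rewrite ltr0n (leq_trans _ ni).
apply: (le_lt_trans (v_hi i ni)); rewrite ltr_pdivrMr// mulrC.
by apply: le_lt_trans cu; rewrite ler_nat rank_le.
Qed.

(** A point above [t] has rank at least [cnt t + 1], hence [v i >= cnt t / n] even at the lower end
    of its cell. *)
Lemma lhs_ge i (t u : R) : (i < n)%N -> v i < u -> n%:R * u <= (cnt t)%:R -> x i <= t.
Proof.
move=> ni vu cu; have n0 : 0 < n%:R :> R by rewrite ltr0n (leq_trans _ ni).
rewrite leNgt; apply/negP => tx.
have := rank_gt i t ni tx.
apply/negP; rewrite -leqNgt -ltnS -(ltr_nat R) -natr1 -ltrBlDr.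
apply: lt_le_trans cu.
by rewrite mulrC -ltr_pdivrMr//; exact: le_lt_trans (v_lo i ni) vu.
Qed.

Lemma rank_mismatch (u : R) : 0 <= u ->
  (forall i k, (i < n)%N -> (k < n)%N -> x i = x k -> i = k) ->
  (count (fun i => (v i < u) != (x i <= u)) (iota 0 n))%:R <= `|n%:R * u - (cnt u)%:R| + 3.
Proof.
move=> u0 noties.
have [->|n_gt0] := posnP n; first by rewrite /= addr_ge0.
have n0 : 0 < n%:R :> R by rewrite ltr0n.
set m := cnt u; set k := Num.truncn (n%:R * u).
have nu0 : 0 <= n%:R * u by rewrite mulr_ge0.
have /andP[k1 k2] : k%:R <= n%:R * u < k.+1%:R.
  by apply/andP; split; [rewrite truncn_le|exact: truncnS_gt].
set s := [seq i <- iota 0 n | (v i < u) != (x i <= u)].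
have rinj : {in s &, injective (fun i => rk i)}.
  move=> i j; rewrite !mem_filter !mem_iota /= !add0n => /andP[_ ni] /andP[_ nj] rij.
  apply: noties => //; apply/eqP; rewrite eq_le; apply/andP; split; rewrite leNgt; apply/negP => h.
    by have := rank_gt i (x j) ni h; rewrite rij ltnn.
  by have := rank_gt j (x i) nj h; rewrite rij ltnn.
have us : uniq (map (fun i => rk i) s).
  by rewrite map_inj_in_uniq// filter_uniq// iota_uniq.
(* A mismatch [v i < u < x i] has rank in [[m + 1, k + 1]], the opposite one in [[k, m]]. *)
have sub : {subset map (fun i => rk i) s <= iota (minn m k) (maxn m k - minn m k + 2)}.
  move=> _ /mapP[i + ->]; rewrite mem_filter mem_iota /= add0n => /andP[mis ni].
  rewrite mem_iota.
  case: (ltP (v i) u) mis => vu; case: (leP (x i) u) => xu // _.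
    have h1 := rank_gt i u ni xu.
    have h2 : (rk i <= k.+1)%N.
      rewrite -ltnS -(ltr_nat R) -natr1 -ltrBlDr; apply: lt_trans (_ : n%:R * u < _).
        by rewrite mulrC -ltr_pdivrMr//; exact: le_lt_trans (v_lo i ni) vu.
      by rewrite (lt_le_trans k2)// ler_nat.
    by move: h1 h2; rewrite -/m; lia.
  have h1 := rank_le i u xu.
  have h2 : (k <= rk i)%N.
    rewrite -(ler_nat R) (le_trans k1)// mulrC -ler_pdivlMr//.
    exact: le_trans vu (v_hi i ni).
  by move: h1 h2; rewrite -/m; lia.
have := uniq_leq_size us sub; rewrite size_map size_iota -size_filter -/s => h.
apply: (@le_trans _ _ (maxn m k - minn m k + 2)%:R); first by rewrite ler_nat.
have mm : (minn m k <= maxn m k)%N by lia.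
rewrite natrD natrB//.
have hk : `|k%:R - n%:R * u| <= 1 by rewrite ler_norml; move: k2; rewrite -natr1 => k2; apply/andP; split; lra.
have : (maxn m k)%:R - (minn m k)%:R <= `|m%:R - k%:R| :> R.
  by rewrite /maxn /minn; case: ltnP => _; [rewrite distrC|]; exact: ler_norm.
have := ler_distD (n%:R * u) m%:R k%:R; rewrite (distrC (n%:R * u) k%:R) (distrC (n%:R * u) m%:R).
lra.
Qed.

End ranks.

Lemma natr_count {R : realType} (p : pred nat) n :
  (count p (iota 0 n))%:R = \sum_(i < n) (p i)%:R :> R.
Proof.
rewrite -natr_sum; congr (_%:R); rewrite -sum1_count big_mkcond /= -[n in iota 0 n]subn0 -/(index_iota 0 n).
by rewrite big_mkord; apply: eq_bigr => i _; case: (p i).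
Qed.

Section rank_counts.
Context {R : realType} {d : nat}.
Variables (n : nat) (x v : nat -> 'I_d -> R).
Local Notation rk i j := (count (fun k => x k j <= x i j) (iota 0 n)).
Hypothesis v_lo : forall i j, (i < n)%N -> ((rk i j)%:R - 1) / n%:R <= v i j.
Hypothesis v_hi : forall i j, (i < n)%N -> v i j <= (rk i j)%:R / n%:R.

Definition cntv (s : 'I_d -> R) : R := \sum_(i < n) (vle (x i) s)%:R.
Definition cntc (j : 'I_d) (t : R) : R := \sum_(i < n) (x i j <= t)%R%:R.
Definition cntl (u : 'I_d -> R) : R := \sum_(i < n) (vlt (v i) u)%:R.

Lemma cntcE j t : (count (fun k => x k j <= t) (iota 0 n))%:R = cntc j t.
Proof. exact: natr_count. Qed.

(** The alternative [cntc j (s j) = 0] covers a threshold pushed down to 0: no sample point then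
    lies below [s], and the left count is 0. *)
Lemma cntv_le_cntl (s u : 'I_d -> R) :
  (forall j, cntc j (s j) = 0 \/ cntc j (s j) < n%:R * u j) -> cntv s <= cntl u.
Proof.
move=> h; apply: ler_sum => i _; rewrite ler_nat; case: vleP => // xs.
rewrite lt0b; apply/vltP => j.
apply: (lhs_lt n (fun k => x k j) (fun k => v k j) _ i (s j)) => //.
  by move=> k kn; exact: v_hi.
rewrite cntcE; have [h0|//] := h j.
have : 1 <= cntc j (s j).
  by rewrite /cntc (bigD1 i)//= (xs j) lerDl sumr_ge0.
by rewrite h0 ler10.
Qed.

Lemma cntl_le_cntv (s u : 'I_d -> R) :
  (forall j, n%:R * u j <= cntc j (s j)) -> cntl u <= cntv s.
Proof.
move=> h; apply: ler_sum => i _; rewrite ler_nat; case: vltP => // vu.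
rewrite lt0b; apply/vleP => j.
apply: (lhs_ge n (fun k => x k j) (fun k => v k j) _ i (s j) (u j)) => //.
  by move=> k kn; exact: v_lo.
by rewrite cntcE.
Qed.

(** No threshold is moved here. The price is of the order of the marginal fluctuations, but the
    bound holds at every [u] and yields the uniform second-moment estimate. *)
Lemma cntl_cntv_dist (u : 'I_d -> R) : (forall j, 0 <= u j) ->
  (forall j i k, (i < n)%N -> (k < n)%N -> x i j = x k j -> i = k) ->
  `|cntl u - cntv u| <= \sum_(j < d) (`|n%:R * u j - cntc j (u j)| + 3).
Proof.
move=> u0 noties.
apply: (@le_trans _ _ (\sum_(j < d) \sum_(i < n) ((v i j < u j) != (x i j <= u j))%R%:R)).
  rewrite -sumrB exchange_big (le_trans (ler_norm_sum _ _ _))//; apply: ler_sum => i _.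
  case: (boolP (vlt (v i) u == vle (x i) u)) => [/eqP ->|ne].
    by rewrite subrr normr0 sumr_ge0.
  apply: (@le_trans _ _ 1).
    by case: vltP; case: vleP => _ _; rewrite ?subrr ?subr0 ?sub0r ?normrN ?normr1 ?normr0.
  have [j hj] : exists j, (v i j < u j) != (x i j <= u j).
    apply/existsP; apply: contraNT ne; rewrite negb_exists => /forallP h.
    apply/eqP/eq_forallb => j; exact/eqP/negPn/h.
  by rewrite (bigD1 j)//= hj lerDl sumr_ge0.
apply: ler_sum => j _; rewrite -(natr_count (fun i => (v i j < u j)%R != (x i j <= u j)%R) n) -cntcE.
apply: (rank_mismatch n (fun k => x k j) (fun k => v k j)) => //.
- by move=> i ni; exact: v_lo.
- by move=> i ni; exact: v_hi.
- exact: noties.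
Qed.

End rank_counts.

(** * Regularity of the copula *)

Section copula.
Context {R : realType} {dT : measure_display} {T : measurableType dT}.
Variables (P : probability T R) (d : nat) (U : nat -> 'I_d -> T -> R).
Hypothesis iidU : iid_vectors P U.
Hypothesis unifU : uniform_marginals P U.
Local Notation Rd := (borelRd R d).
Local Notation V := (fun i x => (fun j => U i j x) : Rd).
Local Notation C := (copula P U).

Lemma iidV : iid_seq P V.
Proof. exact: iid_vectors_seq. Qed.

Lemma measurable_V i : measurable_fun setT (V i).
Proof. by have [] := iidV. Qed.

Lemma measurable_U i j : measurable_fun setT (U i j).
Proof. by have [] := iidU. Qed.

Lemma bmf_vleV i (s : 'I_d -> R) : bmf (fun x => (vle (V i x) s)%:R : R).
Proof. by apply: (bmf_vle (V i) (fun=> s)) => //; exact: measurable_V. Qed.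

Lemma bmf_le_coord i j (t : R) : bmf (fun x => (U i j x <= t)%R%:R : R).
Proof. by apply: bmf_bool; apply: measurable_fun_ler => //; exact: measurable_U. Qed.

Lemma copulaE (s : 'I_d -> R) : C s = Rint P (fun x => (vle (V 0%N x) s)%:R).
Proof.
have E : [set x | vle (V 0%N x) s] = vec_preimage (U 0%N) (orthant s).
  by apply/seteqP; split => x /= => [/vleP|h]; [|apply/vleP].
rewrite Rint_indicb /copula ?E// -E.
have : measurable_fun setT (fun x => vle (V 0%N x) s).
  by apply: measurable_forall => j; apply: measurable_fun_ler => //; exact: measurable_U.
by move=> /(_ measurableT [set true] I); rewrite setTI.
Qed.

Lemma marginalE j (t : R) : 0 <= t <= 1 -> Rint P (fun x => (U 0%N j x <= t)%R%:R) = t.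
Proof.
move=> t01.
have mb : measurable [set x | U 0%N j x <= t].
  have mf := measurable_fun_ler (measurable_U 0 j) (measurable_cst t).
  by have := mf measurableT [set true] I; rewrite setTI.
transitivity (fine (P [set x | U 0%N j x <= t])); first exact: Rint_indicb.
by rewrite unifU.
Qed.

Lemma marginal_dist j (s t : R) : 0 <= s <= 1 -> 0 <= t <= 1 ->
  Rint P (fun x => `|(U 0%N j x <= s)%R%:R - (U 0%N j x <= t)%R%:R|) = `|s - t|.
Proof.
wlog st : s t / s <= t => [hw|s01 t01].
  have [st|/ltW ts] := leP s t; first exact: hw.
  move=> s01 t01; rewrite distrC -(hw _ _ ts t01 s01); congr Rintegral.
  by apply/funext => x; rewrite distrC.
rewrite distrC ger0_norm ?subr_ge0// -[in RHS](marginalE j t t01) -[in RHS](marginalE j s s01).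
rewrite -RintB; try exact: bmf_le_coord.
congr Rintegral; apply/funext => x; rewrite distrC ger0_norm// subr_ge0 ler_nat.
by case: (leP (U 0%N j x) s) => // /le_trans/(_ st) ->.
Qed.

Lemma vle_dist (y s u : 'I_d -> R) :
  `|(vle y s)%:R - (vle y u)%:R| <= \sum_j `|(y j <= s j)%R%:R - (y j <= u j)%R%:R| :> R.
Proof.
have pos : 0 <= \sum_j `|(y j <= s j)%R%:R - (y j <= u j)%R%:R| :> R by exact: sumr_ge0.
case: (boolP (vle y s == vle y u)) => [/eqP ->|ne]; first by rewrite subrr normr0.
have [j hj] : exists j, (y j <= s j) != (y j <= u j).
  apply/existsP; apply: contraNT ne; rewrite negb_exists => /forallP h.
  apply/eqP/eq_forallb => j; exact/eqP/negPn/h.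
apply: (@le_trans _ _ 1).
  by case: vle; case: vle; rewrite ?subrr ?subr0 ?sub0r ?normrN ?normr1 ?normr0.
rewrite (bigD1 j)//=; apply: ler_wpDr; first exact: sumr_ge0.
by move: hj; case: (_ <= _); case: (_ <= _) => //; rewrite ?subr0 ?sub0r ?normrN normr1.
Qed.

Lemma bmf_dist_coord i j (s t : R) :
  bmf (fun x => `|(U i j x <= s)%R%:R - (U i j x <= t)%R%:R| : R).
Proof. by apply/bmf_norm/bmfB; exact: bmf_le_coord. Qed.

Lemma Rint_vle_dist (s u : 'I_d -> R) : cube d s -> cube d u ->
  Rint P (fun x => `|(vle (V 0%N x) s)%:R - (vle (V 0%N x) u)%:R|) <= \sum_j `|s j - u j|.
Proof.
move=> cs cu.
rewrite [leRHS](_ : _ = Rint P (fun x => \sum_j `|(U 0%N j x <= s j)%R%:R - (U 0%N j x <= u j)%R%:R|)).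
  apply: Rint_le.
  - by apply/bmf_norm/bmfB; exact: bmf_vleV.
  - by apply: bmf_sum => j _; exact: bmf_dist_coord.
  - by move=> x; exact: vle_dist.
rewrite Rint_sum; last by move=> j _; exact: bmf_dist_coord.
by apply: eq_bigr => j _; rewrite marginal_dist.
Qed.

Lemma copula_lipschitz (s u : 'I_d -> R) : cube d s -> cube d u -> `|C s - C u| <= \sum_j `|s j - u j|.
Proof.
move=> cs cu; have hd := bmfB _ _ (bmf_vleV 0 s) (bmf_vleV 0 u).
apply: le_trans (Rint_vle_dist _ _ cs cu).
rewrite !copulaE -RintB; try exact: bmf_vleV.
exact: (Rint_norm P _ hd).
Qed.

Lemma copula_mono (s u : 'I_d -> R) : (forall j, s j <= u j) -> C s <= C u.
Proof.
move=> su; rewrite !copulaE; apply: Rint_le; try exact: bmf_vleV.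
move=> x; rewrite ler_nat; case: vleP => // h.
by rewrite lt0b; apply/vleP => j; exact: le_trans (h j) (su j).
Qed.

Lemma cube_upd (u : 'I_d -> R) j t : cube d u -> 0 <= t <= 1 -> cube d (upd u j t).
Proof. by move=> cu t01 k; rewrite /upd; case: eqP. Qed.

Lemma upd_upd (u : 'I_d -> R) j s t : upd (upd u j s) j t = upd u j t.
Proof. by apply/funext => k; rewrite /upd; case: eqP. Qed.

Lemma copula_upd (u : 'I_d -> R) j s t : cube d u -> 0 <= s -> s <= t -> t <= 1 ->
  0 <= C (upd u j t) - C (upd u j s) <= t - s.
Proof.
move=> cu s0 st t1; apply/andP; split.
  by rewrite subr_ge0; apply: copula_mono => k; rewrite /upd; case: eqP.
have s01 : 0 <= s <= 1 by rewrite s0 (le_trans st).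
have t01 : 0 <= t <= 1 by rewrite t1 (le_trans s0).
apply: (le_trans (ler_norm _)).
apply: (le_trans (copula_lipschitz _ _ (cube_upd u j t cu t01) (cube_upd u j s cu s01))).
rewrite (bigD1 j)//= big1 => [|k kj].
  by rewrite addr0 /upd eqxx ger0_norm// subr_ge0.
by rewrite /upd (negbTE kj) subrr normr0.
Qed.

Variable dC : 'I_d -> ('I_d -> R) -> R.
Hypothesis dCP : forall j u, cube d u -> is_partial_cube C j u (dC j u).
Hypothesis dC_cont : forall j, continuous_on_cube (dC j).

Lemma partialP j (u : 'I_d -> R) (e : R) : cube d u -> 0 < e ->
  exists2 dl, 0 < dl & forall h, `|h| < dl -> h != 0 -> 0 <= u j + h <= 1 ->
    `|dC j u - (C (upd u j (u j + h)) - C u) / h| <= e.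
Proof.
move=> cu e0; have /cvgrPdist_le/(_ e e0) := dCP j u cu.
rewrite /prop_near1 /within /= => /nbhs_ballP[dl /= dl0 hdl].
exists dl => // h hh hn h01; apply: hdl => //=.
by rewrite /ball/= sub0r normrN.
Qed.

(** Difference quotients in one variable lie in [[0, 1]] by [copula_upd]. The increment is positive
    if [u j < 1] and negative at [u j = 1], to stay in the cube. *)
Lemma partial01 j (u : 'I_d -> R) : cube d u -> 0 <= dC j u <= 1.
Proof.
move=> cu.
suff h (e : R) : 0 < e -> - e <= dC j u <= 1 + e.
  apply/andP; split.
    by apply/ler_addgt0Pr => e e0; have /andP[] := h e e0; lra.
  by apply/ler_addgt0Pr => e e0; have /andP[] := h e e0.
move=> e0; have [dl dl0 hdl] := partialP j u e cu e0.
have /andP[u0 u1] := cu j.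
have [h [hn hdl' h01 hq]] : exists h, [/\ h != 0, `|h| < dl, 0 <= u j + h <= 1 &
    0 <= (C (upd u j (u j + h)) - C u) / h <= 1].
  have [u2|u2] := ltP (u j) 1.
    pose h := Num.min (dl / 2) (1 - u j).
    have h0 : 0 < h by rewrite lt_min divr_gt0//= subr_gt0.
    have hle1 : h <= dl / 2 by rewrite ge_min lexx.
    have hle2 : h <= 1 - u j by rewrite ge_min lexx orbT.
    exists h; split; first by rewrite gt_eqF.
    - by rewrite gtr0_norm//; lra.
    - by apply/andP; split; lra.
    - have := copula_upd u j (u j) (u j + h) cu u0; rewrite upd_id.
      move=> /(_ ltac:(lra) ltac:(lra)) /andP[a b].
      by rewrite divr_ge0 ?(ltW h0)//= ler_pdivrMr// mul1r; lra.
  pose h := Num.min (dl / 2) 1.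
  have h0 : 0 < h by rewrite lt_min divr_gt0//= ltr01.
  have hle1 : h <= dl / 2 by rewrite ge_min lexx.
  have hle2 : h <= 1 by rewrite ge_min lexx orbT.
  exists (- h); split; first by rewrite oppr_eq0 gt_eqF.
  - by rewrite normrN gtr0_norm//; lra.
  - by apply/andP; split; lra.
  - have := copula_upd u j (u j - h) (u j) cu; rewrite upd_id.
    move=> /(_ ltac:(lra) ltac:(lra) u1) /andP[a b].
    rewrite invrN mulrN -mulNr opprB.
    by rewrite divr_ge0 ?(ltW h0)//= ler_pdivrMr// mul1r; lra.
by have := hdl h hdl' hn h01; rewrite ler_norml; lra.
Qed.

(** Inside the segment the partial derivative is an ordinary derivative, and the Lipschitz bound
    gives continuity up to the ends, where only one-sided quotients may be available. *)
Lemma copula_MVT j (w : 'I_d -> R) t : cube d w -> 0 <= t <= 1 ->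
  exists2 xi, 0 <= xi <= 1 /\ `|xi - w j| <= `|t - w j| &
    C (upd w j t) - C w = dC j (upd w j xi) * (t - w j).
Proof.
move=> cw t01.
have w01 := cw j.
pose phi x := C (upd w j x).
have dphi (a b x : R) : 0 <= a -> b <= 1 -> x \in `]a, b[%R -> is_derive x 1 phi (dC j (upd w j x)).
  move=> a0 b1; rewrite in_itv /= => /andP[ax xb].
  have x01 : 0 <= x <= 1 by apply/andP; split; lra.
  have c : (fun h => h^-1 *: (phi (h *: (1 : R) + x) - phi x)) @ 0^' --> dC j (upd w j x).
    apply/cvgrPdist_le => e e0.
    have [dl dl0 hdl] := partialP j (upd w j x) e (cube_upd w j x cw x01) e0.
    have E : upd w j x j = x by rewrite /upd eqxx.
    rewrite E in hdl.
    near=> h.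
    have -> : h^-1 *: (phi (h *: (1 : R) + x) - phi x) = (C (upd (upd w j x) j (x + h)) - C (upd w j x)) / h.
      by rewrite upd_upd /phi /GRing.scale/= mulr1 mulrC (addrC h).
    apply: hdl.
    - near: h; apply: dnbhs0_lt => //.
    - near: h; exact: nbhs_dnbhs_neq.
    - have h1 : `|h| < Num.min x (1 - x).
        near: h; apply: dnbhs0_lt; rewrite lt_min; apply/andP; split; lra.
      move: h1; rewrite lt_min !ltr_norml => /andP[/andP[? ?] /andP[? ?]].
      by apply/andP; split; lra.
  split; last by apply: cvg_lim.
  by apply/cvg_ex; exists (dC j (upd w j x)).
have cphi (a b : R) : 0 <= a -> b <= 1 -> {within `[a, b], continuous phi}.
  move=> a0 b1; apply/subspace_continuousP => x; rewrite /= in_itv /= => /andP[ax xb].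
  apply/cvgrPdist_le => e e0.
  near=> y.
  have : y \in `[a, b]%R by near: y; apply: withinT.
  rewrite in_itv /= => /andP[ay yb].
  have x01 : 0 <= x <= 1 by apply/andP; split; lra.
  have y01 : 0 <= y <= 1 by apply/andP; split; lra.
  apply: (le_trans (copula_lipschitz _ _ (cube_upd w j x cw x01) (cube_upd w j y cw y01))).
  rewrite (bigD1 j)//= big1 => [|k kj]; last by rewrite /upd (negbTE kj) subrr normr0.
  rewrite addr0 /upd eqxx.
  by near: y; apply: cvg_within; apply/nbhs_ballP; exists e => //= z /ltW.
have [wt|tw] := leP (w j) t.
  have [||xi] := @MVT_segment R phi (fun x => dC j (upd w j x)) (w j) t wt.
  - by move=> x; apply: dphi; lra.
  - by apply: cphi; lra.
  rewrite in_itv/= /phi upd_id => /andP[xi0 xi1] E; exists xi => //; split.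
    by apply/andP; split; lra.
  by rewrite !ger0_norm; lra.
have [||xi] := @MVT_segment R phi (fun x => dC j (upd w j x)) t (w j) (ltW tw).
- by move=> x; apply: dphi; lra.
- by apply: cphi; lra.
rewrite in_itv/= /phi upd_id => /andP[xi0 xi1] E; exists xi; last by lra.
split; first by apply/andP; split; lra.
by rewrite !ler0_norm; lra.
Unshelve. all: by end_near. Qed.

(** The coordinates of [u] are replaced by those of [s] one at a time, [h k] having the first [k] of
    them; the mean value theorem applies to each increment, at a point where the partial derivative
    is within [eta] of its value at [u]. *)
Lemma copula_differentiable (u : 'I_d -> R) (eta : R) : cube d u -> 0 < eta ->
  exists2 dl, 0 < dl & forall s, cube d s -> (forall j, `|s j - u j| < dl) ->
    `|C s - C u - \sum_j dC j u * (s j - u j)| <= eta * \sum_j `|s j - u j|.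
Proof.
move=> cu eta0.
have [dl dl0 hdl] : exists2 dl, 0 < dl & forall j v, cube d v -> (forall k, `|v k - u k| < dl) ->
    `|dC j v - dC j u| <= eta.
  have hj j := dC_cont j u cu eta eta0.
  pose D j := s2val (cid2 (hj j)).
  have D0 j : 0 < D j by rewrite /D; case: cid2.
  have DP j v : cube d v -> (forall k, `|v k - u k| < D j) -> `|dC j v - dC j u| < eta.
    by rewrite /D; case: cid2 => /= x _; apply.
  exists (\big[Num.min/1]_j D j).
    by apply/bigmin_gtP; split => // j _; exact: D0.
  move=> j v cv hv; apply/ltW/DP => // k; apply: (lt_le_trans (hv k)).
  by rewrite (bigminD1 j)// ge_min lexx.
exists dl => // s cs hs.
pose h (k : nat) : 'I_d -> R := fun j => if (j < k)%N then s j else u j.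
have ch k : cube d (h k) by move=> j; rewrite /h; case: ifP.
have h0 : h 0%N = u by apply/funext => j.
have hd : h d = s by apply/funext => j; rewrite /h ltn_ord.
have hS (k : 'I_d) : h k.+1 = upd (h k) k (s k).
  apply/funext => j; rewrite /h /upd ltnS leq_eqVlt.
  by case: (eqVneq j k) => [->|jk]; rewrite ?eqxx//= (negbTE (_ : nat_of_ord j != k)).
have tele : C s - C u = \sum_(k < d) (C (h k.+1) - C (h k)).
  by rewrite -{1}hd -{1}h0 -(telescope_sumr (fun k => C (h k)))// big_mkord.
rewrite tele -sumrB mulr_sumr (le_trans (ler_norm_sum _ _ _))//; apply: ler_sum => k _.
have hk : h k k = u k by rewrite /h ltnn.
have [xi [xi01 xid] E] := copula_MVT k (h k) (s k) (ch k) (cs k).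
rewrite hS E hk -mulrBl normrM; apply: ler_wpM2r => //.
apply: hdl; first exact: cube_upd.
move=> i; rewrite /upd; case: eqP => [->|_].
  by rewrite -hk (le_lt_trans xid)// hk.
by rewrite /h; case: ifP => // _; rewrite subrr normr0.
Qed.

End copula.

(** * Compensating thresholds on a grid *)

Section grid_choice.
Context {R : realType}.
Implicit Types (q e u r : R) (K k : nat) (A : R -> R).

(** Grid of mesh [e / q] around [u], with index [K] at [u] itself and indices from 0 to [K + K]; in
    use [q] is [sqrt n]. *)
Definition gridpt q e K u k : R := clamp1 (u + e * (k%:R - K%:R) / q).

Lemma gridpt_01 q e K u k : 0 <= gridpt q e K u k <= 1.
Proof. exact: clamp1_01. Qed.

Lemma clamp1_cases r : [\/ r < 0 /\ clamp1 r = 0, 0 <= r <= 1 /\ clamp1 r = r | 1 < r /\ clamp1 r = 1].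
Proof.
have [r0|r0] := ltP r 0.
  by apply: Or31; split => //; rewrite /clamp1 max_l// ge_min (ltW r0) orbT.
have [r1|r1] := leP r 1; first by apply: Or32; split => //; rewrite clamp1_id// r0.
by apply: Or33; split => //; rewrite /clamp1 min_l ?(ltW r1)// max_r.
Qed.

Lemma clamp1_dist u r : 0 <= u <= 1 -> `|clamp1 r - u| <= `|r - u|.
Proof.
move=> /andP[u0 u1]; case: (clamp1_cases r) => -[h ->] //.
  by rewrite !ler0_norm; lra.
by rewrite !ger0_norm; lra.
Qed.

Lemma gridpt_dist q e K u k : 0 < q -> 0 < e -> 0 <= u <= 1 -> (k <= K + K)%N ->
  `|q * (gridpt q e K u k - u)| <= e * K%:R.
Proof.
move=> q0 e0 u01 kK; rewrite normrM (gtr0_norm q0).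
apply: (@le_trans _ _ (q * `|e * (k%:R - K%:R) / q|)).
  rewrite ler_pM2l//; apply: (le_trans (clamp1_dist _ _ u01)).
  by rewrite addrC addKr.
rewrite normrM normfV (gtr0_norm q0) mulrCA mulfV ?gt_eqF// mulr1 normrM (gtr0_norm e0) ler_pM2l//.
move: kK; rewrite -(ler_nat R) natrD => kK; have := ler0n R k; rewrite ler_norml => k0.
by apply/andP; split; lra.
Qed.

(* Moving the threshold [u] by about [- A u / q] compensates the fluctuation [A u / q] of the
   empirical distribution function [t + A t / q] at [u]; the two lemmas do so up to [2 e / q], from
   above and from below. *)
Lemma gridpt_up q e K u A : 0 < q -> 0 < e -> 0 <= u <= 1 -> A 0 = 0 -> A 1 = 0 ->
  `|A u| <= e * (K%:R - 3) -> (0 < u -> e * K%:R / q <= u) ->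
  (forall k, (k <= K + K)%N -> `|A (gridpt q e K u k) - A u| <= e / 2) ->
  exists2 k, (k <= K + K)%N &
    q * u <= q * gridpt q e K u k + A (gridpt q e K u k) /\
    q * (gridpt q e K u k - u) <= - A u + 2 * e.
Proof.
(* [c] is the real index whose displacement is exactly [- A u / q]; the 3 in [AK] keeps the rounded
   index within the grid. *)
move=> q0 e0 u01 A0 A1 AK u0K Ad; set c := K%:R - A u / e.
have AuE : A u = e * (K%:R - c) by rewrite /c; field; rewrite gt_eqF.
have [c3 cK] : 3 <= c /\ c <= K%:R + K%:R - 3.
  by move: AK; rewrite AuE ler_norml => /andP[]; rewrite -mulrN !ler_pM2l// => ? ?; split; lra.
have c0 : 0 <= c by lra.
(* Rounding up by one to two steps leaves a surplus of more than [e], which absorbs the oscillation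
   [e / 2] of [A]. *)
set k := (Num.truncn c + 2)%N.
have k1 : k%:R <= c + 2 by rewrite /k natrD lerD2r truncn_le.
have k2 : c + 1 < k%:R by rewrite /k natrD; have := truncnS_gt c; rewrite -natr1; lra.
have kK : (k <= K + K)%N by rewrite -(ler_nat R) natrD; lra.
have H := Ad k kK; exists k => //; move: H; rewrite /gridpt.
have e1 : e * (k%:R - K%:R) <= - A u + 2 * e.
  by rewrite AuE [leRHS](_ : _ = e * (c + 2 - K%:R)) ?ler_pM2l//; [lra|ring].
have e2 : - A u + e < e * (k%:R - K%:R).
  by rewrite AuE [ltLHS](_ : _ = e * (c + 1 - K%:R)) ?ltr_pM2l//; [lra|ring].
set r := u + _; have qr : q * (r - u) = e * (k%:R - K%:R) by rewrite /r; field; rewrite gt_eqF.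
(* Clamping at 0 would force [u] to be within [e K / q] of 0, hence [u = 0], where [A u = 0] makes
   the displacement positive: this case is void. Clamping at 1 is harmless as [A 1 = 0]. *)
case: (clamp1_cases r) => -[hr ->].
- have ur : q * u < e * K%:R.
    have : q * r < 0 by rewrite pmulr_rlt0.
    have : 0 <= e * k%:R by rewrite mulr_ge0// ltW.
    by move: qr; rewrite !mulrBr; lra.
  have [u0|u0] := ltP 0 u.
    by have := u0K u0; rewrite ler_pdivrMr// mulrC; lra.
  have uE : u = 0 by lra.
  have : 0 < q * r by move: qr e2; rewrite uE A0 subr0; lra.
  by rewrite pmulr_rgt0//; lra.
- by rewrite ler_norml => /andP[? ?]; split; move: qr; rewrite mulrBr; lra.
- move=> _; rewrite A1 addr0; split; first by rewrite ler_pM2l//; lra.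
  apply: (le_trans _ e1); rewrite -qr ler_pM2l//; lra.
Qed.

Lemma gridpt_down q e K u A : 0 < q -> 0 < e -> 0 <= u <= 1 -> A 0 = 0 -> A 1 = 0 ->
  `|A u| <= e * (K%:R - 3) -> (u < 1 -> e * K%:R / q <= 1 - u) ->
  (forall k, (k <= K + K)%N -> `|A (gridpt q e K u k) - A u| <= e / 2) ->
  exists2 k, (k <= K + K)%N &
    (gridpt q e K u k = 0 \/ q * gridpt q e K u k + A (gridpt q e K u k) < q * u) /\
    - A u - 2 * e <= q * (gridpt q e K u k - u).
Proof.
move=> q0 e0 u01 A0 A1 AK u1K Ad; set c := K%:R - A u / e.
have AuE : A u = e * (K%:R - c) by rewrite /c; field; rewrite gt_eqF.
have [c3 cK] : 3 <= c /\ c <= K%:R + K%:R - 3.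
  by move: AK; rewrite AuE ler_norml => /andP[]; rewrite -mulrN !ler_pM2l// => ? ?; split; lra.
have c0 : 0 <= c by lra.
have t1 : (Num.truncn c)%:R <= c by rewrite truncn_le.
have t2 : c < (Num.truncn c)%:R + 1 by have := truncnS_gt c; rewrite -natr1.
have t3 : (1 <= Num.truncn c)%N by rewrite -(ler_nat R); lra.
(* Rounding down by one to two steps. Here clamping at 0 is accepted, through the left alternative,
   and clamping at 1 is the void case. *)
set k := (Num.truncn c - 1)%N.
have kE : k%:R = (Num.truncn c)%:R - 1 :> R by rewrite /k natrB.
have kK : (k <= K + K)%N by rewrite -(ler_nat R) natrD kE; lra.
have H := Ad k kK; exists k => //; move: H; rewrite /gridpt.
have e1 : - A u - 2 * e <= e * (k%:R - K%:R).
  by rewrite AuE [leLHS](_ : _ = e * (c - 2 - K%:R)) ?ler_pM2l//; [lra|ring].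
have e2 : e * (k%:R - K%:R) <= - A u - e.
  by rewrite AuE [leRHS](_ : _ = e * (c - 1 - K%:R)) ?ler_pM2l//; [lra|ring].
set r := u + _; have qr : q * (r - u) = e * (k%:R - K%:R) by rewrite /r; field; rewrite gt_eqF.
case: (clamp1_cases r) => -[hr ->].
- move=> _; split; first by left.
  apply: (le_trans e1); rewrite -qr ler_pM2l//; lra.
- by rewrite ler_norml => /andP[? ?]; split; [right|]; move: qr; rewrite mulrBr; lra.
- have ur : q * (1 - u) < e * K%:R.
    apply: (@lt_le_trans _ _ (e * (k%:R - K%:R))).
      by rewrite -qr ltr_pM2l//; lra.
    rewrite ler_pM2l//; move: kK; rewrite -(ler_nat R) natrD; lra.
  have [u1|u1] := ltP u 1.
    by have := u1K u1; rewrite ler_pdivrMr// mulrC; lra.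
  have uE : u = 1 by lra.
  have : q * (r - u) < 0 by rewrite qr; move: e2; rewrite uE A1; lra.
  by rewrite pmulr_rlt0//; lra.
Qed.

End grid_choice.

Lemma Rint_variance_le {dT} {T : measurableType dT} {R : realType} (P : probability T R) (g : T -> R) :
  bmf g -> Rint P (fun x => (g x - Rint P g) ^+ 2) <= Rint P (fun x => g x ^+ 2).
Proof.
move=> hg; set c := Rint P g.
have hg2 : bmf (fun x => g x * g x) by exact: bmfM.
have hcg : bmf (fun x => 2 * c * g x) by exact: bmfZ.
rewrite (_ : (fun x => (g x - c) ^+ 2) = fun x => g x * g x - 2 * c * g x + c * c); last first.
  by apply/funext => x; ring.
rewrite (RintD P _ _ (bmfB _ _ hg2 hcg) (bmf_cst _)) (RintB P _ _ hg2 hcg) (RintZ P _ _ hg) Rint1 -/c.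
rewrite (_ : (fun x => g x ^+ 2) = fun x => g x * g x); last by apply/funext => x; rewrite expr2.
by have := sqr_ge0 c; rewrite expr2; lra.
Qed.

(** * Centred summands, their variances and the exceptional null event *)

Section linearization.
Context {R : realType} {dT : measure_display} {T : measurableType dT}.
Variables (P : probability T R) (d : nat) (U : nat -> 'I_d -> T -> R).
Hypothesis iidU : iid_vectors P U.
Hypothesis unifU : uniform_marginals P U.
Variable eta : nat -> nat -> 'I_d -> T -> R.
Hypothesis meta : forall n i j, measurable_fun setT (eta n i j).
Hypothesis eta01 : forall n i j x, 0 <= eta n i j x <= 1.
Variable dC : 'I_d -> ('I_d -> R) -> R.
Local Notation Rd := (borelRd R d).
Local Notation V := (fun i x => (fun j => U i j x) : Rd).
Local Notation C := (copula P U).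
Hypothesis dCP : forall j u, cube d u -> is_partial_cube C j u (dC j u).
Hypothesis dC_cont : forall j, continuous_on_cube (dC j).

Definition zb (s : 'I_d -> R) (y : Rd) : R := (vle y s)%:R - C s.
Definition za (j : 'I_d) (t : R) (y : Rd) : R := (y j <= t)%R%:R - t.
(** The i.i.d. counterpart of [G_C u]: [zb u] stands for [B_C u], and [za j (u j)] for [B_C] at the
    [j]-th axis point. *)
Definition zw (u : 'I_d -> R) (y : Rd) : R := zb u y - \sum_j dC j u * za j (u j) y.
Definition normsum (z : Rd -> R) (n : nat) (x : T) : R := (Num.sqrt n%:R)^-1 * \sum_(i < n) z (V i x).
Definition lhs_count (n : nat) (u : 'I_d -> R) (x : T) : R :=
  cntl n (fun i => LHSD U eta n i x) u.
Definition lin_err (n : nat) (u : 'I_d -> R) (x : T) : R :=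
  Num.sqrt n%:R * (lhs_count n u x / n%:R - C u) - normsum (zw u) n x.

Lemma LHSD_lo n i j x :
  ((count (fun k => U k j x <= U i j x) (iota 0 n))%:R - 1) / n%:R <= LHSD U eta n i x j.
Proof. by rewrite /LHSD /rank_stat lerDl divr_ge0//; have /andP[] := eta01 n i j x. Qed.

Lemma LHSD_hi n i j x : (i < n)%N ->
  LHSD U eta n i x j <= (count (fun k => U k j x <= U i j x) (iota 0 n))%:R / n%:R.
Proof.
move=> ni; rewrite /LHSD /rank_stat -mulrDl ler_pM2r ?invr_gt0 ?ltr0n ?(leq_trans _ ni)//.
by have /andP[_] := eta01 n i j x; lra.
Qed.

Lemma LHSD_cube n i x : (i < n)%N -> cube d (LHSD U eta n i x).
Proof.
move=> ni j; have n0 : 0 < n%:R :> R by rewrite ltr0n (leq_trans _ ni).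
apply/andP; split.
  apply: le_trans (LHSD_lo n i j x); rewrite divr_ge0// subr_ge0 ler1n.
  by apply: (rank_pos n (fun k => U k j x)).
apply: (le_trans (LHSD_hi n i j x ni)); rewrite ler_pdivrMr// mul1r ler_nat.
by rewrite (leq_trans (count_size _ _))// size_iota.
Qed.

Lemma bmf_zb s : bmf (zb s).
Proof.
apply: bmfB; last exact: bmf_cst.
exact: (bmf_vle (id : Rd -> Rd) (fun=> s)).
Qed.

Lemma bmf_za j t : bmf (za j t).
Proof.
apply: bmfB; last exact: bmf_cst.
by apply: bmf_bool; apply: measurable_fun_ler => //; exact: measurable_coord.
Qed.

Lemma bmfV (z : Rd -> R) i : bmf z -> bmf (fun x => z (V i x)).
Proof. by move=> hz; apply: bmf_comp => //; exact: measurable_V iidU i. Qed.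

Lemma bmf_normsum z n : bmf z -> bmf (normsum z n).
Proof. by move=> hz; apply: bmfZ; apply: bmf_sum => i _; exact: bmfV. Qed.

Lemma Rint_zb s : Rint P (fun x => zb s (V 0%N x)) = 0.
Proof.
rewrite RintB; last exact: bmf_cst.
  by rewrite Rint1 (copulaE _ _ _ iidU) subrr.
exact: (bmf_vleV _ _ _ iidU).
Qed.

Lemma Rint_za j t : 0 <= t <= 1 -> Rint P (fun x => za j t (V 0%N x)) = 0.
Proof.
move=> t01; rewrite RintB; last exact: bmf_cst.
  by rewrite Rint1 (marginalE _ _ _ iidU unifU)// subrr.
exact: (bmf_le_coord _ _ _ iidU).
Qed.

Lemma Rint_zw u : cube d u -> Rint P (fun x => zw u (V 0%N x)) = 0.
Proof.
move=> cu; have h j : bmf (fun x => dC j u * za j (u j) (V 0%N x)) by apply: bmfZ; apply: bmfV; exact: bmf_za.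
rewrite RintB; last by apply: bmf_sum => j _.
  rewrite Rint_zb Rint_sum// big1 ?subrr// => j _.
  by rewrite RintZ ?Rint_za ?mulr0//; apply: bmfV; exact: bmf_za.
apply: bmfV; exact: bmf_zb.
Qed.

Lemma Rint_normsum2 z n : bmf z -> Rint P (fun x => z (V 0%N x)) = 0 ->
  Rint P (fun x => normsum z n x ^+ 2) <= Rint P (fun x => z (V 0%N x) ^+ 2).
Proof.
move=> hz z0.
have hS : bmf (fun x => \sum_(i < n) z (V i x)) by apply: bmf_sum => i _; exact: bmfV.
rewrite (_ : (fun x => _) = fun x => (Num.sqrt n%:R)^-1 ^+ 2 *
   ((\sum_(i < n) z (V i x)) * (\sum_(i < n) z (V i x)))); last first.
  by apply/funext => x; rewrite /normsum exprMn -[in RHS]expr2.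
rewrite RintZ; last exact: bmfM.
rewrite (_ : (fun x => _ * _) = fun x => (\sum_(i < n) z (V i x)) ^+ 2); last by apply/funext => x; rewrite expr2.
rewrite (variance_sum P V z (iidV P d U iidU) hz z0) exprVn sqr_sqrtr//.
case: n {hS} => [|n]; last by rewrite mulKf.
by rewrite !mul0r mulr0; apply: Rint_ge0 => x; exact: sqr_ge0.
Qed.

Lemma normsumB z1 z2 n x : normsum z1 n x - normsum z2 n x = normsum (fun y => z1 y - z2 y) n x.
Proof. by rewrite /normsum -mulrBr -sumrB. Qed.

Lemma Rint_centered2 (z : Rd -> R) (c : R) : bmf z -> c = Rint P (fun x => z (V 0%N x)) ->
  (forall y, `|z y| <= 1) ->
  Rint P (fun x => (z (V 0%N x) - c) ^+ 2) <= Rint P (fun x => `|z (V 0%N x)|).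
Proof.
move=> hz -> z1; apply: (le_trans (Rint_variance_le P _ (bmfV z 0 hz))).
apply: Rint_le.
- by apply: (bmf_ext (fun x => z (V 0%N x) * z (V 0%N x))); [apply: bmfM; exact: bmfV|].
- by apply: bmf_norm; exact: bmfV.
- move=> x; rewrite -real_normK ?num_real// expr2 ler_piMr//.
Qed.

Lemma bmf_le1 j (t : R) : bmf (fun y : Rd => (y j <= t)%R%:R : R).
Proof. by apply: bmf_bool; apply: measurable_fun_ler => //; exact: measurable_coord. Qed.

Lemma Rint_normsum_za n j t : 0 <= t <= 1 -> Rint P (fun x => normsum (za j t) n x ^+ 2) <= 1.
Proof.
move=> t01; apply: (le_trans (Rint_normsum2 _ n (bmf_za j t) (Rint_za j t t01))).
apply: (le_trans (Rint_centered2 _ t (bmf_le1 j t) _ _)).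
- by rewrite (marginalE _ _ _ iidU unifU).
- by move=> y; case: (y j <= t)%R; rewrite ?normr1 ?normr0.
- rewrite -[leRHS](Rint1 P 1); apply: Rint_le; [apply: bmf_norm; exact: (bmf_le_coord _ _ _ iidU)|exact: bmf_cst|].
  by move=> x; case: (U 0%N j x <= t)%R; rewrite ?normr1 ?normr0.
Qed.

(** The bound does not involve [n]: at points whose distance is of order [1 / sqrt n] the normalized
    sums differ by a variance of that order, so finitely many grid points contribute a vanishing
    probability. *)
Lemma Rint_normsum_zb_dist n s u : cube d s -> cube d u ->
  Rint P (fun x => (normsum (zb s) n x - normsum (zb u) n x) ^+ 2) <= \sum_j `|s j - u j|.
Proof.
move=> cs cu; under eq_fun do rewrite normsumB.
have h v : bmf (fun y : Rd => (vle y v)%:R : R) by exact: (bmf_vle (id : Rd -> Rd) (fun=> v)).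
apply: (le_trans (Rint_normsum2 _ n (bmfB _ _ (bmf_zb s) (bmf_zb u)) _)).
  by rewrite RintB ?Rint_zb ?subrr//; apply: bmfV; exact: bmf_zb.
apply: le_trans (Rint_vle_dist P d U iidU unifU s u cs cu).
apply: (le_trans _ (Rint_centered2 (fun y => (vle y s)%:R - (vle y u)%:R) (C s - C u) (bmfB _ _ (h s) (h u)) _ _)).
- by rewrite le_eqVlt; apply/orP; left; apply/eqP; congr Rintegral; apply/funext => x; congr (_ ^+ 2); rewrite /zb; ring.
- by rewrite !(copulaE _ _ _ iidU) RintB//; exact: (bmf_vleV _ _ _ iidU).
- by move=> y; case: vle; case: vle; rewrite ?subrr ?subr0 ?sub0r ?normrN ?normr1 ?normr0.
Qed.

Lemma Rint_normsum_za_dist n j s t : 0 <= s <= 1 -> 0 <= t <= 1 ->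
  Rint P (fun x => (normsum (za j s) n x - normsum (za j t) n x) ^+ 2) <= `|s - t|.
Proof.
move=> s01 t01; under eq_fun do rewrite normsumB.
apply: (le_trans (Rint_normsum2 _ n (bmfB _ _ (bmf_za j s) (bmf_za j t)) _)).
  by rewrite RintB ?Rint_za ?subrr//; apply: bmfV; exact: bmf_za.
rewrite -(marginal_dist P d U iidU unifU j s t s01 t01).
apply: (le_trans _ (Rint_centered2 (fun y => (y j <= s)%R%:R - (y j <= t)%R%:R) (s - t) (bmfB _ _ (bmf_le1 j s) (bmf_le1 j t)) _ _)).
- by rewrite le_eqVlt; apply/orP; left; apply/eqP; congr Rintegral; apply/funext => x; congr (_ ^+ 2); rewrite /za; ring.
- by rewrite RintB ?(marginalE P d U iidU unifU)//; exact: (bmf_le_coord _ _ _ iidU).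
- by move=> y; case: (y j <= s)%R; case: (y j <= t)%R; rewrite ?subrr ?subr0 ?sub0r ?normrN ?normr1 ?normr0.
Qed.

(* Counts the failures, among the first n vectors, of the almost sure properties
   "no ties" and "coordinates in ]0, 1]"; thus nul n x < 1 says that none fails. *)
Definition nul (n : nat) (x : T) : R :=
  \sum_(j < d) \sum_(i < n)
    ((U i j x <= 0)%R%:R + (1 - (U i j x <= 1)%R%:R) +
     \sum_(k < n | k != i) (U i j x == U k j x)%:R).

Lemma measurable_tie i k j : measurable_fun setT (fun x => U i j x == U k j x).
Proof.
rewrite (_ : (fun x => _) = fun x => (U i j x <= U k j x) && (U k j x <= U i j x)); last first.
  by apply/funext => x; rewrite eq_le.
by apply: measurable_and; apply: measurable_fun_ler; exact: measurable_U iidU _ _.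
Qed.

(** For [0 < t <= 1] the atom is at most the increment of the marginal from [clamp1 (t - e)] to [t],
    hence at most [e]. At [t = 0] and outside [[0, 1]] it lies in one of the null events [U <= 0]
    and [U > 1]. *)
Lemma Rint_atom j t : Rint P (fun y => (t == U 0%N j y)%:R) = 0.
Proof.
have mt : bmf (fun y => (t == U 0%N j y)%:R : R).
  apply: bmf_bool; rewrite (_ : (fun y => _) = fun y => (t <= U 0%N j y) && (U 0%N j y <= t)).
    by apply: measurable_and; apply: measurable_fun_ler => //; exact: measurable_U iidU _ _.
  by apply/funext => y; rewrite eq_le.
have h (e : R) : 0 < e -> e <= 1 -> Rint P (fun y => (t == U 0%N j y)%:R) <= e.
  move=> e0 e1.
  have [t01|t01] := boolP (0 <= t <= 1).
    have s01 : 0 <= clamp1 (t - e) <= 1 := clamp1_01 _.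
    have st : t - e <= clamp1 (t - e) by rewrite /clamp1 le_max le_min; apply/orP; right; apply/andP; split; lra.
    have hs := bmf_le_coord _ _ _ iidU 0 j (clamp1 (t - e)).
    have ht := bmf_le_coord _ _ _ iidU 0 j t.
    have h1 : bmf (fun y => 1 - (U 0%N j y <= 1)%R%:R : R) by apply: bmfB; [exact: bmf_cst|exact: (bmf_le_coord _ _ _ iidU)].
    have h0 := bmf_le_coord _ _ _ iidU 0 j 0.
    have [t0|t0] := ltP 0 t.
      have ct : clamp1 (t - e) < t.
        by rewrite /clamp1 gt_max t0 /= gt_min; apply/orP; right; lra.
      apply: (@le_trans _ _ (t - clamp1 (t - e))); last by lra.
      rewrite -[X in _ <= X - _](marginalE P d U iidU unifU j t t01) -[X in _ <= _ - X](marginalE P d U iidU unifU j _ s01).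
      rewrite -RintB//; apply: Rint_le => //; first exact: bmfB.
      move=> y; case: eqP => [E|_]; first by rewrite -E lexx (leNgt t) ct subr0.
      rewrite subr_ge0 ler_nat; case: (leP (U 0%N j y) (clamp1 (t - e))) => // yc.
      by rewrite (le_trans yc (ltW ct)).
    have tE : t = 0 by move: t01 => /andP[? ?]; lra.
    apply: (@le_trans _ _ 0); last exact: ltW.
    rewrite -[X in _ <= X](marginalE P d U iidU unifU j 0) ?lexx ?ler01//.
    by apply: Rint_le => // y; rewrite ler_nat tE; case: eqP => [<-|]; rewrite ?lexx.
  apply: (@le_trans _ _ 0); last exact: ltW.
  have h0 := bmf_le_coord _ _ _ iidU 0 j 0.
  have h1 := bmf_le_coord _ _ _ iidU 0 j 1.
  have h1' := bmfB _ _ (bmf_cst 1) h1.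
  have -> : 0 = Rint P (fun y => (U 0%N j y <= 0)%R%:R + (1 - (U 0%N j y <= 1)%R%:R)).
    rewrite (RintD P _ _ h0 h1') (RintB P _ _ (bmf_cst 1) h1) Rint1.
    by rewrite !(marginalE P d U iidU unifU) ?lexx ?ler01// subrr addr0.
  apply: Rint_le => //; first exact: bmfD.
  move=> y; case: eqP => [E|_] /=.
    move: t01; rewrite E negb_and -!ltNge => /orP[/ltW ->|]; last rewrite ltNge => /negbTE ->.
      by rewrite lerDl subr_ge0 lern1; case: (U 0%N j y <= 1)%R.
    by rewrite subr0 lerDr.
  by apply: addr_ge0 => //; rewrite subr_ge0 lern1; case: (U 0%N j y <= 1)%R.
apply/eqP; rewrite eq_le Rint_ge0// andbT.
apply/ler_addgt0Pr => e e0; rewrite add0r.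
apply: (le_trans (h (Num.min e 1) _ _)); rewrite ?lt_min ?ge_min ?e0 ?ltr01 ?lexx ?orbT//.
Qed.

Lemma Rint_tie i k j : i != k -> Rint P (fun x => (U i j x == U k j x)%:R) = 0.
Proof.
move=> ik.
have mF : bmf (fun p : Rd * Rd => (p.1 j == p.2 j)%:R : R).
  apply: bmf_bool; rewrite (_ : (fun p => _) = fun p : Rd * Rd => (p.1 j <= p.2 j) && (p.2 j <= p.1 j)); last first.
    by apply/funext => p; rewrite eq_le.
  have m1 := measurableT_comp (measurable_coord j) (@measurable_fst _ _ Rd Rd).
  have m2 := measurableT_comp (measurable_coord j) (@measurable_snd _ _ Rd Rd).
  by apply: measurable_and; [exact: measurable_fun_ler m1 m2|exact: measurable_fun_ler m2 m1].
rewrite (iid_Rint2 P V (iidV P d U iidU) i k (fun p => (p.1 j == p.2 j)%:R) ik mF) /=.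
by rewrite -[RHS](Rint1 P); congr Rintegral; apply/funext => x; exact: Rint_atom.
Qed.

Lemma bmf_nul n : bmf (nul n).
Proof.
apply: bmf_sum => j _; apply: bmf_sum => i _; apply: bmfD; first apply: bmfD.
- exact: (bmf_le_coord _ _ _ iidU).
- by apply: bmfB; [exact: bmf_cst|exact: (bmf_le_coord _ _ _ iidU)].
- by apply: bmf_sum => k _; apply: bmf_bool; exact: measurable_tie.
Qed.

Lemma Rint_nul n : Rint P (nul n) = 0.
Proof.
have h1 i j : bmf (fun x => (U i j x <= 0)%R%:R : R) by exact: (bmf_le_coord _ _ _ iidU).
have h2 i j : bmf (fun x => 1 - (U i j x <= 1)%R%:R : R).
  by apply: bmfB; [exact: bmf_cst|exact: (bmf_le_coord _ _ _ iidU)].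
have h3 (i : 'I_n) j : bmf (fun x => \sum_(k < n | k != i) (U i j x == U k j x)%:R : R).
  by apply: bmf_sum => k _; apply: bmf_bool; exact: measurable_tie.
have h i j := bmfD _ _ (bmfD _ _ (h1 (nat_of_ord i) j) (h2 _ j)) (h3 i j).
rewrite Rint_sum; last by move=> j _; apply: bmf_sum => i _; exact: h.
rewrite big1// => j _; rewrite Rint_sum; last by move=> i _; exact: h.
rewrite big1// => i _.
rewrite (RintD P _ _ (bmfD _ _ (h1 i j) (h2 i j)) (h3 i j)) (RintD P _ _ (h1 i j) (h2 i j)).
have e (t : R) : 0 <= t <= 1 -> Rint P (fun x => (U i j x <= t)%R%:R) = t.
  move=> t01; rewrite -[RHS](marginalE P d U iidU unifU j t t01).
  exact: (iid_Rint P V (iidV P d U iidU) i (fun y => (y j <= t)%R%:R) (bmf_le1 j t)).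
rewrite RintB; [|exact: bmf_cst|exact: (bmf_le_coord _ _ _ iidU)].
rewrite !e ?lexx ?ler01// Rint1 subrr !add0r Rint_sum; last by move=> k _; apply: bmf_bool; exact: measurable_tie.
by rewrite big1// => k ki; apply: Rint_tie; rewrite eq_sym.
Qed.

Lemma nul_term_ge0 n x j (i : 'I_n) : 0 <= (U i j x <= 0)%R%:R + (1 - (U i j x <= 1)%R%:R) +
     \sum_(k < n | k != i) (U i j x == U k j x)%:R :> R.
Proof.
apply: addr_ge0; last exact: sumr_ge0.
by apply: addr_ge0 => //; rewrite subr_ge0 lern1; case: (U i j x <= 1)%R.
Qed.

Lemma nul_ge0 n x : 0 <= nul n x.
Proof. by apply: sumr_ge0 => j _; apply: sumr_ge0 => i _; exact: nul_term_ge0. Qed.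

Lemma nul_lt1 n x : nul n x < 1 ->
  [/\ forall j i k, (i < n)%N -> (k < n)%N -> U i j x = U k j x -> i = k,
      forall j i, (i < n)%N -> 0 < U i j x & forall j i, (i < n)%N -> U i j x <= 1].
Proof.
move=> h.
have key j (i : 'I_n) : (U i j x <= 0)%R%:R + (1 - (U i j x <= 1)%R%:R) +
     \sum_(k < n | k != i) (U i j x == U k j x)%:R < 1 :> R.
  apply: le_lt_trans h; rewrite /nul (bigD1 j)//=.
  apply: ler_wpDr; first by apply: sumr_ge0 => j' _; apply: sumr_ge0 => i' _; exact: nul_term_ge0.
  rewrite [leRHS](bigD1 i)//=.
  by apply: ler_wpDr => //; apply: sumr_ge0 => i' _; exact: nul_term_ge0.
have p1 j (i : 'I_n) : 0 <= \sum_(k < n | k != i) (U i j x == U k j x)%:R :> R by exact: sumr_ge0.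
split=> [j i k ni nk E|j i ni|j i ni].
- apply/eqP; apply: contraT => ik; have := key j (Ordinal ni).
  rewrite (bigD1 (Ordinal nk))/= ?E ?eqxx; last by rewrite -val_eqE /= eq_sym.
  have : 0 <= \sum_(k' < n | (k' != Ordinal ni) && (k' != Ordinal nk)) (U k j x == U k' j x)%:R :> R by exact: sumr_ge0.
  by move=> h1 h2; exfalso; move: h1 h2; case: (U k j x <= 1)%R; case: (U k j x <= 0)%R => /=; lra.
- have := key j (Ordinal ni); have := p1 j (Ordinal ni); rewrite /=.
  by case: (leP (U i j x) 0) => //; case: (U i j x <= 1)%R => /=; lra.
- have := key j (Ordinal ni); have := p1 j (Ordinal ni); rewrite /=.
  by case: (leP (U i j x) 1) => //; case: (U i j x <= 0)%R => /=; lra.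
Qed.

End linearization.

Lemma sum_sqr_le {R : realType} (d : nat) (b : 'I_d -> R) :
  (\sum_j b j) ^+ 2 <= d%:R * \sum_j b j ^+ 2.
Proof.
rewrite expr2 big_distrlr /=.
apply: (@le_trans _ _ (\sum_(i < d) \sum_(j < d) ((b i ^+ 2 + b j ^+ 2) / 2))).
  apply: ler_sum => i _; apply: ler_sum => j _.
  by have := sqr_ge0 (b i - b j); rewrite sqrrB; lra.
set S := \sum_j b j ^+ 2.
rewrite (eq_bigr (fun i => d%:R * (b i ^+ 2 / 2) + S / 2)); last first.
  move=> i _; under eq_bigr do rewrite mulrDl.
  by rewrite big_split /= sumr_const card_ord -mulr_suml -[_ *+ d]mulr_natl.
rewrite big_split /= sumr_const card_ord -mulr_sumr -mulr_suml -[_ *+ d]mulr_natl -/S.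
by rewrite le_eqVlt; apply/orP; left; apply/eqP; field.
Qed.

Lemma cvg_sqrt_nat {R : realType} (B : R) : \forall n \near \oo, B <= Num.sqrt n%:R.
Proof.
near=> n.
rewrite (le_trans (ler_norm B))// -sqrtr_sqr ler_wsqrtr//.
near: n; exact: nbhs_infty_ger.
Unshelve. all: by end_near. Qed.

(** * Pathwise bounds for the linearization error *)

Section lin_err_bounds.
Context {R : realType} {dT : measure_display} {T : measurableType dT}.
Variables (P : probability T R) (d : nat) (U : nat -> 'I_d -> T -> R).
Hypothesis iidU : iid_vectors P U.
Hypothesis unifU : uniform_marginals P U.
Variable eta : nat -> nat -> 'I_d -> T -> R.
Hypothesis meta : forall n i j, measurable_fun setT (eta n i j).
Hypothesis eta01 : forall n i j x, 0 <= eta n i j x <= 1.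
Variable dC : 'I_d -> ('I_d -> R) -> R.
Local Notation Rd := (borelRd R d).
Local Notation V := (fun i x => (fun j => U i j x) : Rd).
Local Notation C := (copula P U).
Hypothesis dCP : forall j u, cube d u -> is_partial_cube C j u (dC j u).
Hypothesis dC_cont : forall j, continuous_on_cube (dC j).
Local Notation A n j t x := (normsum d U (za d j t) n x).
Local Notation B n s x := (normsum d U (zb P d U s) n x).
Local Notation lerr := (lin_err P d U eta dC).
Local Notation Vx x := (fun i j => U i j x).
Local Notation q n := (Num.sqrt n%:R : R).

Lemma q_gt0 n : (0 < n)%N -> 0 < q n.
Proof. by move=> n0; rewrite sqrtr_gt0 ltr0n. Qed.

Lemma qq n : n%:R = q n ^+ 2.
Proof. by rewrite sqr_sqrtr. Qed.

Lemma scale_q n (a : R) : n%:R * a = q n * (q n * a).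
Proof. by rewrite mulrA -expr2 -qq. Qed.

Lemma cntcE_normsum n j t x : (0 < n)%N -> cntc n (Vx x) j t = n%:R * t + q n * A n j t x.
Proof.
move=> n0; rewrite /normsum mulrA divff ?gt_eqF ?q_gt0// mul1r /za sumrB sumr_const card_ord.
by rewrite -[t *+ n]mulr_natl addrC subrK.
Qed.

Lemma cntvE_normsum n s x : (0 < n)%N -> cntv n (Vx x) s = n%:R * C s + q n * B n s x.
Proof.
move=> n0; rewrite /normsum mulrA divff ?gt_eqF ?q_gt0// mul1r /zb sumrB sumr_const card_ord.
by rewrite -[C s *+ n]mulr_natl addrC subrK.
Qed.

Lemma normsum_zw n u x : normsum d U (zw P d U dC u) n x = B n u x - \sum_j dC j u * A n j (u j) x.
Proof.
rewrite /normsum /zw sumrB mulrBr; congr (_ - _).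
rewrite exchange_big mulr_sumr; apply: eq_bigr => j _.
by rewrite -mulr_sumr mulrCA.
Qed.

Lemma A_ends n j x : (0 < n)%N -> nul d U n x < 1 -> A n j 0 x = 0 /\ A n j 1 x = 0.
Proof.
move=> n0 /nul_lt1[_ h0 h1]; split.
  rewrite /normsum big1 ?mulr0// => i _; rewrite /za subr0.
  by rewrite leNgt h0.
by rewrite /normsum big1 ?mulr0// => i _; rewrite /za h1// subrr.
Qed.

(** The count of the [V_i] is enclosed between the counts of the [U_i] below two grid points, given
    by [gridpt_down] and [gridpt_up]. In the error, [e] is the oscillation of [B], [2 * d * e] comes
    from rounding the thresholds, the partial derivatives being at most 1, and the term in [et] is
    the differentiability remainder at distance [e K / sqrt n]. *)
Lemma lin_err_good n u (e et dl : R) (K : nat) x : (0 < n)%N -> cube d u -> 0 < e -> 0 < et ->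
  (forall s, cube d s -> (forall j, `|s j - u j| < dl) ->
    `|C s - C u - \sum_j dC j u * (s j - u j)| <= et * \sum_j `|s j - u j|) ->
  (forall j, 0 < u j -> e * K%:R / q n <= u j) ->
  (forall j, u j < 1 -> e * K%:R / q n <= 1 - u j) ->
  e * K%:R < dl * q n ->
  nul d U n x < 1 ->
  (forall j, `|A n j (u j) x| <= e * (K%:R - 3)) ->
  (forall j k, (k <= K + K)%N ->
    `|A n j (gridpt (q n) e K (u j) k) x - A n j (u j) x| <= e / 2) ->
  (forall k : 'I_d -> nat, (forall j, (k j <= K + K)%N) ->
    `|B n (fun j => gridpt (q n) e K (u j) (k j)) x - B n u x| <= e) ->
  `|lerr n u x| <= e * (1 + 2 * d%:R) + et * (d%:R * (e * K%:R)).
Proof.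
move=> n0 cu e0 et0 diff c0 c1 cdl nul1 hA hgA hgB.
have q0 := q_gt0 n n0.
have hlo i j : (i < n)%N -> _ := fun _ => LHSD_lo d U eta eta01 n i j x.
have hhi i j : (i < n)%N -> _ := LHSD_hi d U eta eta01 n i j x.
have dC01 j : 0 <= dC j u <= 1 := partial01 P d U iidU unifU dC dCP j u cu.
rewrite /lin_err normsum_zw.
have sumA (b : R) : \sum_(j < d) dC j u * (- A n j (u j) x + b) = - (\sum_j dC j u * A n j (u j) x) + (\sum_j dC j u) * b.
  under eq_bigr do rewrite mulrDr mulrN.
  by rewrite big_split /= sumrN mulr_suml.
have sdC : 0 <= \sum_j dC j u <= d%:R.
  rewrite sumr_ge0/=; last by move=> j _; case/andP: (dC01 j).
  by rewrite -[d in leRHS]card_ord -sumr_const; apply: ler_sum => j _; case/andP: (dC01 j).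
have core (k : 'I_d -> nat) (hk : forall j, (k j <= K + K)%N) :
   let s := fun j => gridpt (q n) e K (u j) (k j) in
   `|q n * (cntv n (Vx x) s / n%:R - C u) - B n u x - \sum_j dC j u * (q n * (s j - u j))|
     <= e + et * (d%:R * (e * K%:R)).
  move=> s; have cs : cube d s by move=> j; exact: gridpt_01.
  have sd j : `|q n * (s j - u j)| <= e * K%:R by apply: gridpt_dist.
  have sdl j : `|s j - u j| < dl.
    rewrite -(ltr_pM2r q0); apply: le_lt_trans cdl.
    by rewrite -[X in _ * X](gtr0_norm q0) -normrM (mulrC (s j - u j)).
  have := diff s cs sdl; rewrite -(ler_pM2l q0) => hd.
  have hB := hgB k hk.
  have -> : q n * (cntv n (Vx x) s / n%:R - C u) - B n u x - \sum_j dC j u * (q n * (s j - u j)) =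
     (B n s x - B n u x) + q n * (C s - C u - \sum_j dC j u * (s j - u j)).
    rewrite cntvE_normsum// mulrDl mulrAC divff ?pnatr_eq0 -?lt0n// mul1r.
    rewrite [X in _ = _ + X]mulrBr mulr_sumr.
    under eq_bigr do rewrite mulrCA.
    set S := \sum_j _; set b1 := B n s x; set b2 := B n u x; set Q := Num.sqrt _.
    rewrite (_ : n%:R = Q ^+ 2); last exact: qq.
    by field; rewrite gt_eqF.
  apply: (le_trans (ler_normD _ _)); apply: lerD => //.
  rewrite normrM (gtr0_norm q0) (le_trans hd)// mulrCA; apply: ler_wpM2l; first exact: ltW.
  rewrite mulr_sumr mulr_natl -[d in leRHS]card_ord -sumr_const; apply: ler_sum => j _.
  by rewrite -[X in X * _](gtr0_norm q0) -normrM.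
have Lmono (L1 L2 : R) : L1 <= L2 -> q n * (L1 / n%:R - C u) <= q n * (L2 / n%:R - C u).
  by move=> L12; rewrite ler_pM2l// lerD2r ler_pM2r// invr_gt0 ltr0n.
rewrite ler_norml; apply/andP; split.
  have hdn j : exists k, (k <= K + K)%N /\
     ((gridpt (q n) e K (u j) k = 0 \/ q n * gridpt (q n) e K (u j) k + A n j (gridpt (q n) e K (u j) k) x < q n * u j) /\
     - A n j (u j) x - 2 * e <= q n * (gridpt (q n) e K (u j) k - u j)).
    have [A0 A1] := A_ends n j x n0 nul1.
    have [k k1 k2] := gridpt_down (q n) e K (u j) (fun t => A n j t x) q0 e0 (cu j) A0 A1 (hA j) (c1 j) (hgA j).
    by exists k.
  pose k j := sval (cid (hdn j)).
  have hk j : (k j <= K + K)%N by rewrite /k; case: cid => /= ? [].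
  have := core k hk; set s := fun j => _ => /= hc.
  have hs j : (s j = 0 \/ q n * s j + A n j (s j) x < q n * u j) /\
     - A n j (u j) x - 2 * e <= q n * (s j - u j) by rewrite /s /k; case: cid => /= ? [].
  have Lle : cntv n (Vx x) s <= lhs_count d U eta n u x.
    apply: cntv_le_cntl => // j; have [A0 _] := A_ends n j x n0 nul1.
    rewrite cntcE_normsum//; have [[->|h] _] := hs j; first by left; rewrite A0 !mulr0 addr0.
    by right; rewrite !scale_q -mulrDr ltr_pM2l.
  have h1 := Lmono _ _ Lle.
  have h2 : \sum_j dC j u * (- A n j (u j) x + (- (2 * e))) <= \sum_j dC j u * (q n * (s j - u j)).
    apply: ler_sum => j _; apply: ler_wpM2l; first by case/andP: (dC01 j).
    by have [] := hs j.
  move: hc h1 h2; rewrite sumA ler_norml => /andP[hc _].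
  move: sdC hc => /andP[? ?]; set X := \sum_j dC j u * _; set Y := \sum_j dC j u * _; set Z := \sum_j dC j u.
  move=> hc h1 h2.
  have : Z * e <= d%:R * e by apply: ler_wpM2r => //; exact: ltW.
  by lra.
have hup j : exists k, (k <= K + K)%N /\
   (q n * u j <= q n * gridpt (q n) e K (u j) k + A n j (gridpt (q n) e K (u j) k) x /\
   q n * (gridpt (q n) e K (u j) k - u j) <= - A n j (u j) x + 2 * e).
  have [A0 A1] := A_ends n j x n0 nul1.
  have [k k1 k2] := gridpt_up (q n) e K (u j) (fun t => A n j t x) q0 e0 (cu j) A0 A1 (hA j) (c0 j) (hgA j).
  by exists k.
pose k j := sval (cid (hup j)).
have hk j : (k j <= K + K)%N by rewrite /k; case: cid => /= ? [].
have := core k hk; set s := fun j => _ => /= hc.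
have hs j : q n * u j <= q n * s j + A n j (s j) x /\
   q n * (s j - u j) <= - A n j (u j) x + 2 * e by rewrite /s /k; case: cid => /= ? [].
have Lle : lhs_count d U eta n u x <= cntv n (Vx x) s.
  apply: cntl_le_cntv => // j; rewrite cntcE_normsum//; have [h _] := hs j.
  by rewrite !scale_q -mulrDr ler_pM2l.
have h1 := Lmono _ _ Lle.
have h2 : \sum_j dC j u * (q n * (s j - u j)) <= \sum_j dC j u * (- A n j (u j) x + (2 * e)).
  apply: ler_sum => j _; apply: ler_wpM2l; first by case/andP: (dC01 j).
  by have [] := hs j.
move: hc h1 h2; rewrite sumA ler_norml => /andP[_ hc].
move: sdC hc => /andP[? ?]; set X := \sum_j dC j u * _; set Y := \sum_j dC j u * _; set Z := \sum_j dC j u.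
move=> hc h1 h2.
have : Z * e <= d%:R * e by apply: ler_wpM2r => //; exact: ltW.
by lra.
Qed.

(** With [S] the sum of the [|A|], the linear term contributes [S] and [cntl_cntv_dist] contributes
    [S + 3 d]. Then [(2 S + 3 d)^2 <= 8 S^2 + 18 d^2], and [S^2] is at most [d] times the sum of
    squares. *)
Lemma lin_err_sqr n u x : (0 < n)%N -> cube d u -> nul d U n x < 1 ->
  lerr n u x ^+ 2 <= 8 * d%:R * (\sum_j A n j (u j) x ^+ 2) + 18 * d%:R ^+ 2.
Proof.
move=> n0 cu nul1; have q0 := q_gt0 n n0.
have dC01 j : 0 <= dC j u <= 1 := partial01 P d U iidU unifU dC dCP j u cu.
have [noties h0 h1] := nul_lt1 d U n x nul1.
have hd := cntl_cntv_dist n (Vx x) (fun i => LHSD U eta n i x)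
  (fun i j _ => LHSD_lo d U eta eta01 n i j x) (fun i j => LHSD_hi d U eta eta01 n i j x) u
  (fun j => proj1 (andP (cu j))) noties.
set S := \sum_j `|A n j (u j) x|.
have e1 : `|lerr n u x| <= 2 * S + 3 * d%:R.
  rewrite /lin_err normsum_zw -/(lhs_count d U eta n u x) in hd *.
  have -> : q n * (lhs_count d U eta n u x / n%:R - C u) - (B n u x - \sum_j dC j u * A n j (u j) x) =
     (lhs_count d U eta n u x - cntv n (Vx x) u) / q n + \sum_j dC j u * A n j (u j) x.
    rewrite cntvE_normsum//; set X := \sum_j _; set L := lhs_count _ _ _ _ _ _; set b := B n u x; set Q := Num.sqrt _.
    rewrite (_ : n%:R = Q ^+ 2); last exact: qq.
    by field; rewrite gt_eqF.
  apply: (le_trans (ler_normD _ _)).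
  have s1 : `|\sum_j dC j u * A n j (u j) x| <= S.
    apply: (le_trans (ler_norm_sum _ _ _)); apply: ler_sum => j _.
    by rewrite normrM; have /andP[a b] := dC01 j; rewrite (ger0_norm a) ler_piMl.
  have s2 : `|(lhs_count d U eta n u x - cntv n (Vx x) u) / q n| <= S + 3 * d%:R.
    rewrite normrM normfV (gtr0_norm q0) ler_pdivrMr//; apply: (le_trans hd).
    rewrite (_ : 3 * d%:R = \sum_(j < d) 3); last by rewrite sumr_const card_ord mulr_natr.
    rewrite /S -big_split /= mulr_suml.
    apply: ler_sum => j _.
    rewrite cntcE_normsum//; set a := A n j (u j) x; set b := n%:R * u j.
    rewrite (_ : b - (b + q n * a) = - (q n * a)); last by ring.
    rewrite normrN normrM (gtr0_norm q0) mulrDl (mulrC (q n)) lerD2l.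
    have : 1 <= q n by rewrite -[leLHS]sqrtr1 ler_wsqrtr// ler1n.
    by lra.
  by lra.
have S0 : 0 <= S by exact: sumr_ge0.
have SS : S ^+ 2 <= d%:R * \sum_j A n j (u j) x ^+ 2.
  apply: (le_trans (sum_sqr_le d _)); apply: ler_wpM2l => //.
  by apply: ler_sum => j _; rewrite real_normK ?num_real.
rewrite -real_normK ?num_real//.
apply: (@le_trans _ _ ((2 * S + 3 * d%:R) ^+ 2)).
  by rewrite lerXn2r ?nnegrE// addr_ge0// mulr_ge0.
have := sqr_ge0 (2 * S - 3 * d%:R); move: SS; set D : R := d%:R; rewrite !expr2 => SS.
have : 8 * D * (\sum_j A n j (u j) x * A n j (u j) x) = 8 * (D * \sum_j A n j (u j) x * A n j (u j) x) by ring.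
by lra.
Qed.

End lin_err_bounds.

Lemma continuous_on_cube_right {R : realType} (d : nat) (g : ('I_d -> R) -> R) :
  continuous_on_cube g -> right_continuous_cube g.
Proof.
move=> cg u un cu cun _ unu; apply/cvgrPdist_lt => e e0.
have [dl dl0 h] := cg u cu e e0.
have : \forall n \near \oo, forall j, `|un n j - u j| < dl.
  apply: filter_forall => j; have /cvgrPdist_lt/(_ dl dl0) := unu j.
  by apply: filterS => n; rewrite distrC.
by apply: filterS => n hn; rewrite distrC; exact: h.
Qed.

Lemma cvg_div_sqrt_nat {R : realType} (a b : R) : 0 < b -> \forall n \near \oo, a / Num.sqrt n%:R <= b.
Proof.
move=> b0; near=> n.
have n0 : 0 < Num.sqrt n%:R :> R by rewrite sqrtr_gt0 ltr0n; near: n; exact: nbhs_infty_gt.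
rewrite ler_pdivrMr// mulrC -ler_pdivrMr//; near: n; exact: cvg_sqrt_nat.
Unshelve. all: by end_near. Qed.

(** * Convergence in mean of the linearization error *)

Section lin_err_limit.
Context {R : realType} {dT : measure_display} {T : measurableType dT}.
Variables (P : probability T R) (d : nat) (U : nat -> 'I_d -> T -> R).
Hypothesis iidU : iid_vectors P U.
Hypothesis unifU : uniform_marginals P U.
Variable eta : nat -> nat -> 'I_d -> T -> R.
Hypothesis meta : forall n i j, measurable_fun setT (eta n i j).
Hypothesis eta01 : forall n i j x, 0 <= eta n i j x <= 1.
Variable dC : 'I_d -> ('I_d -> R) -> R.
Local Notation Rd := (borelRd R d).
Local Notation V := (fun i x => (fun j => U i j x) : Rd).
Local Notation C := (copula P U).
Hypothesis dCP : forall j u, cube d u -> is_partial_cube C j u (dC j u).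
Hypothesis dC_cont : forall j, continuous_on_cube (dC j).
Local Notation A n j t x := (normsum d U (za d j t) n x).
Local Notation B n s x := (normsum d U (zb P d U s) n x).
Local Notation lerr := (lin_err P d U eta dC).
Local Notation q n := (Num.sqrt n%:R : R).

Lemma bmf_copula : bmf (C : Rd -> R).
Proof.
have m2 : measurable_fun setT (fun p : Rd * T => (V 0%N p.2 : Rd)).
  by apply: (measurableT_comp (measurable_V P d U iidU 0)); exact: measurable_snd.
apply: (bmf_ext (fun u : Rd => Rint P (fun x => (vle (V 0%N x) u)%:R))).
  apply: (bmf_Rint (dirac ((fun=> 0) : Rd)) P (fun p : Rd * T => (vle (V 0%N p.2) p.1)%:R)).
  by apply: (bmf_vle (fun p : Rd * T => (V 0%N p.2 : Rd)) fst) => //; exact: measurable_fst.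
by move=> u; rewrite (copulaE P d U iidU).
Qed.

Lemma bmf_dC j : bmf (fun u : Rd => dC j (clamp u)).
Proof.
apply: right_continuous_bmf; first exact: continuous_on_cube_right.
exists 1 => u cu; have /andP[h0 h1] := partial01 P d U iidU unifU dC dCP j u cu.
by rewrite ger0_norm.
Qed.

Lemma bmf_zw2 : bmf (fun p : Rd * Rd => zw P d U dC (clamp p.1) p.2).
Proof.
have m1 := measurableT_comp (@measurable_clamp R d) (@measurable_fst _ _ Rd Rd).
have m2 := @measurable_snd _ _ Rd Rd.
have c1 (g : Rd -> R) : bmf (fun u : Rd => g (clamp u)) -> bmf (fun p : Rd * Rd => g (clamp p.1)).
  by move=> hg; apply: (bmf_comp (fst : Rd * Rd -> Rd) (fun u : Rd => g (clamp u))) => //; exact: measurable_fst.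
apply: bmfB.
  apply: bmfB; first by exact: (bmf_vle (snd : Rd * Rd -> Rd) (fun p => clamp p.1)).
  by apply: c1; apply: (bmf_comp (clamp : Rd -> Rd) (C : Rd -> R)); [exact: measurable_clamp|exact: bmf_copula].
apply: bmf_sum => j _; apply: bmfM; first by apply: c1; exact: bmf_dC.
apply: bmfB.
  apply: bmf_bool; apply: measurable_fun_ler.
    exact: (measurableT_comp (measurable_coord j) m2).
  exact: (measurableT_comp (measurable_coord j) m1).
split; first exact: (measurableT_comp (measurable_coord j) m1).
by exists 1 => p; have /andP[h0 h1] := cube_clamp p.1 j; rewrite ger0_norm.
Qed.

Lemma measurable_LHSD n i : measurable_fun setT (fun x => (LHSD U eta n i x : Rd)).
Proof.
apply: measurable_vec => j; rewrite /LHSD /=.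
apply: measurable_funD; last exact: measurable_funM.
apply: measurable_funM => //; apply: measurable_funB => //.
under eq_fun do rewrite /rank_stat (natr_count (fun k => U k j _ <= U i j _)).
have [] : bmf (fun x => \sum_(k < n) (U k j x <= U i j x)%R%:R : R) => //.
apply: bmf_sum => k _; apply: bmf_bool.
by apply: measurable_fun_ler; exact: measurable_U iidU _ _.
Qed.

Lemma bmf_lin_err2 n : bmf (fun p : Rd * T => lerr n (clamp p.1) p.2).
Proof.
have m1 := measurableT_comp (@measurable_clamp R d) (@measurable_fst _ _ Rd T).
apply: bmfB.
  apply: bmfZ; apply: bmfB.
    apply: (bmf_ext (fun p : Rd * T => n%:R^-1 * lhs_count d U eta n (clamp p.1) p.2)); last by move=> p; rewrite mulrC.
    apply: bmfZ; apply: bmf_sum => i _.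
    apply: (bmf_vlt (fun p : Rd * T => (LHSD U eta n i p.2 : Rd)) (fun p => clamp p.1)) => //.
    by apply: (measurableT_comp (measurable_LHSD n i)); exact: measurable_snd.
  by apply: (bmf_comp (fun p : Rd * T => clamp p.1 : Rd)) => //; exact: bmf_copula.
apply: bmfZ; apply: bmf_sum => i _.
apply: (bmf_comp (fun p : Rd * T => (p.1, V i p.2) : Rd * Rd) _ _ bmf_zw2).
apply: measurable_fun_pair; first exact: measurable_fst.
by apply: (measurableT_comp (measurable_V P d U iidU i)); exact: measurable_snd.
Qed.

Lemma bmf_lin_err n u : cube d u -> bmf (lerr n u).
Proof. by move=> cu; have := bmf_pairr _ (u : Rd) (bmf_lin_err2 n); rewrite /= clamp_id. Qed.

Lemma bmf_lin_err_sqr n u : cube d u -> bmf (fun x => lerr n u x ^+ 2).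
Proof.
move=> cu; apply: (bmf_ext (fun x => lerr n u x * lerr n u x)); last by move=> x; rewrite expr2.
by apply: bmfM; exact: bmf_lin_err.
Qed.

Lemma bmf_sqr (g : T -> R) : bmf g -> bmf (fun x => g x ^+ 2).
Proof. by move=> hg; apply: (bmf_ext (fun x => g x * g x)); [exact: bmfM|move=> x; rewrite expr2]. Qed.

(** The constant is [26 = 8 + 18], each [A] having second moment at most 1. The term [M * nul]
    dominates the integrand on the exceptional event and has integral 0. *)
Lemma Rint_lin_err_sqr n u : cube d u -> Rint P (fun x => lerr n u x ^+ 2) <= 26 * d%:R ^+ 2.
Proof.
move=> cu; have [->|n0] := posnP n.
  (* At [n = 0] both terms vanish, through the factors [sqrt 0] and [0^-1 = 0]. *)
  under eq_fun do rewrite /lin_err sqrtr0 mul0r /normsum sqrtr0 invr0 mul0r subr0 expr0n.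
  by rewrite Rint1 mulr_ge0// sqr_ge0.
have hl := bmf_lin_err_sqr n u cu.
have [M M0 hM] := bmf_bound _ hl.
have hA j : bmf (fun x => A n j (u j) x ^+ 2) by apply: bmf_sqr; apply: (bmf_normsum P d U iidU); exact: bmf_za.
have hS : bmf (fun x => \sum_j A n j (u j) x ^+ 2) by apply: bmf_sum.
have hZ := bmfZ (8 * d%:R) _ hS.
have hN := bmfZ M _ (bmf_nul P d U iidU n).
have hC : bmf (fun _ : T => 18 * d%:R ^+ 2 : R) by exact: bmf_cst.
apply: (@le_trans _ _ (Rint P (fun x => 8 * d%:R * (\sum_j A n j (u j) x ^+ 2) + 18 * d%:R ^+ 2 + M * nul d U n x))).
  apply: Rint_le => //; first by apply: bmfD => //; exact: bmfD.
  move=> x; have [h|h] := ltP (nul d U n x) 1.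
    apply: ler_wpDr; first by rewrite mulr_ge0// nul_ge0.
    exact: (lin_err_sqr P d U iidU unifU eta eta01 dC dCP).
  apply: ler_wpDl.
    by rewrite addr_ge0// mulr_ge0// ?mulr_ge0// ?sqr_ge0//; apply: sumr_ge0 => j _; exact: sqr_ge0.
  by apply: (le_trans (ler_norm _)); apply: (le_trans (hM x)); rewrite ler_peMr.
rewrite (RintD P _ _ (bmfD _ _ hZ hC) hN) (RintD P _ _ hZ hC) (RintZ P _ _ hS).
rewrite (RintZ P _ _ (bmf_nul P d U iidU n)) (Rint_nul P d U iidU unifU) mulr0 addr0 Rint1 Rint_sum//.
have : \sum_j Rint P (fun x => A n j (u j) x ^+ 2) <= d%:R.
  rewrite -[d in leRHS]card_ord -sumr_const; apply: ler_sum => j _.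
  exact: (Rint_normsum_za P d U iidU unifU).
set S := \sum_j _ => hSd.
have : 8 * d%:R * S <= 8 * d%:R * d%:R by apply: ler_wpM2l => //; rewrite mulr_ge0.
by rewrite expr2; lra.
Qed.

(* At least 1 wherever a hypothesis of lin_err_good fails: Chebyshev's inequality in additive form. *)
Definition bad_events (e : R) (K n : nat) (u : 'I_d -> R) (x : T) : R :=
  nul d U n x + \sum_j (e * (K%:R - 3))^-2 * A n j (u j) x ^+ 2 +
  \sum_j \sum_(k < (K + K).+1) (e / 2)^-2 * (A n j (gridpt (q n) e K (u j) k) x - A n j (u j) x) ^+ 2 +
  \sum_(k : {ffun 'I_d -> 'I_(K + K).+1})
    e^-2 * (B n (fun j => gridpt (q n) e K (u j) (k j)) x - B n u x) ^+ 2.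

Lemma bad_events_lt1 e K n u x : 0 < e -> (3 < K)%N -> bad_events e K n u x < 1 ->
  [/\ nul d U n x < 1, (forall j, `|A n j (u j) x| <= e * (K%:R - 3)),
  (forall j k, (k <= K + K)%N ->
    `|A n j (gridpt (q n) e K (u j) k) x - A n j (u j) x| <= e / 2) &
  (forall k : 'I_d -> nat, (forall j, (k j <= K + K)%N) ->
    `|B n (fun j => gridpt (q n) e K (u j) (k j)) x - B n u x| <= e)].
Proof.
move=> e0 K3; rewrite /bad_events.
have eK : 0 < e * (K%:R - 3) by rewrite mulr_gt0// subr_gt0 ltr_nat.
have e2 : 0 < e / 2 by rewrite divr_gt0.
have p0 (a b : R) : 0 <= a^-2 * b ^+ 2 by rewrite mulr_ge0// ?invr_ge0 sqr_ge0.
set S2 := \sum_j _; set S1 := \sum_j _; set S3 := \sum_(k : {ffun _ -> _}) _ => h.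
have N0 := nul_ge0 d U n x.
have S10 : 0 <= S1 by apply: sumr_ge0.
have S20 : 0 <= S2 by apply: sumr_ge0 => j _; apply: sumr_ge0.
have S30 : 0 <= S3 by apply: sumr_ge0.
have cheb (a b : R) : 0 < a -> a^-2 * b ^+ 2 < 1 -> `|b| <= a.
  move=> a0; rewrite mulrC ltr_pdivrMr ?exprn_gt0// mul1r => /ltW hb.
  by rewrite -(ger0_norm (ltW a0)) -ler_sqr ?nnegrE// -!normrX !ger0_norm ?sqr_ge0.
split.
- by lra.
- move=> j; apply: cheb => //; apply: (@le_lt_trans _ _ S1); last by lra.
  by rewrite /S1 (bigD1 j)//= lerDl; apply: sumr_ge0.
- move=> j k kK; apply: cheb => //; apply: (@le_lt_trans _ _ S2); last by lra.
  rewrite /S2 (bigD1 j)//= ler_wpDr//; first by apply: sumr_ge0 => j' _; apply: sumr_ge0.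
  by rewrite (bigD1 (Ordinal (kK : (k < (K + K).+1)%N)))//= lerDl; apply: sumr_ge0.
- move=> k kK; apply: cheb => //; apply: (@le_lt_trans _ _ S3); last by lra.
  pose k' := [ffun j => Ordinal (kK j : (k j < (K + K).+1)%N)].
  rewrite (_ : (fun j => gridpt (q n) e K (u j) (k j)) = fun j => gridpt (q n) e K (u j) (k' j)); last first.
    by apply/funext => j; rewrite ffunE.
  by rewrite /S3 (bigD1 k')//= lerDl; apply: sumr_ge0.
Qed.

(** Sum over the grid points of a Chebyshev factor times [e K] per coordinate involved; divided by
    [sqrt n], it bounds the part of the grid in the mean of [bad_events]. *)
Definition grid_const (e : R) (K : nat) : R :=
  \sum_(j < d) \sum_(k < (K + K).+1) (e / 2)^-2 * (e * K%:R) +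
  \sum_(k : {ffun 'I_d -> 'I_(K + K).+1}) e^-2 * \sum_(j < d) (e * K%:R).

Lemma bmf_bad_parts e K n u : bmf (bad_events e K n u).
Proof.
have hA j t : bmf (normsum d U (za d j t) n) by apply: (bmf_normsum P d U iidU); exact: bmf_za.
have hB s : bmf (normsum d U (zb P d U s) n) by apply: (bmf_normsum P d U iidU); exact: bmf_zb.
apply: bmfD; first apply: bmfD; first apply: bmfD.
- exact: bmf_nul iidU n.
- by apply: bmf_sum => j _; apply: bmfZ; exact: bmf_sqr.
- by apply: bmf_sum => j _; apply: bmf_sum => k _; apply: bmfZ; apply: bmf_sqr; exact: bmfB.
- by apply: bmf_sum => k _; apply: bmfZ; apply: bmf_sqr; exact: bmfB.
Qed.

Lemma Rint_bad_events e K n u : (0 < n)%N -> cube d u -> 0 < e ->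
  Rint P (bad_events e K n u) <= (e * (K%:R - 3))^-2 * d%:R + grid_const e K / q n.
Proof.
move=> n0 cu e0; have q0 : 0 < q n := q_gt0 n n0.
have hA j t : bmf (normsum d U (za d j t) n) by apply: (bmf_normsum P d U iidU); exact: bmf_za.
have hB s : bmf (normsum d U (zb P d U s) n) by apply: (bmf_normsum P d U iidU); exact: bmf_zb.
have h0 := bmf_nul P d U iidU n.
have h1 j : bmf (fun x => A n j (u j) x ^+ 2) by exact: bmf_sqr.
have h2 j t : bmf (fun x => (A n j t x - A n j (u j) x) ^+ 2) by apply: bmf_sqr; exact: bmfB.
have h3 t : bmf (fun x => (B n t x - B n u x) ^+ 2) by apply: bmf_sqr; exact: bmfB.
have h1' : bmf (fun x => \sum_j (e * (K%:R - 3))^-2 * A n j (u j) x ^+ 2).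
  by apply: bmf_sum => j _; exact: bmfZ.
have h2'' j : bmf (fun x => \sum_(k < (K + K).+1) (e / 2)^-2 * (A n j (gridpt (q n) e K (u j) k) x - A n j (u j) x) ^+ 2).
  by apply: bmf_sum => k _; exact: bmfZ.
have h2' : bmf (fun x => \sum_j \sum_(k < (K + K).+1) (e / 2)^-2 * (A n j (gridpt (q n) e K (u j) k) x - A n j (u j) x) ^+ 2).
  by apply: bmf_sum => j _.
have h3' : bmf (fun x => \sum_(k : {ffun 'I_d -> 'I_(K + K).+1})
    e^-2 * (B n (fun j => gridpt (q n) e K (u j) (k j)) x - B n u x) ^+ 2).
  by apply: bmf_sum => k _; exact: bmfZ.
rewrite /bad_events (RintD P _ _ (bmfD _ _ (bmfD _ _ h0 h1') h2') h3').
rewrite (RintD P _ _ (bmfD _ _ h0 h1') h2') (RintD P _ _ h0 h1').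
rewrite (Rint_nul P d U iidU unifU) add0r -addrA; apply: lerD.
  rewrite Rint_sum; last by move=> j _; exact: bmfZ.
  rewrite mulr_natr -[d in leRHS]card_ord -sumr_const; apply: ler_sum => j _.
  rewrite RintZ// ler_piMr// ?invr_ge0 ?sqr_ge0//.
  exact: (Rint_normsum_za P d U iidU unifU).
have gd j k : (k <= K + K)%N -> `|gridpt (q n) e K (u j) k - u j| <= e * K%:R / q n.
  move=> kK; rewrite ler_pdivlMr// -[X in _ * X](gtr0_norm q0) -normrM mulrC.
  exact: gridpt_dist.
rewrite /grid_const mulrDl; apply: lerD.
  rewrite Rint_sum// mulr_suml; apply: ler_sum => j _.
  rewrite Rint_sum; last by move=> k _; exact: bmfZ.
  rewrite mulr_suml; apply: ler_sum => k _; rewrite RintZ// -mulrA.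
  apply: ler_wpM2l; first by rewrite invr_ge0 sqr_ge0.
  apply: (le_trans (Rint_normsum_za_dist P d U iidU unifU n j _ _ (gridpt_01 _ _ _ _ _) (cu j))).
  by apply: gd; rewrite -ltnS.
rewrite Rint_sum; last by move=> k _; exact: bmfZ.
rewrite mulr_suml; apply: ler_sum => k _; rewrite RintZ// -mulrA.
apply: ler_wpM2l; first by rewrite invr_ge0 sqr_ge0.
apply: (le_trans (Rint_normsum_zb_dist P d U iidU unifU n _ _ (fun j => gridpt_01 _ _ _ _ _) cu)).
rewrite mulr_suml; apply: ler_sum => j _.
by apply: gd; rewrite -ltnS.
Qed.

(** On the good event [lin_err_good] applies. Elsewhere [bad_events >= 1] and
    [a <= de * a^2 + de^-1], so that the bounded second moment is paid with the small weight [de]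
    and the probability with the weight [de^-1]. *)
Lemma Rint_lin_err_le n u (e et dl de : R) (K : nat) :
  (0 < n)%N -> cube d u -> 0 < e -> 0 < et -> 0 < de -> (3 < K)%N ->
  (forall s, cube d s -> (forall j, `|s j - u j| < dl) ->
    `|C s - C u - \sum_j dC j u * (s j - u j)| <= et * \sum_j `|s j - u j|) ->
  (forall j, 0 < u j -> e * K%:R / q n <= u j) ->
  (forall j, u j < 1 -> e * K%:R / q n <= 1 - u j) ->
  e * K%:R < dl * q n ->
  Rint P (fun x => `|lerr n u x|) <=
    (e * (1 + 2 * d%:R) + et * (d%:R * (e * K%:R))) + de * (26 * d%:R ^+ 2) +
    de^-1 * ((e * (K%:R - 3))^-2 * d%:R + grid_const e K / q n).
Proof.
move=> n0 cu e0 et0 de0 K3 diff c0 c1 cdl.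
set b := e * _ + _.
have b0 : 0 <= b by rewrite /b addr_ge0// !mulr_ge0// ?ltW// addr_ge0// mulr_ge0.
have hl := bmf_lin_err n u cu.
have hl2 := bmf_lin_err_sqr n u cu.
have hb := bmf_bad_parts e K n u.
have hC : bmf (fun _ : T => b) by exact: bmf_cst.
have hl2' := bmfZ de _ hl2.
have hb' := bmfZ de^-1 _ hb.
apply: (@le_trans _ _ (Rint P (fun x => b + de * lerr n u x ^+ 2 + de^-1 * bad_events e K n u x))).
  apply: Rint_le; [exact: bmf_norm|by apply: bmfD => //; exact: bmfD|].
  move=> x.
  have bad0 : 0 <= bad_events e K n u x.
    rewrite /bad_events !addr_ge0// ?nul_ge0//; first [apply: sumr_ge0 => j _]; 
      try (apply: sumr_ge0 => k _); by rewrite mulr_ge0// ?invr_ge0 ?sqr_ge0.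
  have [h|h] := ltP (bad_events e K n u x) 1.
    have [g1 g2 g3 g4] := bad_events_lt1 e K n u x e0 K3 h.
    rewrite -addrA; apply: ler_wpDr.
      by rewrite addr_ge0// mulr_ge0// ?invr_ge0 ?sqr_ge0// ltW.
    exact: (lin_err_good P d U iidU unifU eta eta01 dC dCP n u e et dl K x n0 cu e0 et0).
  rewrite -addrA; apply: ler_wpDl => //.
  apply: (@le_trans _ _ (de * lerr n u x ^+ 2 + de^-1)); last first.
    by rewrite lerD2l ler_peMr// invr_ge0 ltW.
  rewrite -(real_normK (num_real _)); set a := `|_|.
  have := sqr_ge0 (de * a - 1); rewrite sqrrB1 => hh.
  rewrite -(ler_pM2l de0) mulrDr mulfV ?gt_eqF//.
  have : 0 <= de * a by rewrite mulr_ge0 ?normr_ge0// ltW.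
  by move: hh; rewrite -[_ *+ 2]mulr_natl exprMn expr2; lra.
rewrite (RintD P _ _ (bmfD _ _ hC hl2') hb') (RintD P _ _ hC hl2') Rint1 (RintZ P _ _ hl2) (RintZ P _ _ hb).
apply: lerD; first apply: lerD => //.
  by rewrite ler_pM2l//; exact: Rint_lin_err_sqr.
by rewrite ler_pM2l ?invr_gt0//; exact: Rint_bad_events.
Qed.

Lemma lin_err_cvg u : cube d u -> (fun n => Rint P (fun x => `|lerr n u x|)) @ \oo --> (0 : R).
Proof.
move=> cu; apply/cvgrPdist_le => eps eps0.
(* With [et = K^-1] the first part of the bound in [Rint_lin_err_le] is [e (1 + 2 d) + d e = c e],
   that is [eps / 4]. *)
pose c : R := 1 + 3 * d%:R.
have c0 : 0 < c by rewrite /c ltr_pwDl// mulr_ge0.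
pose e : R := eps / (4 * c).
have e0 : 0 < e by rewrite divr_gt0// mulr_gt0.
pose m : R := 26 * d%:R ^+ 2 + 1.
have m0 : 0 < m by rewrite /m ltr_wpDl// mulr_ge0// sqr_ge0.
pose de : R := eps / (4 * m).
have de0 : 0 < de by rewrite divr_gt0// mulr_gt0.
(* Chosen so that the Chebyshev term at the centre of the grid equals [L / (K - 3)^2] times
   [eps / 4]; [K] is fixed accordingly, and [n] is taken large last. *)
pose L : R := 4 * d%:R / (de * e ^+ 2 * eps).
have L0 : 0 <= L.
  apply: divr_ge0; first exact: mulr_ge0.
  by apply: ltW; rewrite mulr_gt0// mulr_gt0// exprn_gt0.
pose K : nat := (4 + Num.truncn L).+1.
have K3 : (3 < K)%N by [].
have KL : 1 + L <= K%:R - 3.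
  have := truncnS_gt L; set t := Num.truncn L.
  by rewrite (_ : K%:R = t.+1%:R + 4); [lra|rewrite -natrD /K addnC].
have K0 : 0 < K%:R :> R by rewrite ltr0n.
have et0 : 0 < K%:R^-1 :> R by rewrite invr_gt0.
have [dl dl0 diff] := copula_differentiable P d U iidU unifU dC dCP dC_cont u K%:R^-1 cu et0.
have part1 : de^-1 * ((e * (K%:R - 3))^-2 * d%:R) <= eps / 4.
  set k := K%:R - 3 in KL *.
  have k0 : 0 < k by lra.
  have k2 : L <= k ^+ 2.
    apply: (@le_trans _ _ k); first by lra.
    by rewrite expr2 ler_peMl; lra.
  rewrite exprMn (_ : _ * _ = L / k ^+ 2 * (eps / 4)).
    by rewrite ler_piMl ?divr_ge0 ?(ltW eps0)// ler_pdivrMr ?mul1r ?exprn_gt0.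
  by rewrite /L; field; rewrite !gt_eqF.
near=> n.
have n0 : (0 < n)%N by near: n; exact: nbhs_infty_gt.
have q0 : 0 < q n := q_gt0 n n0.
rewrite sub0r normrN ger0_norm; last by apply: Rint_ge0 => x; exact: normr_ge0.
apply: (le_trans (Rint_lin_err_le n u e K%:R^-1 dl de K n0 cu e0 et0 de0 K3 diff _ _ _)).
- near: n; apply: filter_forall => j; have [uj|uj] := ltP 0 (u j); last by apply: nearW.
  by apply: filterS (cvg_div_sqrt_nat (e * K%:R) _ uj).
- near: n; apply: filter_forall => j; have [uj|uj] := ltP (u j) 1; last by apply: nearW.
  by have := cvg_div_sqrt_nat (e * K%:R) (1 - u j); rewrite subr_gt0 => /(_ uj); apply: filterS.
- rewrite [ltRHS]mulrC -ltr_pdivrMr//; apply: (@lt_le_trans _ _ (e * K%:R / dl + 1)); first by rewrite ltrDl.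
  by near: n; exact: cvg_sqrt_nat.
have -> : e * (1 + 2 * d%:R) + K%:R^-1 * (d%:R * (e * K%:R)) = eps / 4.
  rewrite (_ : eps = e * (4 * c)); last by rewrite /e divfK// gt_eqF// mulr_gt0.
  by rewrite /c; field; rewrite gt_eqF.
have h2 : de * (26 * d%:R ^+ 2) <= eps / 4.
  have -> : eps / 4 = de * m by rewrite /de; field; rewrite gt_eqF.
  by rewrite ler_pM2l// /m lerDl.
have h3 : de^-1 * (grid_const e K / q n) <= eps / 4.
  rewrite mulrA; near: n; apply: cvg_div_sqrt_nat; exact: divr_gt0.
by rewrite [de^-1 * (_ + _)]mulrDr; lra.
Unshelve. all: by end_near. Qed.

Lemma Rint_lin_err_bounded n u : cube d u ->
  Rint P (fun x => `|lerr n u x|) <= 1 + 26 * d%:R ^+ 2.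
Proof.
move=> cu; have hl := bmf_lin_err n u cu; have hl2 := bmf_lin_err_sqr n u cu.
apply: (@le_trans _ _ (Rint P (fun x => 1 + lerr n u x ^+ 2))).
  apply: Rint_le; [exact: bmf_norm|by apply: bmfD => //; exact: bmf_cst|].
  move=> x; rewrite -(real_normK (num_real _)); set a := `|_|.
  by have := sqr_ge0 (a - 1); have := normr_ge0 (lerr n u x); rewrite -/a sqrrB1 -[_ *+ 2]mulr_natl; lra.
rewrite RintD//; last exact: bmf_cst.
by rewrite Rint1 lerD2l; exact: Rint_lin_err_sqr.
Qed.

End lin_err_limit.

(** * Integral representation of the estimator *)

Section off_null.
Import HBNNSimple.

(** Intended for functions known to be measurable only after a change on [N]; hence the detour
    through the simple functions below [f], restricted to the complement of [N]. *)
Lemma ge0_integral_off_null_le {dT} {T : measurableType dT} {R : realType}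
  (mu : {measure set T -> \bar R}) (N : set T) (f g : T -> \bar R) :
  measurable N -> mu N = 0%E -> (forall x, (0 <= f x)%E) -> (forall x, (0 <= g x)%E) ->
  (forall x, ~ N x -> f x = g x) -> (\int[mu]_x f x <= \int[mu]_x g x)%E.
Proof.
move=> mN N0 f0 g0 fg; rewrite !ge0_integralE//.
apply: ge_ereal_sup => _ [h /= hf <-].
have mN' : measurable (~` N) by exact: measurableC.
have hE : sintegral mu h = sintegral mu (h \_ (~` N)).
  rewrite -integralT_nnsfun -integral_nnsfun// -[in RHS]setTD.
  apply: ge0_negligible_integral => //; first exact/measurable_EFinP.
  by move=> x _; rewrite lee_fin.
rewrite hE mrestrict; apply: ereal_sup_ubound; exists (proj_nnsfun h mN') => // x.
rewrite -mrestrict !patch_setT /patch.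
case: ifPn => [|_]; last exact: g0.
by rewrite inE => Nx; have := hf x; rewrite patch_setT fg.
Qed.

End off_null.

Lemma Rint_off_null {dT} {T : measurableType dT} {R : realType}
  (mu : {measure set T -> \bar R}) (N : set T) (f g : T -> R) :
  measurable N -> mu N = 0%E -> (forall x, ~ N x -> f x = g x) ->
  Rintegral mu setT f = Rintegral mu setT g.
Proof.
move=> mN N0 fg; rewrite /Rintegral; congr fine.
rewrite integralE [RHS]integralE; congr (_ - _)%E.
  by apply/eqP; rewrite eq_le; apply/andP; split; apply: (ge0_integral_off_null_le mu N) => // x Nx;
    rewrite !funeposE fg.
by apply/eqP; rewrite eq_le; apply/andP; split; apply: (ge0_integral_off_null_le mu N) => // x Nx;
  rewrite !funenegE fg.
Qed.

Lemma natr_forall {R : realType} (d : nat) (b : 'I_d -> bool) :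
  ([forall j, b j])%:R = \prod_j (b j)%:R :> R.
Proof.
have [/forallP h|/forallPn[j hj]] := boolP [forall j, b j].
  by rewrite big1// => j _; rewrite h.
by rewrite (bigD1 j)//= (negbTE hj) mul0r.
Qed.

(** * Integration against the signed measure *)

Section signed_integral.
Context {R : realType} {d : nat}.
Local Notation Rd := (borelRd R d).
Variables m1 m2 : {finite_measure set Rd -> \bar R}.
Hypothesis m1_cube : m1 (~` cube d) = 0%E.
Hypothesis m2_cube : m2 (~` cube d) = 0%E.

Definition sint (h : Rd -> R) : R := Rint m1 h - Rint m2 h.

Lemma sintD h k : bmf h -> bmf k -> sint (fun u => h u + k u) = sint h + sint k.
Proof. by move=> hh hk; rewrite /sint !RintD//; ring. Qed.

Lemma sintZ c h : bmf h -> sint (fun u => c * h u) = c * sint h.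
Proof. by move=> hh; rewrite /sint !RintZ//; ring. Qed.

Lemma sint_sum (I : Type) (s : seq I) (Q : pred I) (F : I -> Rd -> R) :
  (forall i, Q i -> bmf (F i)) -> sint (fun u => \sum_(i <- s | Q i) F i u) = \sum_(i <- s | Q i) sint (F i).
Proof. by move=> hF; rewrite /sint !Rint_sum// sumrB. Qed.

Lemma measurable_cubeC : measurable (~` cube d : set Rd).
Proof. by apply: measurableC; exact: measurable_cube. Qed.

Lemma eq_sint_cube h k : (forall u, cube d u -> h u = k u) -> sint h = sint k.
Proof.
move=> hk; rewrite /sint; congr (_ - _).
  by apply: (Rint_off_null m1 _ _ _ measurable_cubeC m1_cube) => u /contrapT; exact: hk.
by apply: (Rint_off_null m2 _ _ _ measurable_cubeC m2_cube) => u /contrapT; exact: hk.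
Qed.

Lemma sint_clamp h : sint (fun u => h (clamp u)) = sint h.
Proof. by apply: eq_sint_cube => u cu; rewrite clamp_id. Qed.

Lemma sint_norm h : bmf h -> `|sint h| <= Rint m1 (fun u => `|h u|) + Rint m2 (fun u => `|h u|).
Proof.
by move=> hh; apply: (le_trans (ler_normB _ _)); apply: lerD; exact: Rint_norm.
Qed.

Lemma bmf_sint {dS} {S : measurableType dS} (s0 : S) (F : S * Rd -> R) :
  bmf F -> bmf (fun x => sint (fun u => F (x, u))).
Proof.
by move=> hF; apply: bmfB; [exact: (bmf_Rint (dirac s0) m1)|exact: (bmf_Rint (dirac s0) m2)].
Qed.

Lemma sint_fubini {dS} {S : measurableType dS} (P : {finite_measure set S -> \bar R}) (F : Rd * S -> R) :
  bmf F -> Rint P (fun x => sint (fun u => F (u, x))) = sint (fun u => Rint P (fun x => F (u, x))).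
Proof.
move=> hF; have hF' : bmf (fun p : S * Rd => F (p.2, p.1)).
  apply: (bmf_comp (fun p : S * Rd => (p.2, p.1)) F) => //.
  by apply: measurable_fun_pair; [exact: measurable_snd|exact: measurable_fst].
rewrite /sint RintB.
- by rewrite !(Rint_fubini _ _ _ hF).
- exact: (bmf_Rint P m1 _ hF').
- exact: (bmf_Rint P m2 _ hF').
Qed.

Lemma Rintegral_cube (m : {finite_measure set Rd -> \bar R}) h :
  m (~` cube d) = 0%E -> Rintegral m (cube d) h = Rint m h.
Proof.
move=> mc; rewrite Rintegral_mkcond.
apply: (Rint_off_null m _ _ _ measurable_cubeC mc) => u /contrapT cu.
by rewrite patchE mem_set.
Qed.

Lemma dint_signedE (K : ('I_d -> R) -> ('I_d -> R) -> R) :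
  bmf (fun p : Rd * Rd => K (clamp p.1) (clamp p.2)) ->
  dint_signed m1 m2 K = sint (fun u => sint (fun v => K (clamp u) (clamp v))).
Proof.
move=> hK.
have eK (n1 n2 : {finite_measure set Rd -> \bar R}) : n1 (~` cube d) = 0%E -> n2 (~` cube d) = 0%E ->
   dint n1 n2 K = Rint n1 (fun u => Rint n2 (fun v => K (clamp u) (clamp v))).
  move=> c1 c2; rewrite /dint (Rintegral_cube n1 _ c1).
  apply: (Rint_off_null n1 _ _ _ measurable_cubeC c1) => u /contrapT cu.
  rewrite (Rintegral_cube n2 _ c2); apply: (Rint_off_null n2 _ _ _ measurable_cubeC c2) => v /contrapT cv.
  by rewrite !clamp_id.
rewrite /dint_signed !eK// {1}/sint /sint !RintB ?opprB; first by ring.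
all: by [exact: (bmf_Rint m1 m1 _ hK)|exact: (bmf_Rint m1 m2 _ hK)].
Qed.

(* Inclusion-exclusion: the terms indexed by a proper subset are values of fhat f on an
   upper face, where it vanishes. *)
Lemma fhat_upper (f : ('I_d -> R) -> R) :
  (forall x, cube d x -> sint (fun u => (vle u x)%:R) = fhat f x) ->
  forall x, cube d x -> sint (fun u => (vlt x u)%:R) = (-1) ^+ d * fhat f x.
Proof.
move=> hf x cx.
(* On the cube a bound 1 imposes nothing, so [xS S] constrains the coordinates in [S] only. *)
pose xS (S : {set 'I_d}) j := if j \in S then x j else 1.
have cxS S : cube d (xS S) by move=> j; rewrite /xS; case: ifP => // _; rewrite ler01 lexx.
have hb S : bmf (fun u : Rd => (vle u (xS S))%:R : R) by exact: (bmf_vle (id : Rd -> Rd) (fun=> xS S)).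
transitivity (sint (fun u => \sum_(S : {set 'I_d}) (-1) ^+ #|S| * (vle u (xS S))%:R)).
  apply: eq_sint_cube => u cu; rewrite /vlt natr_forall.
  rewrite (eq_bigr (fun j => - (u j <= x j)%R%:R + 1)); last first.
    by move=> j _; case: leP => _; rewrite ?addNr// oppr0 add0r.
  rewrite bigA_distr; apply: eq_bigr => S _.
  rewrite /vle natr_forall -prodr_const [X in X * _]big_mkcond -big_split /=.
  apply: eq_bigr => j _; rewrite /xS; case: ifP => _; first by rewrite mulN1r.
  by rewrite mul1r; have /andP[_ ->] := cu j.
rewrite sint_sum; last by move=> S _; exact: bmfZ.
rewrite (bigD1 finset.setT)//= big1 ?addr0.
  rewrite sintZ// cardsT card_ord hf//; congr (_ * fhat f _).
  by apply/funext => j; rewrite /xS finset.in_setT.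
move=> S ST; rewrite sintZ// hf// /fhat ifT ?mulr0//.
have /existsP[j jS] : [exists j, j \notin S].
  rewrite -negb_forall; apply: contra ST => /forallP h; apply/eqP/finset.setP => j.
  by rewrite finset.in_setT h.
by apply/existsP; exists j; rewrite /xS (negbTE jS).
Qed.

End signed_integral.

Lemma null_of_Rint {dT} {T : measurableType dT} {R : realType} (P : {finite_measure set T -> \bar R}) (h : T -> R) :
  bmf h -> (forall x, 0 <= h x) -> Rint P h = 0 ->
  measurable [set x | 1 <= h x] /\ P [set x | 1 <= h x] = 0%E.
Proof.
move=> hh h0 hP.
have mN : measurable [set x | 1 <= h x].
  rewrite -[X in measurable X]setTI; have [mh _] := hh.
  have mb : measurable_fun setT (fun x => 1 <= h x) by exact: measurable_fun_ler.
  by have := mb measurableT [set true] I; rewrite /preimage /=.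
split => //; have fP := fin_num_measure P _ mN.
apply/eqP; rewrite -(fineK fP) eqe; apply/eqP; apply/le_anti/andP; split; last exact: fine_ge0.
rewrite -(Rint_indicb P (fun x => 1 <= h x))// -hP; apply: Rint_le => //; first exact: bmf_indicb.
by move=> x; have [h1|_] := leP 1 (h x); rewrite ?h1.
Qed.

(** * Reduction of the estimator to an i.i.d. sum *)

Section representation.
Context {R : realType} {dT : measure_display} {T : measurableType dT}.
Variables (P : probability T R) (d : nat) (U : nat -> 'I_d -> T -> R).
Hypothesis iidU : iid_vectors P U.
Hypothesis unifU : uniform_marginals P U.
Variable eta : nat -> nat -> 'I_d -> T -> R.
Hypothesis meta : forall n i j, measurable_fun setT (eta n i j).
Hypothesis eta01 : forall n i j x, 0 <= eta n i j x <= 1.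
Variable dC : 'I_d -> ('I_d -> R) -> R.
Local Notation Rd := (borelRd R d).
Local Notation V := (fun i x => (fun j => U i j x) : Rd).
Local Notation C := (copula P U).
Hypothesis dCP : forall j u, cube d u -> is_partial_cube C j u (dC j u).
Hypothesis dC_cont : forall j, continuous_on_cube (dC j).
Local Notation lerr := (lin_err P d U eta dC).
Local Notation q n := (Num.sqrt n%:R : R).
Local Notation zww := (zw P d U dC).

Lemma Rint_nul_eq n (h k : T -> R) : (forall x, nul d U n x < 1 -> h x = k x) -> Rint P h = Rint P k.
Proof.
move=> hk; have [mN N0] := null_of_Rint P _ (bmf_nul P d U iidU n) (nul_ge0 d U n) (Rint_nul P d U iidU unifU n).
by apply: (Rint_off_null P _ _ _ mN N0) => x /= /negP; rewrite -ltNge; exact: hk.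
Qed.

Lemma Rint_nul_le n (h k : T -> R) : bmf h -> bmf k -> (forall x, 0 <= k x) ->
  (forall x, nul d U n x < 1 -> h x <= k x) -> Rint P h <= Rint P k.
Proof.
move=> hh hk k0 hhk; have [M M0 hM] := bmf_bound _ hh.
have hN := bmf_nul P d U iidU n.
apply: (@le_trans _ _ (Rint P (fun x => k x + M * nul d U n x))).
  apply: Rint_le => //; first by apply: bmfD => //; exact: bmfZ.
  move=> x; have [h1|h1] := ltP (nul d U n x) 1.
    by apply: ler_wpDr; [rewrite mulr_ge0 ?nul_ge0|exact: hhk].
  by apply: ler_wpDl => //; apply: (le_trans (ler_norm _)); apply: (le_trans (hM x)); rewrite ler_peMr.
by rewrite RintD//; [rewrite RintZ// Rint_nul// mulr0 addr0|exact: bmfZ].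
Qed.

Lemma vlt_vle (s : 'I_d -> R) (y : 'I_d -> R) : (forall j, s j != y j) -> vlt y s = vle y s.
Proof. by move=> sy; rewrite /vlt /vle; apply: eq_forallb => j; rewrite lt_neqAle eq_sym sy. Qed.

Lemma Rint_vlt s : Rint P (fun x => (vlt (V 0%N x) s)%:R) = C s.
Proof.
have ha j : bmf (fun y => (s j == U 0%N j y)%:R : R).
  apply: bmf_bool; rewrite (_ : (fun y => _) = fun y => (s j <= U 0%N j y) && (U 0%N j y <= s j)).
    by apply: measurable_and; apply: measurable_fun_ler => //; exact: measurable_U iidU _ _.
  by apply/funext => y; rewrite eq_le.
have hS : bmf (fun y => \sum_j (s j == U 0%N j y)%:R : R) by exact: bmf_sum.
have S0 : Rint P (fun y => \sum_j (s j == U 0%N j y)%:R) = 0.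
  by rewrite Rint_sum// big1// => j _; exact: (Rint_atom P d U iidU unifU).
have [|mN N0] := null_of_Rint P _ hS _ S0; first by move=> x; exact: sumr_ge0.
rewrite (copulaE P d U iidU); apply: (Rint_off_null P _ _ _ mN N0) => x /= /negP; rewrite -ltNge => h.
congr (nat_of_bool _)%:R; apply: vlt_vle => j; apply: contraTneq h => E.
by rewrite -leNgt (bigD1 j)//= E eqxx lerDl; exact: sumr_ge0.
Qed.

Lemma zb_cov s t : Rint P (fun x => zb P d U s (V 0%N x) * zb P d U t (V 0%N x)) = covB C s t.
Proof.
have hs r : bmf (fun x => (vle (V 0%N x) r)%:R : R) by exact: (bmf_vleV _ _ _ iidU).
rewrite (_ : (fun x => _) = fun x => (vle (V 0%N x) (minv s t))%:R - C t * (vle (V 0%N x) s)%:R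
   - C s * (vle (V 0%N x) t)%:R + C s * C t); last first.
  apply/funext => x; rewrite /zb (_ : vle _ (minv s t) = vle (V 0%N x) s && vle (V 0%N x) t).
    by case: (vle _ s); case: (vle _ t) => /=; ring.
  apply/vleP/andP => [h|[/vleP h1 /vleP h2] j]; last by rewrite /minv le_min h1 h2.
  by split; apply/vleP => j; have := h j; rewrite /minv le_min => /andP[].
have h1 := hs (minv s t); have h2 := bmfZ (C t) _ (hs s); have h3 := bmfZ (C s) _ (hs t).
rewrite (RintD P _ _ (bmfB _ _ (bmfB _ _ h1 h2) h3) (bmf_cst _)) (RintB P _ _ (bmfB _ _ h1 h2) h3).
rewrite (RintB P _ _ h1 h2) Rint1 !RintZ// -!(copulaE P d U iidU) /covB; ring.
Qed.

Lemma copula_on_axis j u : cube d u -> C (on_axis j u) = u j.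
Proof.
move=> cu; rewrite (copulaE P d U iidU) -[RHS](marginalE P d U iidU unifU j _ (cu j)).
apply: (Rint_nul_eq 1) => x /nul_lt1[_ _ h1]; congr (nat_of_bool _)%:R.
apply/vleP/idP => [/(_ j)|h k]; first by rewrite /on_axis eqxx.
by rewrite /on_axis; case: eqP => [->//|_]; exact: h1.
Qed.

(** The marginal summand is the field at an axis point, provided that all coordinates of the
    observation are at most 1. *)
Lemma za_zb u j x : cube d u -> nul d U 1 x < 1 ->
  za d j (u j) (V 0%N x) = zb P d U (on_axis j u) (V 0%N x).
Proof.
move=> cu /nul_lt1[_ _ h1]; rewrite /za /zb copula_on_axis//; congr ((nat_of_bool _)%:R - _).
apply/idP/vleP => [h k|/(_ j)]; last by rewrite /on_axis eqxx.
by rewrite /on_axis; case: eqP => [->//|_]; exact: h1.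
Qed.

Lemma zw_cov u v : cube d u -> cube d v ->
  Rint P (fun x => zww u (V 0%N x) * zww v (V 0%N x)) = covG C dC u v.
Proof.
move=> cu cv.
pose b s x := zb P d U s (V 0%N x).
have hbb s t : bmf (fun x => b s x * b t x) by apply: bmfM; apply: (bmfV P d U iidU); exact: bmf_zb.
transitivity (Rint P (fun x => b u x * b v x - \sum_k dC k v * (b u x * b (on_axis k v) x)
   - \sum_j dC j u * (b (on_axis j u) x * b v x)
   + \sum_j \sum_k dC j u * dC k v * (b (on_axis j u) x * b (on_axis k v) x))).
  apply: (Rint_nul_eq 1) => x nx; rewrite /zw.
  under eq_bigr do rewrite za_zb//.
  under [X in _ * (_ - X)]eq_bigr do rewrite za_zb//.
  rewrite -/(b u x) -/(b v x); set X := (X in (_ - X) * _); set Y := (X in _ * (_ - X)).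
  rewrite (_ : (b u x - X) * (b v x - Y) = b u x * b v x - b u x * Y - X * b v x + X * Y); last by ring.
  rewrite /X /Y mulr_sumr mulr_suml big_distrlr /=; congr (_ - _ - _ + _).
  - by apply: eq_bigr => k _; rewrite mulrCA.
  - by apply: eq_bigr => k _; rewrite mulrA.
  - by apply: eq_bigr => j _; apply: eq_bigr => k _; rewrite mulrACA.
have h1 s t c : bmf (fun x => c * (b s x * b t x)) by exact: bmfZ.
have h2 := bmf_sum (index_enum 'I_d) xpredT (fun k x => dC k v * (b u x * b (on_axis k v) x)) (fun k _ => h1 _ _ _).
have h3 := bmf_sum (index_enum 'I_d) xpredT (fun j x => dC j u * (b (on_axis j u) x * b v x)) (fun k _ => h1 _ _ _).
have h4 j := bmf_sum (index_enum 'I_d) xpredT (fun k x => dC j u * dC k v * (b (on_axis j u) x * b (on_axis k v) x)) (fun k _ => h1 _ _ _).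
have h5 := bmf_sum (index_enum 'I_d) xpredT _ (fun k _ => h4 k).
rewrite (RintD P _ _ (bmfB _ _ (bmfB _ _ (hbb u v) h2) h3) h5) (RintB P _ _ (bmfB _ _ (hbb u v) h2) h3).
rewrite (RintB P _ _ (hbb u v) h2) !Rint_sum// zb_cov /covG; congr (_ - _ - _ + _).
- by apply: eq_bigr => k _; rewrite RintZ// zb_cov.
- by apply: eq_bigr => k _; rewrite RintZ// zb_cov.
- by apply: eq_bigr => j _; rewrite Rint_sum//; apply: eq_bigr => k _; rewrite RintZ// zb_cov.
Qed.

(* A coordinate of the LHSD point i equals 1 only if the rank of U_i is n in that coordinate. *)
Lemma LHSD_ones n x : nul d U n x < 1 ->
  \sum_(i < n) \sum_j (LHSD U eta n i x j == 1)%:R <= d%:R :> R.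
Proof.
move=> /nul_lt1[noties _ _]; rewrite exchange_big /= -[d in leRHS]card_ord -sumr_const.
apply: ler_sum => j _.
have full (i : 'I_n) : LHSD U eta n i x j = 1 -> forall k : 'I_n, U k j x <= U i j x.
  move=> E k; have n0 : (0 < n)%N := leq_ltn_trans (leq0n i) (ltn_ord i).
  have := LHSD_hi d U eta eta01 n i j x (ltn_ord i).
  rewrite E ler_pdivlMr ?ltr0n// mul1r ler_nat -[X in (X <= _)%N](size_iota 0 n) => h.
  have /allP : all (fun k => U k j x <= U i j x) (iota 0 n).
    by rewrite all_count eqn_leq count_size h.
  by apply; rewrite mem_iota /= add0n.
have [/existsP[i /eqP hi]|/existsPn h] := boolP [exists i : 'I_n, LHSD U eta n i x j == 1].
  rewrite (bigD1 i)//= hi eqxx big1 ?addr0// => k ki.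
  case: eqP => // hk; case/eqP: ki; apply: val_inj.
  by apply: (noties j _ _ (ltn_ord k) (ltn_ord i)); apply/eqP; rewrite eq_le (full i hi k) (full k hk i).
by rewrite big1// => i _; rewrite (negbTE (h i)).
Qed.

Variable f : ('I_d -> R) -> R.
Hypothesis bf : bmf (fun u : Rd => f (clamp u)).
Variables m1 m2 : {finite_measure set Rd -> \bar R}.
Hypothesis m1_cube : m1 (~` cube d) = 0%E.
Hypothesis m2_cube : m2 (~` cube d) = 0%E.
Hypothesis mf : forall x, cube d x -> sint m1 m2 (fun u => (vle u x)%:R) = fhat f x.
Local Notation J := (sint m1 m2).
Local Notation sg := ((-1) ^+ d : R).

(** Agrees with [fhat f] on the cube, but as an integral of indicators: its sum over the sample
    brings the counts [L_n(u)] under the integral sign. In [zstat] the linearized summands take the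
    place of the indicators. *)
Definition Phi (x : Rd) : R := sg * J (fun u => (vlt x (clamp u))%:R).
Definition zstat (y : Rd) : R := sg * J (fun u => zww (clamp u) y).

Lemma bmf_Phi_pair : bmf (fun p : Rd * Rd => (vlt p.1 (clamp p.2))%:R : R).
Proof.
have m2' := measurableT_comp (@measurable_clamp R d) (@measurable_snd _ _ Rd Rd).
by exact: (bmf_vlt (fst : Rd * Rd -> Rd) (fun p => clamp p.2)).
Qed.

Lemma bmf_zstat : bmf zstat.
Proof.
apply: bmfZ; apply: (bmf_sint m1 m2 ((fun=> 0) : Rd) (fun p : Rd * Rd => zww (clamp p.2) p.1)).
apply: (bmf_comp (fun p : Rd * Rd => (p.2, p.1)) _ _ (bmf_zw2 P d U iidU unifU dC dCP dC_cont)).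
by apply: measurable_fun_pair; [exact: measurable_snd|exact: measurable_fst].
Qed.

Lemma sgsg : sg * sg = 1.
Proof. by rewrite -exprD addnn -muln2 mulnC exprM sqrrN expr1n expr1n. Qed.

Lemma Phi_fhat x : cube d x -> Phi x = fhat f x.
Proof.
move=> cx; rewrite /Phi (sint_clamp m1 m2 m1_cube m2_cube (fun u => (vlt x u)%:R)).
by rewrite (fhat_upper m1 m2 m1_cube m2_cube f mf)// mulrA sgsg mul1r.
Qed.

Lemma Phi_dist M x : (forall u, `|f (clamp u)| <= M) -> cube d x ->
  `|f x - Phi x| <= M * \sum_j (x j == 1)%:R.
Proof.
move=> hM cx; have fM := hM x; rewrite clamp_id// in fM.
have M0 : 0 <= M := le_trans (normr_ge0 _) fM.
rewrite Phi_fhat// /fhat; case: ifP => [/existsP[j xj]|_].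
  rewrite subr0; apply: (le_trans fM).
  by rewrite ler_peMr// (bigD1 j)//= xj lerDl; exact: sumr_ge0.
by rewrite subrr normr0 mulr_ge0//; exact: sumr_ge0.
Qed.

(** Almost surely no coordinate of the observation equals 1, so [f] may be replaced by [fhat f],
    hence by [Phi]; Fubini then produces the probabilities [C u]. *)
Lemma Rint_f : Rint P (fun y => f (V 0%N y)) = sg * J (fun u => C (clamp u)).
Proof.
have hpair : bmf (fun p : Rd * T => (vlt (V 0%N p.2) (clamp p.1))%:R : R).
  apply: (bmf_vlt (fun p : Rd * T => (V 0%N p.2 : Rd)) (fun p => clamp p.1)).
    by apply: (measurableT_comp (measurable_V P d U iidU 0)); exact: measurable_snd.
  by apply: (measurableT_comp (@measurable_clamp R d)); exact: measurable_fst.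
transitivity (Rint P (fun y => Phi (V 0%N y))); last first.
  rewrite /Phi RintZ; last exact: (bmf_comp (V 0%N) _ (measurable_V P d U iidU 0) (bmf_sint m1 m2 ((fun=> 0) : Rd) _ bmf_Phi_pair)).
  congr (_ * _); rewrite (sint_fubini m1 m2 P (fun p : Rd * T => (vlt (V 0%N p.2) (clamp p.1))%:R))//.
  by congr (sint m1 m2); apply/funext => u /=; exact: Rint_vlt.
have ha j : bmf (fun y => (1 == U 0%N j y)%:R : R).
  apply: bmf_bool; rewrite (_ : (fun y => _) = fun y => (1 <= U 0%N j y) && (U 0%N j y <= 1)).
    by apply: measurable_and; apply: measurable_fun_ler => //; exact: measurable_U iidU _ _.
  by apply/funext => y; rewrite eq_le.
have hS : bmf (fun y => \sum_j (1 == U 0%N j y)%:R : R) by exact: bmf_sum.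
have S0 : Rint P (fun y => \sum_j (1 == U 0%N j y)%:R) = 0.
  by rewrite Rint_sum// big1// => j _; exact: (Rint_atom P d U iidU unifU).
have hN := bmf_nul P d U iidU 1.
have [| |mN N0] := null_of_Rint P _ (bmfD _ _ hS hN).
- by move=> x; rewrite addr_ge0 ?nul_ge0//; exact: sumr_ge0.
- by rewrite RintD// S0 Rint_nul// addr0.
apply: (Rint_off_null P _ _ _ mN N0) => x /= /negP; rewrite -ltNge => h.
have hS0 : 0 <= \sum_j (1 == U 0%N j x)%:R :> R by exact: sumr_ge0.
have nx : nul d U 1 x < 1 by move: h hS0; lra.
have sx : \sum_j (1 == U 0%N j x)%:R < 1 :> R by move: h (nul_ge0 d U 1 x); lra.
have [_ h0 h1] := nul_lt1 d U 1 x nx.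
rewrite Phi_fhat; last by move=> j; rewrite (ltW (h0 j 0%N _)) ?h1.
rewrite /fhat ifF//; apply/existsP => -[j /eqP E].
by move: sx; rewrite (bigD1 j)//= E eqxx ltNge lerDl sumr_ge0.
Qed.

Lemma LHSD_stat_bmf n : bmf (LHSD_stat P U eta f n).
Proof.
apply: (bmf_ext (fun x => (q n)^-1 * \sum_(i < n) (f (clamp (LHSD U eta n i x)) - Rint P (fun y => f (V 0%N y))))).
  apply: bmfZ; apply: bmf_sum => i _; apply: bmfB; last exact: bmf_cst.
  by apply: (bmf_comp (LHSD U eta n i : T -> Rd) _ _ bf); exact: (measurable_LHSD P d U iidU eta meta).
move=> x; congr (_ * _); apply: eq_bigr => i _.
by rewrite clamp_id//; exact: LHSD_cube.
Qed.

(** [f] and [Phi] differ only at points with a coordinate equal to 1, whose total contribution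
    [LHSD_ones] bounds by [M d]. With [Phi] in place of [f], the difference is exactly the integral
    of [lin_err], up to the sign. *)
Lemma LHSD_stat_dist M n x : (0 < n)%N -> (forall u, `|f (clamp u)| <= M) -> nul d U n x < 1 ->
  `|LHSD_stat P U eta f n x - (q n)^-1 * \sum_(i < n) zstat (V i x)| <=
  (q n)^-1 * (M * d%:R) + `|J (fun u => lerr n (clamp u) x)|.
Proof.
move=> n0 hM nx; have q0 : 0 < q n := q_gt0 n n0.
have M0 : 0 <= M := le_trans (normr_ge0 _) (hM (fun=> 0)).
have hv i : bmf (fun u : Rd => (vlt (LHSD U eta n i x) (clamp u))%:R : R).
  by have := bmf_pairr _ (LHSD U eta n i x : Rd) bmf_Phi_pair.
have hz i : bmf (fun u : Rd => zww (clamp u) (V i x)).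
  by have := bmf_pairl _ (V i x) (bmf_zw2 P d U iidU unifU dC dCP dC_cont).
have hc : bmf (fun u : Rd => C (clamp u)).
  by apply: (bmf_comp (clamp : Rd -> Rd) (C : Rd -> R)); [exact: measurable_clamp|exact: bmf_copula].
have e1 : (q n)^-1 * \sum_(i < n) (Phi (LHSD U eta n i x) - Rint P (fun y => f (V 0%N y))) -
   (q n)^-1 * \sum_(i < n) zstat (V i x) = sg * J (fun u => lerr n (clamp u) x).
  rewrite Rint_f -mulrBr sumrB sumr_const card_ord.
  have hS := bmf_sum (index_enum 'I_n) xpredT _ (fun i _ => hv (nat_of_ord i)).
  have hT := bmf_sum (index_enum 'I_n) xpredT _ (fun i _ => hz (nat_of_ord i)).
  rewrite /Phi /zstat -!mulr_sumr -(sint_sum m1 m2)// -(sint_sum m1 m2)//.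
  have -> : (fun u => lerr n (clamp u) x) = fun u : Rd => (q n)^-1 * (\sum_(i < n) (vlt (LHSD U eta n i x) (clamp u))%:R)
      + (- (n%:R / q n) * C (clamp u) + - (q n)^-1 * (\sum_(i < n) zww (clamp u) (V i x))).
    apply/funext => u; rewrite /lin_err /normsum /lhs_count /cntl.
    set a := \sum_(i < n) _; set b := \sum_(i < n) _; set c := C _; set Q := Num.sqrt _.
    rewrite (_ : n%:R = Q ^+ 2); last exact: qq.
    by field; rewrite gt_eqF.
  rewrite (sintD m1 m2 _ _ (bmfZ _ _ hS) (bmfD _ _ (bmfZ _ _ hc) (bmfZ _ _ hT))).
  rewrite (sintD m1 m2 _ _ (bmfZ _ _ hc) (bmfZ _ _ hT)) !sintZ//.
  by rewrite -[_ *+ n]mulr_natr; ring.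
have -> : LHSD_stat P U eta f n x - (q n)^-1 * \sum_(i < n) zstat (V i x) =
  (q n)^-1 * \sum_(i < n) (f (LHSD U eta n i x) - Phi (LHSD U eta n i x)) + sg * J (fun u => lerr n (clamp u) x).
  by rewrite -e1 /LHSD_stat addrA -mulrDr -big_split /=; congr (_ * _ - _); apply: eq_bigr => i _; rewrite addrA subrK.
apply: (le_trans (ler_normD _ _)); apply: lerD.
  rewrite normrM normfV (gtr0_norm q0); apply: ler_wpM2l; first by rewrite invr_ge0 ltW.
  apply: (le_trans (ler_norm_sum _ _ _)).
  apply: (@le_trans _ _ (M * \sum_(i < n) \sum_j (LHSD U eta n i x j == 1)%:R)).
    by rewrite mulr_sumr; apply: ler_sum => i _; apply: Phi_dist => //; exact: LHSD_cube.
  by apply: ler_wpM2l => //; exact: LHSD_ones.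
by rewrite normrM normrX normrN1 expr1n mul1r.
Qed.

Lemma LHSD_stat_cvg : (fun n => Rint P (fun x => `|LHSD_stat P U eta f n x - (q n)^-1 * \sum_(i < n) zstat (V i x)|)) @ \oo --> (0 : R).
Proof.
have [M M0 hM] := bmf_bound _ bf.
have hl n := bmf_lin_err2 P d U iidU unifU eta meta dC dCP dC_cont n.
have hln n : bmf (fun p : Rd * T => `|lerr n (clamp p.1) p.2|) by exact: bmf_norm.
have hln' n : bmf (fun p : T * Rd => lerr n (clamp p.2) p.1).
  apply: (bmf_comp (fun p : T * Rd => (p.2, p.1)) _ _ (hl n)).
  by apply: measurable_fun_pair; [exact: measurable_snd|exact: measurable_fst].
have hJ n : bmf (fun x => J (fun u => lerr n (clamp u) x)).
  by apply: (bmf_sint m1 m2 point _ (hln' n)).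
have hR n : bmf (fun u : Rd => Rint P (fun x => `|lerr n (clamp u) x|)).
  exact: (bmf_Rint m1 P _ (hln n)).
have bound n : (0 < n)%N -> Rint P (fun x => `|LHSD_stat P U eta f n x - (q n)^-1 * \sum_(i < n) zstat (V i x)|) <=
    (M * d%:R) / q n + (Rint m1 (fun u => Rint P (fun x => `|lerr n (clamp u) x|)) +
                        Rint m2 (fun u => Rint P (fun x => `|lerr n (clamp u) x|))).
  move=> n0; have q0 : 0 < q n := q_gt0 n n0.
  have hX : bmf (fun x => `|LHSD_stat P U eta f n x - (q n)^-1 * \sum_(i < n) zstat (V i x)|).
    apply: bmf_norm; apply: bmfB; first exact: LHSD_stat_bmf.
    by apply: bmfZ; apply: bmf_sum => i _; apply: (bmfV P d U iidU); exact: bmf_zstat.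
  apply: (le_trans (Rint_nul_le n _ (fun x => (q n)^-1 * (M * d%:R) + `|J (fun u => lerr n (clamp u) x)|) hX _ _ _)).
  - by apply: bmfD; [exact: bmf_cst|exact: bmf_norm].
  - by move=> x; rewrite addr_ge0// mulr_ge0 ?invr_ge0 ?mulr_ge0// ltW.
  - by move=> x nx; exact: LHSD_stat_dist.
  rewrite RintD; [|exact: bmf_cst|exact: bmf_norm].
  rewrite Rint1 [X in X + _]mulrC lerD2l.
  have hm1 : bmf (fun x => Rint m1 (fun u => `|lerr n (clamp u) x|)).
    by apply: (bmf_Rint P m1 (fun p : T * Rd => `|lerr n (clamp p.2) p.1|)); exact: bmf_norm.
  have hm2 : bmf (fun x => Rint m2 (fun u => `|lerr n (clamp u) x|)).
    by apply: (bmf_Rint P m2 (fun p : T * Rd => `|lerr n (clamp p.2) p.1|)); exact: bmf_norm.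
  apply: (@le_trans _ _ (Rint P (fun x => Rint m1 (fun u => `|lerr n (clamp u) x|) + Rint m2 (fun u => `|lerr n (clamp u) x|)))).
    apply: Rint_le; [exact: bmf_norm|exact: bmfD|].
    by move=> x; apply: sint_norm; have := bmf_pairl _ x (hl n).
  by rewrite RintD// -(Rint_fubini m1 P _ (hln n)) -(Rint_fubini m2 P _ (hln n)).
(* Bounded convergence in [u]: [lin_err_cvg] gives the pointwise limit, the second-moment estimate
   the domination. *)
have lim (m : {finite_measure set Rd -> \bar R}) :
    (fun n => Rint m (fun u => Rint P (fun x => `|lerr n (clamp u) x|))) @ \oo --> (0 : R).
  rewrite -[0](_ : Rint m (fun=> 0) = 0); last first.
    by rewrite /Rintegral integral0.
  apply: (Rint_cvg m _ _ (1 + 26 * d%:R ^+ 2)).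
  - by move=> n; have [] := hR n.
  - move=> n u; rewrite ger0_norm; last by apply: Rint_ge0.
    exact: (Rint_lin_err_bounded P d U iidU unifU eta meta eta01 dC dCP dC_cont n _ (cube_clamp u)).
  - move=> u; exact: (lin_err_cvg P d U iidU unifU eta meta eta01 dC dCP dC_cont _ (cube_clamp u)).
apply/cvgrPdist_le => e e0.
have e4 : 0 < e / 4 by rewrite divr_gt0.
have /cvgrPdist_le/(_ _ e4) l1 := lim m1.
have /cvgrPdist_le/(_ _ e4) l2 := lim m2.
near=> n.
rewrite sub0r normrN ger0_norm; last by apply: Rint_ge0.
apply: (le_trans (bound n _)); first by near: n; exact: nbhs_infty_gt.
have h1 : `|0 - Rint m1 (fun u => Rint P (fun x => `|lerr n (clamp u) x|))| <= e / 4 by near: n.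
have h2 : `|0 - Rint m2 (fun u => Rint P (fun x => `|lerr n (clamp u) x|))| <= e / 4 by near: n.
have h3 : M * d%:R / q n <= e / 4 by near: n; exact: cvg_div_sqrt_nat.
by move: h1 h2 h3; rewrite !sub0r !normrN !ler_norml; lra.
Unshelve. all: by end_near. Qed.

Lemma Rint_zstat : Rint P (fun x => zstat (V 0%N x)) = 0.
Proof.
have hz : bmf (fun p : Rd * T => zww (clamp p.1) (V 0%N p.2)).
  apply: (bmf_comp (fun p : Rd * T => (p.1, V 0%N p.2) : Rd * Rd) _ _ (bmf_zw2 P d U iidU unifU dC dCP dC_cont)).
  apply: measurable_fun_pair; first exact: measurable_fst.
  by apply: (measurableT_comp (measurable_V P d U iidU 0)); exact: measurable_snd.
have hz' : bmf (fun p : T * Rd => zww (clamp p.2) (V 0%N p.1)).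
  apply: (bmf_comp (fun p : T * Rd => (p.2, p.1)) _ _ hz).
  by apply: measurable_fun_pair; [exact: measurable_snd|exact: measurable_fst].
rewrite /zstat RintZ; last exact: (bmf_sint m1 m2 point _ hz').
rewrite (sint_fubini m1 m2 P (fun p : Rd * T => zww (clamp p.1) (V 0%N p.2)))//=.
rewrite (_ : (fun u => _) = fun=> 0); first by rewrite /sint /Rintegral !integral0 subrr mulr0.
by apply/funext => u; exact: (Rint_zw P d U iidU unifU dC _ (cube_clamp u)).
Qed.

Lemma bmf_covG : bmf (fun p : Rd * Rd => covG C dC (clamp p.1) (clamp p.2)).
Proof.
apply: (bmf_ext (fun p : Rd * Rd => Rint P (fun x => zww (clamp p.1) (V 0%N x) * zww (clamp p.2) (V 0%N x)))).
  apply: (bmf_Rint (dirac ((fun=> 0, fun=> 0) : Rd * Rd)) P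
    (fun p : (Rd * Rd) * T => zww (clamp p.1.1) (V 0%N p.2) * zww (clamp p.1.2) (V 0%N p.2))).
  have mV : measurable_fun setT (fun p : (Rd * Rd) * T => (V 0%N p.2 : Rd)).
    by apply: (measurableT_comp (measurable_V P d U iidU 0)); exact: measurable_snd.
  have mf1 := @measurable_fst _ _ (Rd * Rd)%type T.
  apply: bmfM.
    apply: (bmf_comp (fun p : (Rd * Rd) * T => (p.1.1, V 0%N p.2) : Rd * Rd) _ _ (bmf_zw2 P d U iidU unifU dC dCP dC_cont)).
    by apply: measurable_fun_pair => //; apply: (measurableT_comp (@measurable_fst _ _ Rd Rd) mf1).
  apply: (bmf_comp (fun p : (Rd * Rd) * T => (p.1.2, V 0%N p.2) : Rd * Rd) _ _ (bmf_zw2 P d U iidU unifU dC dCP dC_cont)).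
  by apply: measurable_fun_pair => //; apply: (measurableT_comp (@measurable_snd _ _ Rd Rd) mf1).
by move=> p; apply: zw_cov; exact: cube_clamp.
Qed.

(** Two applications of Fubini turn the square of an integral into a double integral of covariances;
    the sign [(-1)^d] is squared. *)
Lemma Rint_zstat2 : Rint P (fun x => zstat (V 0%N x) ^+ 2) = dint_signed m1 m2 (covG C dC).
Proof.
rewrite dint_signedE//; last exact: bmf_covG.
have mV : measurable_fun setT (fun p : Rd * T => (V 0%N p.2 : Rd)).
  by apply: (measurableT_comp (measurable_V P d U iidU 0)); exact: measurable_snd.
have hw := bmf_zw2 P d U iidU unifU dC dCP dC_cont.
have hz : bmf (fun p : Rd * T => zww (clamp p.1) (V 0%N p.2)).
  apply: (bmf_comp (fun p : Rd * T => (p.1, V 0%N p.2) : Rd * Rd) _ _ hw).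
  by apply: measurable_fun_pair => //; exact: measurable_fst.
have hx x : bmf (fun u : Rd => zww (clamp u) (V 0%N x)) by have := bmf_pairl _ (V 0%N x) hw.
have hJ : bmf (fun x => J (fun u => zww (clamp u) (V 0%N x))).
  apply: (bmf_sint m1 m2 point (fun p : T * Rd => zww (clamp p.2) (V 0%N p.1))).
  apply: (bmf_comp (fun p : T * Rd => (p.2, p.1)) _ _ hz).
  by apply: measurable_fun_pair; [exact: measurable_snd|exact: measurable_fst].
rewrite (_ : (fun x => _) = fun x => J (fun u => zww (clamp u) (V 0%N x) * J (fun v => zww (clamp v) (V 0%N x)))); last first.
  apply/funext => x; rewrite /zstat exprMn [X in X * _]expr2 sgsg mul1r expr2 -(sintZ m1 m2)//.
  by congr sint; apply/funext => u; rewrite mulrC.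
rewrite (sint_fubini m1 m2 P (fun p : Rd * T => zww (clamp p.1) (V 0%N p.2) * J (fun v => zww (clamp v) (V 0%N p.2)))); last first.
  by apply: bmfM => //; apply: (bmf_comp snd _ _ hJ); exact: measurable_snd.
congr sint; apply/funext => u /=.
have hu : bmf (fun x => zww (clamp u) (V 0%N x)) by have := bmf_pairr _ u hz.
have huv : bmf (fun p : Rd * T => zww (clamp u) (V 0%N p.2) * zww (clamp p.1) (V 0%N p.2)).
  by apply: bmfM => //; apply: (bmf_comp snd _ _ hu); exact: measurable_snd.
rewrite (_ : (fun x => _) = fun x => J (fun v => zww (clamp u) (V 0%N x) * zww (clamp v) (V 0%N x))); last first.
  by apply/funext => x; rewrite sintZ.
rewrite (sint_fubini m1 m2 P (fun p : Rd * T => zww (clamp u) (V 0%N p.2) * zww (clamp p.1) (V 0%N p.2)))//.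
congr sint; apply/funext => v /=.
by apply: zw_cov; exact: cube_clamp.
Qed.

Lemma LHSD_clt : conv_in_law_normal P (LHSD_stat P U eta f) (dint_signed m1 m2 (covG C dC)).
Proof.
rewrite -Rint_zstat2; apply: (clt_perturbed P V zstat (iidV P d U iidU) bmf_zstat Rint_zstat _ LHSD_stat_bmf).
exact: LHSD_stat_cvg.
Qed.

End representation.

(** * Existence of the induced measures *)

Section hardy_krause.
Context {R : realType} {d : nat}.
Variable f : ('I_d -> R) -> R.
Hypothesis HKf : (HK_var f < +oo)%E.

Lemma vitali_sum_ge0 S m p : 0 <= vitali_sum f S m p.
Proof. exact: sumr_ge0. Qed.

Lemma vitali_sum_le S m p : S != finset.set0 -> grid m p -> vitali_sum f S m p <= fine (HK_var f).
Proof.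
move=> S0 gp.
have le S' : ((vitali_sum f S' m p)%:E <= vitali_var f S')%E.
  by apply: ereal_sup_ubound; exists m, p.
have v0 S' : (0 <= vitali_var f S')%E.
  by apply: le_trans (le S'); rewrite lee_fin vitali_sum_ge0.
have h : ((vitali_sum f S m p)%:E <= HK_var f)%E.
  apply: (le_trans (le S)); rewrite /HK_var (bigD1 S)//=.
  by rewrite leeDl//; apply: sume_ge0.
rewrite -lee_fin fineK// ge0_fin_numE//.
by apply: le_trans h; rewrite lee_fin vitali_sum_ge0.
Qed.

(** Induction on the number of coordinates allowed to differ from 1. The increment of [f] between
    [u] and the corner 1 of a face is bounded by the variation, and all its terms other than the
    value at [u] lie on faces of smaller dimension. *)
Lemma HK_bounded : exists M, forall u, cube d u -> `|f u| <= M.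
Proof.
pose face (D : {set 'I_d}) (u : 'I_d -> R) : 'I_d -> R := fun j => if j \in D then u j else 1.
suff H k : exists B : R, forall (D : {set 'I_d}) (u : 'I_d -> R), (#|D| <= k)%N -> cube d u -> `|f (face D u)| <= B.
  have [B hB] := H d.
  exists B => u cu; have := hB finset.setT u; rewrite cardsT card_ord leqnn => /(_ isT cu).
  by rewrite (_ : face _ u = u)//; apply/funext => j; rewrite /face finset.in_setT.
elim: k => [|k [B hB]].
  exists `|f (fun=> 1)| => D u; rewrite leqn0 cards_eq0 => /eqP -> _.
  by rewrite (_ : face _ u = fun=> 1)//; apply/funext => j; rewrite /face finset.in_set0.
pose W := fine (HK_var f).
have B0 : 0 <= B.
  have c0 : cube d ((fun=> 0) : 'I_d -> R) by move=> j; rewrite lexx ler01.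
  by apply: le_trans (hB finset.set0 _ _ c0) => //; rewrite cards0.
exists (`|W| + \sum_(e : {set 'I_d}) B) => D u Dk cu.
have SB : B <= \sum_(e : {set 'I_d}) B.
  by rewrite (bigD1 finset.set0)//= lerDl; exact: sumr_ge0.
move: Dk; rewrite leq_eqVlt ltnS => /orP[/eqP Dk|Dk]; last first.
  by apply: (le_trans (hB _ _ Dk cu)); apply: (le_trans SB); rewrite lerDr.
have D0 : D != finset.set0 by rewrite -cards_eq0 Dk.
(* The grid is 0, [u j], 1; [l] selects its second interval in the directions of [D]. *)
pose p (j : 'I_d) (i : nat) : R := if i is i'.+1 then (if i' is _.+1 then 1 else u j) else 0.
have gp : grid 1 p by move=> j; split=> // -[|[|//]] _ /=; have /andP[] := cu j.
pose l : {ffun 'I_d -> 'I_2} := [ffun j => if j \in D then ord_max else ord0].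
have lD : [forall j, (j \notin D) ==> (l j == ord0)].
  by apply/forallP => j; apply/implyP => /negbTE jD; rewrite ffunE jD.
have hc : `|cell_delta f D p l| <= `|W|.
  apply: le_trans (ler_norm W); apply: le_trans (vitali_sum_le D 1 p D0 gp).
  by rewrite /vitali_sum (bigD1 l)//= lerDl; exact: sumr_ge0.
have fc (e : {set 'I_d}) : face_corner D p l e = face (D :\: e) u.
  apply/funext => j; rewrite /face_corner /face finset.in_setD ffunE.
  by case: (j \in D); rewrite ?andbF//=; case: (j \in e).
move: hc; rewrite /cell_delta (bigD1 finset.set0) ?finset.sub0set//= fc finset.setD0.
set r := \sum_(e | _) _ => hc.
have hr : `|r| <= \sum_(e : {set 'I_d}) B.
  apply: (le_trans (ler_norm_sum _ _ _)); rewrite [leRHS](bigID (fun e : {set 'I_d} => (e \subset D) && (e != finset.set0)))/=.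
  apply: ler_wpDr; first exact: sumr_ge0.
  apply: ler_sum => e /andP[eD e0]; rewrite normrM normrX normrN1 expr1n mul1r fc.
  apply: hB => //; rewrite -ltnS -Dk; apply: proper_card.
  rewrite properE finset.subsetDl /=; have [x xe] := finset.set0Pn _ e0.
  by apply/fintype.subsetPn; exists x; [exact: (fintype.subsetP eD)|rewrite !inE xe].
have -> : f (face D u) = (-1) ^+ #|D| * (((-1) ^+ #|D| * f (face D u) + r) - r).
  by rewrite addrK mulrA -exprD addnn -mul2n exprM sqrrN expr1n expr1n mul1r.
rewrite normrM normrX normrN1 expr1n mul1r.
by apply: (le_trans (ler_normB _ _)); exact: lerD.
Qed.

Variable m : nat.
Local Notation H := m.+1.

(** Tensor product of one functional per coordinate, each a combination of two evaluations on the
    grid of mesh [1 / H], applied to [f]. Face differences and increments of the extension of [f]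
    both have this form, which reduces their comparison to dimension one. *)
Definition tens (c : 'I_d -> bool -> R) (k : 'I_d -> bool -> nat) : R :=
  \sum_(e : {set 'I_d}) (\prod_j c j (j \in e)) * f (fun j => (k j (j \in e))%:R / H%:R).

Definition gridval (i : {ffun 'I_d -> 'I_H.+1}) : R := f (fun j => (i j)%:R / H%:R).

Lemma delta_sum (k : 'I_d -> nat) : (forall j, (k j <= H)%N) ->
  \sum_(i : {ffun 'I_d -> 'I_H.+1}) (\prod_j (k j == i j)%:R) * gridval i = f (fun j => (k j)%:R / H%:R).
Proof.
move=> kH; pose i0 : {ffun 'I_d -> 'I_H.+1} := [ffun j => inord (k j)].
have i0E j : i0 j = k j :> nat by rewrite ffunE inordK// ltnS.
rewrite (bigD1 i0)//= big1 ?mul1r ?big1 ?addr0.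
- by rewrite /gridval; congr f; apply/funext => j; rewrite i0E.
- move=> i ii0; have [j ji] : exists j, k j != i j.
    apply/existsP; rewrite -negb_forall; apply: contra ii0 => /forallP h; apply/eqP/ffunP => j.
    by apply/val_inj; rewrite /= i0E; apply/esym/eqP.
  by rewrite (bigD1 j)//= (negbTE ji) !mul0r.
- by move=> j _; rewrite i0E eqxx.
Qed.

Lemma tensE (c : 'I_d -> bool -> R) (k : 'I_d -> bool -> nat) : (forall j b, (k j b <= H)%N) ->
  tens c k = \sum_(i : {ffun 'I_d -> 'I_H.+1}) (\prod_j \sum_b c j b * (k j b == i j)%:R) * gridval i.
Proof.
move=> kH; rewrite /tens.
under [RHS]eq_bigr => i _.
  under eq_bigr do rewrite big_bool.
  rewrite bigA_distr mulr_suml.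
  under eq_bigr => e _.
    rewrite (eq_bigr (fun j => c j (j \in e) * (k j (j \in e) == i j)%:R)); last by move=> j _; case: (j \in e).
    rewrite big_split -mulrA /=.
    over.
  over.
rewrite exchange_big /=; apply: eq_bigr => e _.
by rewrite -mulr_sumr delta_sum.
Qed.

(** Multilinearity: a one-dimensional identity expressing the functionals A through the functionals
    B, with coefficients [t], is multiplied out over the coordinates. *)
Lemma tens_change (L K : finType) (cA : L -> bool -> R) (kA : L -> bool -> nat)
  (cB : K -> bool -> R) (kB : K -> bool -> nat) (t : L -> K -> R) :
  (forall l b, (kA l b <= H)%N) -> (forall k b, (kB k b <= H)%N) ->
  (forall l (i : 'I_H.+1), \sum_b cA l b * (kA l b == i)%:R =
     \sum_k t l k * \sum_b cB k b * (kB k b == i)%:R) ->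
  forall l : {ffun 'I_d -> L}, tens (fun j => cA (l j)) (fun j => kA (l j)) =
    \sum_(k : {ffun 'I_d -> K}) (\prod_j t (l j) (k j)) * tens (fun j => cB (k j)) (fun j => kB (k j)).
Proof.
move=> hA hB ht l; rewrite tensE//.
under [RHS]eq_bigr do rewrite tensE// mulr_sumr.
rewrite exchange_big /=; apply: eq_bigr => i _.
under [RHS]eq_bigr do rewrite mulrA -big_split /=.
rewrite -mulr_suml -(@bigA_distr_bigA _ 0 1 *%R +%R _ _ (fun j k => t (l j) k * \sum_b cB k b * (kB k b == i j)%:R)) /=.
by congr (_ * _); apply: eq_bigr => j _; exact: ht.
Qed.

(** Once the sums are exchanged, the weight of [k] is a product over the coordinates of column sums
    of [|t|], each at most 2. *)
Lemma tens_change_le (L K : finType) (cA : L -> bool -> R) (kA : L -> bool -> nat)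
  (cB : K -> bool -> R) (kB : K -> bool -> nat) (t : L -> K -> R) :
  (forall l b, (kA l b <= H)%N) -> (forall k b, (kB k b <= H)%N) ->
  (forall l (i : 'I_H.+1), \sum_b cA l b * (kA l b == i)%:R =
     \sum_k t l k * \sum_b cB k b * (kB k b == i)%:R) ->
  (forall k, \sum_l `|t l k| <= 2) ->
  \sum_(l : {ffun 'I_d -> L}) `|tens (fun j => cA (l j)) (fun j => kA (l j))| <=
    2 ^+ d * \sum_(k : {ffun 'I_d -> K}) `|tens (fun j => cB (k j)) (fun j => kB (k j))|.
Proof.
move=> hA hB ht t2.
apply: (@le_trans _ _ (\sum_(l : {ffun 'I_d -> L}) \sum_(k : {ffun 'I_d -> K})
   (\prod_j `|t (l j) (k j)|) * `|tens (fun j => cB (k j)) (fun j => kB (k j))|)).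
  apply: ler_sum => l _; rewrite (tens_change _ _ _ _ _ _ t hA hB ht).
  apply: (le_trans (ler_norm_sum _ _ _)); apply: ler_sum => k _.
  by rewrite normrM normr_prod.
rewrite exchange_big /= mulr_sumr; apply: ler_sum => k _.
rewrite -mulr_suml; apply: ler_wpM2r => //.
rewrite -(@bigA_distr_bigA _ 0 1 *%R +%R _ _ (fun j l => `|t l (k j)|)) /=.
rewrite -[d in leRHS]card_ord -prodr_const; apply: ler_prod => j _.
by rewrite t2 andbT; exact: sumr_ge0.
Qed.

Definition ugrid (j : 'I_d) (i : nat) : R := i%:R / H%:R.

Lemma grid_ugrid : grid m ugrid.
Proof.
move=> j; split=> [| |k _]; rewrite /ugrid ?mul0r ?divff//.
by rewrite ler_pM2r ?invr_gt0// ler_nat.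
Qed.

(* One coordinate of a face difference: [Some k] is a difference over the k-th cell of
   [0,1], [None] is the evaluation at 1. *)
Definition fcoef (k : option 'I_H) (b : bool) : R :=
  if k is Some _ then (if b then 1 else -1) else (if b then 0 else 1).
Definition fpos (k : option 'I_H) (b : bool) : nat := if k is Some i then (i + b)%N else H.

Definition fsupp (k : {ffun 'I_d -> option 'I_H}) : {set 'I_d} := [set j | k j != None]%SET.
Definition fcell (k : {ffun 'I_d -> option 'I_H}) : {ffun 'I_d -> 'I_H} := [ffun j => odflt ord0 (k j)].

Lemma tens_cell_delta (k : {ffun 'I_d -> option 'I_H}) :
  tens (fun j => fcoef (k j)) (fun j => fpos (k j)) = cell_delta f (fsupp k) ugrid (fcell k).
Proof.
rewrite /cell_delta big_mkcond /=; apply: eq_bigr => e _.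
case: ifPn => [/fintype.subsetP eS|/fintype.subsetPn[j je]]; last first.
  rewrite inE negbK => /eqP jk.
  by rewrite (bigD1 j)//= jk /fcoef je !mul0r.
congr (_ * f _).
  rewrite -prodr_const [RHS]big_mkcond /=; apply: eq_bigr => j _; rewrite !inE /fcoef.
  case E : (k j) => [i|] /=; first by rewrite andbT; case: (j \in e).
  case je : (j \in e) => //.
  by have := eS j je; rewrite inE E.
apply/funext => j; rewrite /face_corner inE /ugrid ffunE /fpos.
by case: (k j) => [i|] //=; rewrite divff.
Qed.

(** A function [k] amounts to a face, given by the coordinates where it is [Some], together with a
    cell of that face. *)
Lemma sum_faces : \sum_(k : {ffun 'I_d -> option 'I_H}) `|tens (fun j => fcoef (k j)) (fun j => fpos (k j))| =
  \sum_(S : {set 'I_d}) vitali_sum f S m ugrid.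
Proof.
rewrite (partition_big fsupp xpredT)//=; apply: eq_bigr => S _; rewrite /vitali_sum.
pose h (l : {ffun 'I_d -> 'I_H}) : {ffun 'I_d -> option 'I_H} := [ffun j => if j \in S then Some (l j) else None].
rewrite (reindex_onto h fcell) /=; last first.
  move=> k /eqP kS; apply/ffunP => j; rewrite !ffunE -kS inE.
  by case: (k j).
have hS l : fsupp (h l) = S.
  by apply/finset.setP => j; rewrite inE ffunE; case: (j \in S).
apply: eq_big => l.
  rewrite hS eqxx /=; apply/eqP/forallP => [E j|h0].
    by apply/implyP => /negbTE jS; rewrite -E !ffunE jS.
  apply/ffunP => j; rewrite !ffunE; case: ifPn => //= jS.
  by have /implyP/(_ jS)/eqP -> := h0 j.
by move=> /andP[_ /eqP E]; rewrite tens_cell_delta hS E.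
Qed.

(** The empty face contributes the value at the corner 1, which the variation does not see; every
    other face contributes at most the total variation. *)
Lemma sum_faces_le : \sum_(S : {set 'I_d}) vitali_sum f S m ugrid <=
  `|f (fun=> 1)| + \sum_(S : {set 'I_d}) fine (HK_var f).
Proof.
have W0 : 0 <= fine (HK_var f).
  by rewrite fine_ge0//; apply: sume_ge0 => S _; apply: (le_trans _ (ereal_sup_ubound _));
    [| exists m, ugrid; split; [exact: grid_ugrid|reflexivity]]; rewrite lee_fin vitali_sum_ge0.
rewrite [leLHS](bigD1 finset.set0)//= [X in _ <= _ + X](bigD1 finset.set0)//= addrA.
apply: lerD; last by apply: ler_sum => S S0; apply: vitali_sum_le => //; exact: grid_ugrid.
apply: ler_wpDr => //; rewrite /vitali_sum (bigD1 [ffun=> ord0])//=; last first.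
  by apply/forallP => j; rewrite ffunE eqxx implybT.
rewrite [X in _ + X]big1 ?addr0.
  rewrite /cell_delta (bigD1 finset.set0) ?finset.sub0set//= big1 ?addr0; last first.
    by move=> e /andP[]; rewrite finset.subset0 => ->.
  rewrite finset.setD0 cards0 expr0 mul1r le_eqVlt; apply/orP; left; apply/eqP; congr `|f _|.
  by apply/funext => j; rewrite /face_corner finset.in_set0.
move=> l /andP[/forallP h /negP[]]; apply/eqP/ffunP => j; rewrite ffunE.
by have := h j; rewrite finset.in_set0 => /eqP.
Qed.

End hardy_krause.

(** * Increments over boxes *)

Section box_increment.
Context {R : realType} {d : nat}.
Implicit Types (F : ('I_d -> R) -> R) (lo hi : 'I_d -> R).

Definition box_mu F lo hi : R :=
  \sum_(e : {set 'I_d}) (\prod_j (if j \in e then 1 else -1)) * F (fun j => if j \in e then hi j else lo j).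

(** Increment in all coordinates but the [j]-th, which is frozen at [t]; a cut along [j] then
    telescopes. *)
Definition slice F lo hi (j : 'I_d) (t : R) : R :=
  \sum_(e : {set 'I_d} | j \notin e) (\prod_(i | i != j) (if i \in e then 1 else -1)) *
    F (upd (fun i => if i \in e then hi i else lo i) j t).

Lemma box_mu_slice F lo hi j : box_mu F lo hi = slice F lo hi j (hi j) - slice F lo hi j (lo j).
Proof.
rewrite /box_mu (bigID (fun e : {set 'I_d} => j \in e))/=; congr (_ + _).
  rewrite (reindex_onto (fun e => j |: e)%SET (fun e => e :\ j)%SET) /=; last by move=> e; exact: finset.setD1K.
  apply: eq_big => e.
    rewrite finset.setU11 /=; apply/eqP/idP => [<-|je]; first by rewrite finset.setD11.
    exact: finset.setU1K.
  move=> /andP[_ /eqP E].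
  have je : j \notin e by rewrite -E finset.setD11.
  rewrite (bigD1 j)//= finset.setU11 mul1r; congr (_ * F _).
    by apply: eq_bigr => i ij; rewrite finset.in_setU1 (negbTE ij).
  apply/funext => i; rewrite /upd; case: eqP => [->|/eqP ij]; first by rewrite finset.setU11.
  by rewrite finset.in_setU1 (negbTE ij).
rewrite -sumrN; apply: eq_bigr => e je.
rewrite (bigD1 j)//= (negbTE je) mulN1r mulNr; congr (- (_ * F _)).
by apply/funext => i; rewrite /upd; case: eqP => [->|//]; rewrite (negbTE je).
Qed.

Lemma slice_upd F lo hi j a b t : slice F (upd lo j a) (upd hi j b) j t = slice F lo hi j t.
Proof.
apply: eq_bigr => e _; congr (_ * F _); apply/funext => i; rewrite /upd.
by case: eqP.
Qed.

Lemma box_mu_split F lo hi j c :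
  box_mu F lo hi = box_mu F lo (upd hi j c) + box_mu F (upd lo j c) hi.
Proof.
have s1 t : slice F lo (upd hi j c) j t = slice F lo hi j t by rewrite -{1}(upd_id lo j) slice_upd.
have s2 t : slice F (upd lo j c) hi j t = slice F lo hi j t by rewrite -{1}(upd_id hi j) slice_upd.
by rewrite !(box_mu_slice F _ _ j) !s1 !s2 /upd eqxx; ring.
Qed.

End box_increment.

(** * The extension by zero and its variation on regular grids *)

Section zero_extension.
Context {R : realType} {d : nat}.
Variable f : ('I_d -> R) -> R.
Hypothesis HKf : (HK_var f < +oo)%E.

(** With the value 0 at negative coordinates, increments over cells that end at 0 record the mass
    carried by the lower faces of the cube. *)
Definition fext (u : 'I_d -> R) : R := if [forall j, 0 <= u j < 1] then f u else 0.

Lemma fext_fhat u : cube d u -> fext u = fhat f u.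
Proof.
move=> cu; rewrite /fext /fhat; case: ifPn => [/forallP h|/forallPn[j hj]].
  by rewrite ifF//; apply/existsP => -[j /eqP E]; have := h j; rewrite E ltxx andbF.
rewrite ifT//; apply/existsP; exists j; have /andP[h0 h1] := cu j.
by move: hj; rewrite h0 /= -leNgt => h; rewrite eq_le h1.
Qed.

Variable m : nat.
Local Notation H := m.+1.

Definition gpt (k : nat) : R := (k%:R - H%:R) / H%:R.

Lemma gpt_lt k l : (gpt k < gpt l) = (k < l)%N.
Proof. by rewrite /gpt ltr_pM2r ?invr_gt0// ltrD2r ltr_nat. Qed.

Lemma gpt_le k l : (gpt k <= gpt l) = (k <= l)%N.
Proof. by rewrite /gpt ler_pM2r ?invr_gt0// lerD2r ler_nat. Qed.

Lemma gptH : gpt H = 0. Proof. by rewrite /gpt subrr mul0r. Qed.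
Lemma gptHH : gpt (H + H) = 1. Proof. by rewrite /gpt natrD addrK divff. Qed.
Lemma gpt0 : gpt 0 = -1. Proof. by rewrite /gpt sub0r mulNr divff. Qed.

Lemma gpt_range k : (0 <= gpt k < 1) = (H <= k < H + H)%N.
Proof. by rewrite -gptH -gptHH gpt_lt gpt_le. Qed.

Lemma fext_gpt (k : 'I_d -> nat) : fext (fun j => gpt (k j)) =
  (\prod_j (H <= k j < H + H)%N%:R) * f (fun j => (minn H (k j - H))%:R / H%:R).
Proof.
rewrite /fext -natr_forall; under eq_forallb do rewrite gpt_range.
case: ifP => [/forallP h|_]; last by rewrite mul0r.
rewrite mul1r; congr f; apply/funext => j; have /andP[h0 h1] := h j.
rewrite (minn_idPr _); last by rewrite leq_subLR ltnW.
by rewrite /gpt natrB.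
Qed.

(** One-dimensional increment of the extension over cell [l], through values of [f]: the coefficient
    is 0 at an end outside [[0, 1[], where [apos] is just some admissible index. *)
Definition acoef (l : 'I_(H + H)) (b : bool) : R := (if b then 1 else -1) * (H <= l + b < H + H)%N%:R.
Definition apos (l : 'I_(H + H)) (b : bool) : nat := minn H (l + b - H).

Lemma box_mu_grid (l : {ffun 'I_d -> 'I_(H + H)}) :
  box_mu fext (fun j => gpt (l j)) (fun j => gpt (l j).+1) = tens f m (fun j => acoef (l j)) (fun j => apos (l j)).
Proof.
apply: eq_bigr => e _; rewrite /acoef big_split -mulrA; congr (_ * _) => /=.
rewrite (_ : (fun j => _) = fun j => gpt (l j + (j \in e))); first exact: fext_gpt.
by apply/funext => j; case: (j \in e); rewrite ?addn1 ?addn0.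
Qed.

Definition gridind (x i : nat) : R := (H <= x < H + H)%N%:R * (minn H (x - H) == i)%:R.

Lemma acoef_sum (l : 'I_(H + H)) (i : nat) :
  \sum_b acoef l b * (apos l b == i)%:R = gridind l.+1 i - gridind l i.
Proof. by rewrite big_bool /acoef /apos /gridind /= addn1 addn0; ring. Qed.

(** Cells in [[0, 1[] give ordinary differences. Two cells are special: the one ending at 0 gives
    the evaluation at 0, which is the evaluation at 1 minus all differences, and the last one
    carries in addition the evaluation at 1 with a minus sign. *)
Lemma gridind_cases (l i : nat) : (l < H + H)%N -> (i < H.+1)%N ->
  gridind l.+1 i - gridind l i = ((l.+1 == H)%:R - (l.+1 == H + H)%N%:R) * (H == i)%:R +
  ((H <= l)%N%:R * (((l - H).+1 == i)%:R - (l - H == i)%N%:R) - (l.+1 == H)%:R * ((H == i)%:R - (0%N == i)%:R)).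
Proof.
rewrite /gridind; move: (H) (ltn0Sn m : (0 < H)%N) => h h0 lh ih.
have [hl|hl] := leqP h l.
  have -> : (l.+1 == h) = false by lia.
  have -> : (l < h + h)%N by lia.
  have -> : (h <= l.+1)%N by lia.
  have -> : (minn h (l - h) == i) = (l - h == i)%N by lia.
  have -> : (minn h (l.+1 - h) == i) = ((l - h).+1 == i) by lia.
  have [lE|lE] := eqVneq l.+1 (h + h)%N.
    have -> : ((l - h).+1 == i) = (h == i) by lia.
    have -> : (l.+1 < h + h)%N = false by lia.
    by rewrite /=; ring.
  have -> : (l.+1 < h + h)%N by lia.
  by rewrite /=; ring.
have -> : (l.+1 == h + h) = false by lia.
have [lE|lE] := eqVneq l.+1 h.
  have -> : (minn h (l.+1 - h) == i) = (0 == i)%N by lia.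
  have -> : (h <= l.+1 < h + h)%N by lia.
  by rewrite /=; ring.
have -> : (h <= l.+1)%N = false by lia.
by rewrite /=; ring.
Qed.

(** Matrix of the preceding identity; [None] stands for the evaluation at 1. Each column has at most
    two nonzero entries, 1 and -1, whence the 2 in [acol_sum]. *)
Definition acol (l : 'I_(H + H)) (k : option 'I_H) : R :=
  if k is Some k then (l == H + k :> nat)%:R - (l.+1 == H)%:R else (l.+1 == H)%:R - (l.+1 == H + H)%:R.

Lemma sum_option (K : finType) (g : option K -> R) : \sum_k g k = g None + \sum_k g (Some k).
Proof.
rewrite (bigD1 None)//=; congr (_ + _).
case: (pickP (fun k : K => true)) => [k0 _|nok]; last first.
  by rewrite !big1//; [move=> k _; have := nok k|move=> [k|//] _; have := nok k].
rewrite (reindex_onto Some (odflt k0)) /=; last by case.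
by apply: eq_bigl => k; rewrite eqxx.
Qed.

Lemma acol_change (l : 'I_(H + H)) (i : 'I_H.+1) :
  \sum_b acoef l b * (apos l b == i)%:R = \sum_k acol l k * \sum_b fcoef m k b * (fpos m k b == i)%:R.
Proof.
rewrite acoef_sum sum_option big_bool /= mul0r add0r mul1r.
pose g (k : nat) : R := (k == i)%:R.
have tel : \sum_(k < H) (g k.+1 - g k) = g H - g 0%N by rewrite -(big_mkord xpredT (fun k => g k.+1 - g k)) telescope_sumr.
have -> : \sum_(k < H) ((l == H + k :> nat)%:R - (l.+1 == H)%:R) * \sum_b (if b then 1 else -1) * (k + b == i)%N%:R =
   \sum_(k < H) (l == H + k :> nat)%:R * (g k.+1 - g k) - (l.+1 == H)%:R * (g H - g 0%N).
  rewrite -tel mulr_sumr -sumrB; apply: eq_bigr => k _.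
  by rewrite big_bool /g /= addn1 addn0; ring.
have -> : \sum_(k < H) (l == H + k :> nat)%:R * (g k.+1 - g k) = (H <= l)%N%:R * (g (l - H).+1 - g (l - H)%N).
  have [Hl|Hl] := leqP H l; last first.
    by rewrite mul0r big1// => k _; rewrite ltn_eqF ?mul0r// (leq_trans Hl)// leq_addr.
  have lH : (l - H < H)%N by rewrite ltn_subLR.
  rewrite (bigD1 (Ordinal lH))// big1 ?addr0 => [|k kl].
    rewrite (_ : (l == H + Ordinal lH :> nat) = true).
      exact: addr0.
    by apply/eqP => /=; move: Hl; lia.
  rewrite (_ : (l == H + k :> nat) = false) ?mul0r//; apply/negbTE; apply: contra kl => /eqP E.
  by apply/eqP/val_inj; rewrite /= [in RHS]E addKn.
exact: gridind_cases.
Qed.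

Lemma acol_sum (k : option 'I_H) : \sum_l `|acol l k| <= 2.
Proof.
have one (b : 'I_(H + H) -> bool) : (forall l l', b l -> b l' -> l = l') -> \sum_l (b l)%:R <= 1 :> R.
  move=> hb; have [/existsP[l bl]|/existsPn h] := boolP [exists l, b l].
    rewrite (bigD1 l)//= bl big1 ?addr0// => l' ll'; case E : (b l') => //.
    by rewrite (hb _ _ E bl) eqxx in ll'.
  by rewrite big1// => l _; rewrite (negbTE (h l)).
have eqS (c : nat) : \sum_(l < H + H) (l.+1 == c)%:R <= 1 :> R.
  by apply: one => l l' /eqP E /eqP E'; apply/val_inj; apply: succn_inj; rewrite E E'.
have eq0 (c : nat) : \sum_(l < H + H) (l == c :> nat)%:R <= 1 :> R.
  by apply: one => l l' /eqP E /eqP E'; apply/val_inj; rewrite /= E E'.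
have two (a b : 'I_(H + H) -> bool) : \sum_l (a l)%:R <= 1 :> R -> \sum_l (b l)%:R <= 1 :> R ->
    \sum_l `|(a l)%:R - (b l)%:R| <= 2 :> R.
  move=> ha hb; apply: (@le_trans _ _ (\sum_l ((a l)%:R + (b l)%:R))).
    by apply: ler_sum => l _; case: (a l); case: (b l); rewrite ?subrr ?subr0 ?sub0r ?normrN ?normr0 ?normr1 ?addr0 ?add0r// ler_wpDr.
  by rewrite big_split /=; lra.
by case: k => [k|]; apply: two.
Qed.

(** The bound is uniform in [m], so the variation along the tree has a finite limit. Each coordinate
    contributes a factor 2, from [acol_sum]. *)
Lemma box_mu_total : \sum_(l : {ffun 'I_d -> 'I_(H + H)})
    `|box_mu fext (fun j => gpt (l j)) (fun j => gpt (l j).+1)| <=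
  2 ^+ d * (`|f (fun=> 1)| + \sum_(S : {set 'I_d}) fine (HK_var f)).
Proof.
under eq_bigr do rewrite box_mu_grid.
apply: (le_trans (tens_change_le f m _ _ _ _ (fcoef m) (fpos m) acol _ _ acol_change acol_sum)).
- by move=> l b; exact: geq_minl.
- by move=> [k|] [] //=; have := ltn_ord k; lia.
by rewrite ler_pM2l ?exprn_gt0// sum_faces; exact: sum_faces_le.
Qed.

(** In each coordinate the increments telescope, and the extension vanishes at -1. *)
Lemma box_mu_corner (k : 'I_d -> nat) : (forall j, (k j <= H + H)%N) ->
  \sum_(l : {ffun 'I_d -> 'I_(H + H)} | [forall j, (l j < k j)%N])
    box_mu fext (fun j => gpt (l j)) (fun j => gpt (l j).+1) = fext (fun j => gpt (k j)).
Proof.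
move=> kH; rewrite big_mkcond /=.
rewrite (eq_bigr (fun l : {ffun 'I_d -> 'I_(H + H)} => \sum_(i : {ffun 'I_d -> 'I_H.+1})
   (\prod_j ((l j < k j)%N%:R * (gridind (l j).+1 (i j) - gridind (l j) (i j)))) * gridval f m i)); last first.
  move=> l _; rewrite box_mu_grid tensE; last by move=> j b; exact: geq_minl.
  under [RHS]eq_bigr do rewrite big_split -natr_forall -mulrA /=.
  rewrite -mulr_sumr; case: ifP => _; last by rewrite mul0r.
  by rewrite mul1r; apply: eq_bigr => i _; congr (_ * _); apply: eq_bigr => j _; rewrite acoef_sum.
rewrite exchange_big /=.
under eq_bigr => i _.
  rewrite -mulr_suml -(@bigA_distr_bigA _ 0 1 *%R +%R _ _ (fun j (l : 'I_(H + H)) =>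
    (l < k j)%N%:R * (gridind l.+1 (i j) - gridind l (i j)))) /=.
  rewrite (eq_bigr (fun j => (H <= k j < H + H)%N%:R * (minn H (k j - H) == i j)%:R)).
    rewrite big_split -mulrA /=.
    over.
  move=> j _; rewrite -/(gridind (k j) (i j)).
  rewrite (eq_bigr (fun l : 'I_(H + H) => if (l < k j)%N then gridind l.+1 (i j) - gridind l (i j) else 0)); last first.
    by move=> l _; case: ifP; rewrite ?mul1r ?mul0r.
  rewrite -big_mkcond -(big_ord_widen _ (fun l => gridind l.+1 (i j) - gridind l (i j)) (kH j)).
  rewrite -(big_mkord xpredT (fun l => gridind l.+1 (i j) - gridind l (i j))) telescope_sumr//.
  by rewrite {2}/gridind mul0r subr0.
rewrite -mulr_sumr delta_sum; last by move=> j; exact: geq_minl.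
by rewrite fext_gpt.
Qed.

End zero_extension.

(** * Additive masses on a binary tree *)

Section mass_tree.
Context {R : realType} {N : Type}.
Variable ch : bool -> N -> N.

Fixpoint lsum (g : N -> R) (m : nat) (x : N) : R :=
  if m is m'.+1 then lsum g m' (ch false x) + lsum g m' (ch true x) else g x.

Fixpoint desc (m : nat) (x y : N) : Prop :=
  if m is m'.+1 then exists b, desc m' (ch b x) y else y = x.

Lemma lsumS g m x : lsum g m.+1 x = lsum g m (ch false x) + lsum g m (ch true x).
Proof. by []. Qed.

Lemma lsumB g h m x : lsum (fun y => g y - h y) m x = lsum g m x - lsum h m x.
Proof. by elim: m x => //= m IH x; rewrite !IH; ring. Qed.

Variables (good : N -> Prop) (nu : N -> R).
Hypothesis good_ch : forall b x, good x -> good (ch b x).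
Hypothesis nu_ge0 : forall x, good x -> 0 <= nu x.
Hypothesis nuD : forall x, good x -> nu x = nu (ch false x) + nu (ch true x).

(* The interval [a, a + nu x[ is cut in proportion to the masses of the children of x;
   the leaf is the descendant whose piece contains t. *)
Fixpoint leaf (m : nat) (x : N) (a t : R) : N :=
  if m is m'.+1 then
    if t < a + nu (ch false x) then leaf m' (ch false x) a t
    else leaf m' (ch true x) (a + nu (ch false x)) t
  else x.

Lemma leaf_desc m x a t : desc m x (leaf m x a t).
Proof.
elim: m x a => //= m IH x a.
by case: ifP => _; [exists false|exists true]; exact: IH.
Qed.

Lemma leafS m x a t : exists b, leaf m.+1 x a t = ch b (leaf m x a t).
Proof.
elim: m x a => [|m IH] x a; first by rewrite /=; case: ifP => _; [exists false|exists true].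
by rewrite [leaf m.+2 _ _ _]/= [leaf m.+1 x a t]/=; case: ifP => _; exact: IH.
Qed.

Lemma good_leaf m x a t : good x -> good (leaf m x a t).
Proof. by elim: m x a => //= m IH x a gx; case: ifP => _; apply: IH; exact: good_ch. Qed.

Lemma measurable_leaf (p : N -> bool) m x a : measurable [set t | p (leaf m x a t)].
Proof.
elim: m x a => [|m IH] x a /=; first by case: (p x); [rewrite set_true|rewrite set_false].
set c := a + nu (ch false x).
rewrite (_ : [set t | _] = (`]-oo, c[ `&` [set t | p (leaf m (ch false x) a t)]) `|`
  (`[c, +oo[ `&` [set t | p (leaf m (ch true x) c t)])).
  by apply: measurableU; apply: measurableI.
apply/seteqP; split => t /=; rewrite !in_itv /= ?andbT; case: ltP => tc.
- by left.
- by right.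
- by move=> [[_]|[]].
- by move=> [[]|[]].
Qed.

(** The pieces of the descendants partition [[a, a + nu x[] into intervals whose lengths are their
    masses. *)
Lemma leaf_mass (p : N -> bool) m x a : good x ->
  lebesgue_measure ([set t | p (leaf m x a t)] `&` `[a, a + nu x[) =
  (lsum (fun y => if p y then nu y else 0) m x)%:E.
Proof.
elim: m x a => [|m IH] x a gx /=.
  case: (p x); last by rewrite set_false set0I measure0.
  rewrite set_true setTI lebesgue_measure_itv /= lte_fin ltrDl.
  have := nu_ge0 x gx; rewrite le_eqVlt => /orP[/eqP <-|x0]; first by rewrite ltxx.
  by rewrite x0 -EFinB addrC addrA addNr add0r.
have g0 := good_ch false x gx; have g1 := good_ch true x gx.
have n0 := nu_ge0 _ g0; have n1 := nu_ge0 _ g1.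
have nE := nuD x gx; set c := a + nu (ch false x).
rewrite (_ : _ `&` _ = ([set t | p (leaf m (ch false x) a t)] `&` `[a, a + nu (ch false x)[) `|`
    ([set t | p (leaf m (ch true x) c t)] `&` `[c, c + nu (ch true x)[)).
  rewrite measureU; [|by apply: measurableI => //; exact: measurable_leaf..|].
    by rewrite EFinD; congr (_ + _)%E; [exact: IH|exact: IH].
  apply/seteqP; split => // t /= [[_]]; rewrite !in_itv /= => /andP[_ tc] [_ /andP[ct _]].
  by move: tc ct; rewrite /c; lra.
apply/seteqP; split => t /=; rewrite !in_itv /= nE -/c addrA -/c.
  by case: ltP => tc [pt /andP[t0 t1]]; [left|right]; split => //; rewrite ?t0 ?tc ?t1.
case=> -[pt /andP[t0 t1]].
  by rewrite t1; split => //; rewrite t0 /=; move: t1; rewrite /c; lra.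
rewrite (ltNge t c) t0 /=; split => //; rewrite t1 andbT.
by move: t0; rewrite /c; lra.
Qed.

End mass_tree.

(** * The variation as an additive mass *)

Section variation_mass.
Context {R : realType} {N : Type}.
Variables (ch : bool -> N -> N) (mu : N -> R).
Hypothesis muD : forall x, mu x = mu (ch false x) + mu (ch true x).

Definition tvar (m : nat) (x : N) : R := lsum ch (fun y => `|mu y|) m x.
Definition tvar_bounded (x : N) : Prop := exists M, forall m, tvar m x <= M.

Lemma tvar_nd x : nondecreasing_seq (tvar^~ x).
Proof.
apply/nondecreasing_seqP => m; elim: m x => [|m IH] x /=; last by apply: lerD; exact: IH.
by rewrite /tvar /= muD; exact: ler_normD.
Qed.

Lemma tvar_ge0 m x : 0 <= tvar m x.
Proof. by elim: m x => [|m IH] x; [exact: normr_ge0|apply: addr_ge0; exact: IH]. Qed.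

Lemma tvar_bounded_ch b x : tvar_bounded x -> tvar_bounded (ch b x).
Proof.
move=> [M hM]; exists M => m; apply: le_trans (hM m.+1); rewrite /tvar /= -!/(tvar _ _).
by case: b; [apply: ler_wpDl|apply: ler_wpDr] => //; exact: tvar_ge0.
Qed.

(** Variation of [mu] below [x]: additive, because the level sums of [x] are those of its children
    one level down, and at least [|mu x|], because level sums increase. Thus [vmass] and
    [vmass - mu] are nonnegative, additive, and differ by [mu]. *)
Definition vmass (x : N) : R := limn (tvar^~ x).

Lemma tvar_cvg x : tvar_bounded x -> tvar^~ x @ \oo --> vmass x.
Proof.
move=> [M hM]; apply: nondecreasing_is_cvgn; first exact: tvar_nd.
by exists M => _ [m _ <-].
Qed.

Lemma tvar_le m x : tvar_bounded x -> tvar m x <= vmass x.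
Proof. by move=> bx; apply: nondecreasing_cvgn_le; [exact: tvar_nd|apply/cvg_ex; exists (vmass x); exact: tvar_cvg]. Qed.

Lemma vmass_ge x : tvar_bounded x -> `|mu x| <= vmass x.
Proof. exact: (tvar_le 0). Qed.

Lemma vmassD x : tvar_bounded x -> vmass x = vmass (ch false x) + vmass (ch true x).
Proof.
move=> bx; have h0 := tvar_cvg _ (tvar_bounded_ch false x bx).
have h1 := tvar_cvg _ (tvar_bounded_ch true x bx).
have := tvar_cvg x bx; rewrite -(cvg_shiftS (tvar^~ x)) => h.
by rewrite -[LHS](cvg_lim (@Rhausdorff R) h); apply: cvg_lim; [exact: Rhausdorff|exact: cvgD].
Qed.

End variation_mass.

(** * Bisection of boxes and regular grids *)

Section bisection.
Context {R : realType} {d : nat}.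
Hypothesis d0 : (0 < d)%N.
Local Notation vec := ('I_d -> R).
(* A node is a level together with the two corners of a box ]lo, hi]; level k cuts along
   coordinate k mod d. *)
Local Notation node := (nat * vec * vec)%type.
Implicit Types (x y : node).

Definition cutc (k : nat) : 'I_d := Ordinal (ltn_pmod k d0).

Definition bisect (b : bool) (x : node) : node :=
  let j := cutc x.1.1 in let c := (x.1.2 j + x.2 j) / 2 in
  if b then (x.1.1.+1, upd x.1.2 j c, x.2) else (x.1.1.+1, x.1.2, upd x.2 j c).

Definition wfbox x := forall j, x.1.2 j < x.2 j.

Lemma wfbox_bisect b x : wfbox x -> wfbox (bisect b x).
Proof.
move=> wx j; have := wx j; have := wx (cutc x.1.1).
by case: b; rewrite /bisect /upd /=; (try case: eqP => [->|_]); lra.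
Qed.

Lemma bisect_lo b x j : wfbox x -> x.1.2 j <= (bisect b x).1.2 j.
Proof.
move=> wx; have := wx (cutc x.1.1).
by case: b; rewrite /bisect /upd /=; (try case: eqP => [->|_]); lra.
Qed.

Lemma bisect_hi b x j : wfbox x -> (bisect b x).2 j <= x.2 j.
Proof.
move=> wx; have := wx (cutc x.1.1).
by case: b; rewrite /bisect /upd /=; (try case: eqP => [->|_]); lra.
Qed.

(** Number of cuts along [j] in the [m] levels from [k] on: a box that many levels above the grid
    cells is [2 ^ ncut k m j] cells wide along [j]. *)
Definition ncut (k m : nat) (j : 'I_d) : nat := count (fun i => cutc i == j) (iota k m).

Lemma ncut_full n j : ncut 0 (d * n) j = n.
Proof.
elim: n => [|n IH]; first by rewrite muln0.
rewrite mulnSr /ncut iotaD count_cat [X in (X + _)%N](_ : _ = n)// add0n -[(d * n)%N]addn0 iotaDl count_map.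
rewrite (eq_in_count (a2 := pred1 (j : nat))); last first.
  move=> i; rewrite mem_iota /= add0n => id_.
  by rewrite -val_eqE /= mulnC modnMDl modn_small.
by rewrite count_uniq_mem ?iota_uniq// mem_iota /= add0n ltn_ord addn1.
Qed.

Variable m : nat.
Local Notation H := m.+1.
Local Notation g := (gpt m : nat -> R).

Lemma gpt_mid (a w : nat) : (g a + g (a + (w + w))%N) / 2 = g (a + w).
Proof. have h : H%:R != 0 :> R by rewrite pnatr_eq0.
by rewrite /gpt !natrD; move: h; set x := H%:R => h; field. Qed.

(** The coordinate to be cut is an even number of cells wide, so its midpoint is a grid point, where
    the child [b = true] begins. *)
Lemma bisect_grid b k n (a : 'I_d -> nat) :
  bisect b (k, fun j => g (a j), fun j => g (a j + 2 ^ ncut k n.+1 j)%N) =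
  (k.+1, fun j => g (a j + b * ((j == cutc k) * 2 ^ ncut k.+1 n j))%N,
         fun j => g (a j + b * ((j == cutc k) * 2 ^ ncut k.+1 n j) + 2 ^ ncut k.+1 n j)%N).
Proof.
have E j : (2 ^ ncut k n.+1 j = if j == cutc k then 2 ^ ncut k.+1 n j + 2 ^ ncut k.+1 n j else 2 ^ ncut k.+1 n j)%N.
  rewrite /ncut /= eq_sym; case: eqP => _; last by rewrite add0n.
  by rewrite add1n expnS mul2n addnn.
rewrite /bisect /=; set c := (_ + _) / 2.
have cE : c = g (a (cutc k) + 2 ^ ncut k.+1 n (cutc k))%N by rewrite /c E eqxx gpt_mid.
case: b; congr (_, _, _); apply/funext => j; rewrite /upd ?E; case: eqP => [->|_]; rewrite ?mul1n ?mul0n ?addn0//.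
by rewrite addnA.
Qed.

(** Induction on the depth: the two children share the multi-indices according to the side of the
    midpoint on which the cut coordinate lies; at depth 0 a single cell is left. *)
Lemma lsum_grid (psi : vec -> vec -> R) n k (a : 'I_d -> nat) :
  (forall j, (a j + 2 ^ ncut k n j <= H + H)%N) ->
  lsum bisect (fun x => psi x.1.2 x.2) n (k, fun j => g (a j), fun j => g (a j + 2 ^ ncut k n j)%N) =
  \sum_(l : {ffun 'I_d -> 'I_(H + H)} | [forall j, (a j <= l j < a j + 2 ^ ncut k n j)%N])
    psi (fun j => g (l j)) (fun j => g (l j).+1).
Proof.
elim: n k a => [|n IH] k a ha.
  have al j : (a j < H + H)%N by have := ha j; rewrite addn1.
  rewrite (big_pred1 [ffun j => Ordinal (al j)]) /=.
    by congr psi; apply/funext => j; rewrite ffunE ?addn1.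
  move=> l; apply/forallP/eqP => [h|-> j]; last by rewrite ffunE /= leqnn addn1 ltnS leqnn.
  by apply/ffunP => j; apply/val_inj; rewrite ffunE /=; have := h j; rewrite addn1 ltnS -eqn_leq => /eqP.
have E j : (2 ^ ncut k n.+1 j = 2 ^ ncut k.+1 n j + (j == cutc k) * 2 ^ ncut k.+1 n j)%N.
  rewrite /ncut /= eq_sym; case: eqP => _; last by rewrite add0n mul0n addn0.
  by rewrite add1n expnS mul2n mul1n addnn.
rewrite lsumS !bisect_grid.
have h0 j : (a j + 0 * ((j == cutc k) * 2 ^ ncut k.+1 n j) + 2 ^ ncut k.+1 n j <= H + H)%N.
  by apply: leq_trans (ha j); rewrite E mul0n addn0 leq_add2l leq_addr.
have h1 j : (a j + 1 * ((j == cutc k) * 2 ^ ncut k.+1 n j) + 2 ^ ncut k.+1 n j <= H + H)%N.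
  by apply: leq_trans (ha j); rewrite E mul1n -addnA leq_add2l addnC.
rewrite (IH _ _ h0) (IH _ _ h1).
set w := (2 ^ ncut k.+1 n (cutc k))%N.
rewrite [RHS](bigID (fun l : {ffun 'I_d -> 'I_(H + H)} => (l (cutc k) < a (cutc k) + w)%N)) /=.
congr (_ + _); apply: eq_bigl => l.
  apply/forallP/andP => [h|[/forallP h h'] j].
    split; last by have := h (cutc k); rewrite mul0n addn0 => /andP[].
    apply/forallP => j; have := h j; rewrite mul0n addn0 => /andP[-> lt] /=.
    by apply: (leq_trans lt); rewrite E leq_add2l leq_addr.
  rewrite mul0n addn0; have := h j; rewrite E; case: eqP => [->|_]; last by rewrite mul0n addn0.
  by move=> /andP[-> _]; rewrite /= -/w.
rewrite -leqNgt; apply/forallP/andP => [h|[/forallP h h'] j].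
  split; last by have := h (cutc k); rewrite mul1n eqxx mul1n => /andP[].
  apply/forallP => j; have := h j; rewrite mul1n E => /andP[le lt].
  by move: le lt; set p := (_ * _)%N; set q := (2 ^ _)%N; lia.
have := h j; rewrite E mul1n; case: eqP => [->|_]; last by rewrite mul0n !addn0.
by rewrite !mul1n -/w => /andP[_ lt]; rewrite h' /= -addnA.
Qed.

Lemma desc_grid n k (a : 'I_d -> nat) y :
  desc bisect n (k, fun j => g (a j), fun j => g (a j + 2 ^ ncut k n j)%N) y ->
  exists l : 'I_d -> nat, y.1.2 = (fun j => g (l j)) /\ y.2 = (fun j => g (l j).+1).
Proof.
elim: n k a => [|n IH] k a /=.
  by move=> ->; exists a; split => //=; apply/funext => j; rewrite addn1.
by move=> [b]; rewrite bisect_grid; exact: IH.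
Qed.

End bisection.

(** * Images of Lebesgue measure under infinite descent *)

Section grid_root.
Context {R : realType} {d : nat}.
Hypothesis d0 : (0 < d)%N.
Local Notation vec := ('I_d -> R).
Local Notation node := (nat * vec * vec)%type.
Local Notation bis := (bisect d0).

Definition root : node := (0%N, fun=> -1, fun=> 1).

Lemma wfbox_root : wfbox root.
Proof. by move=> j; rewrite /=; lra. Qed.

(** Grids are indexed by [m] with [H = m.+1]; this choice makes [H = 2 ^ n]. *)
Definition pm (n : nat) : nat := (2 ^ n).-1.

Lemma pmE n : (pm n).+1 = (2 ^ n)%N.
Proof. by rewrite prednK// expn_gt0. Qed.

(** The root has side 2, that is [2 ^ n.+1] cells of mesh [2 ^- n]: this takes [n.+1] cuts per
    coordinate, hence the depth [d * n.+1]. *)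
Lemma rootE n : root = (0%N, fun j => gpt (pm n) 0, fun j => gpt (pm n) (0 + 2 ^ ncut d0 0 (d * n.+1) j)%N).
Proof.
congr (_, _, _); apply/funext => j; first by rewrite gpt0.
by rewrite ncut_full add0n expnS mul2n -addnn -pmE gptHH.
Qed.

Lemma lsum_root (psi : vec -> vec -> R) n :
  lsum bis (fun x => psi x.1.2 x.2) (d * n.+1) root =
  \sum_(l : {ffun 'I_d -> 'I_((pm n).+1 + (pm n).+1)})
    psi (fun j => gpt (pm n) (l j)) (fun j => gpt (pm n) (l j).+1).
Proof.
have E j : (0 + 2 ^ ncut d0 0 (d * n.+1) j = (pm n).+1 + (pm n).+1)%N.
  by rewrite ncut_full add0n expnS mul2n -addnn -pmE.
rewrite (rootE n) lsum_grid; last by move=> j; rewrite E.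
by apply: eq_bigl => l; apply/forallP => j; rewrite E ltn_ord.
Qed.

Lemma desc_root n y : desc bis (d * n.+1) root y ->
  exists l : 'I_d -> nat, y.1.2 = (fun j => gpt (pm n) (l j)) /\ y.2 = (fun j => gpt (pm n) (l j).+1).
Proof. by rewrite (rootE n); exact: desc_grid. Qed.

Definition kup (n : nat) (t : R) : nat := minn ((pm n).+1 + (Num.truncn (t * 2 ^+ n)).+1) ((pm n).+1 + (pm n).+1).

Lemma gpt_kup n t : gpt (pm n) (kup n t) = dyadic_up n t :> R.
Proof.
have e k : gpt (pm n) ((pm n).+1 + k) = k%:R / 2 ^+ n :> R.
  by rewrite /gpt natrD addrC addKr pmE natrX.
rewrite /kup /dyadic_up -e -[X in Num.min X _](gptHH (pm n)) /minn minEle gpt_le ltnNge.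
by case: (_ <= _)%N.
Qed.

Lemma dyadic_up_gt n (t : R) : t < 1 -> t < dyadic_up n t.
Proof.
move=> t1; rewrite /dyadic_up lt_min t1 /= ltr_pdivlMr ?exprn_gt0//; exact: truncnS_gt.
Qed.

Section sampling.
Variables (good : node -> Prop) (nu : node -> R).
Hypothesis good_wf : forall x, good x -> wfbox x.
Hypothesis good_ch : forall b x, good x -> good (bis b x).
Hypothesis nu_ge0 : forall x, good x -> 0 <= nu x.
Hypothesis nuD : forall x, good x -> nu x = nu (bis false x) + nu (bis true x).
Hypothesis good_root : good root.
Local Notation lf n t := (leaf bis nu n root 0 t).

Lemma good_lf n t : good (lf n t).
Proof. exact: (good_leaf bis good nu good_ch). Qed.

Lemma leaf_mono t n n' j : (n <= n')%N -> (lf n t).1.2 j <= (lf n' t).1.2 j /\ (lf n' t).2 j <= (lf n t).2 j.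
Proof.
elim: n' => [|n' IH]; first by rewrite leqn0 => /eqP ->.
rewrite leq_eqVlt => /orP[/eqP ->//|]; rewrite ltnS => /IH[h1 h2].
have [b ->] := leafS bis nu n' root 0 t.
have wf := good_wf _ (good_lf n' t).
split; [apply: (le_trans h1); exact: bisect_lo|apply: le_trans h2; exact: bisect_hi].
Qed.

Lemma leaf_bound t n j : -1 <= (lf n t).2 j <= 1.
Proof.
have [h1 h2] := leaf_mono t 0 n j (leq0n n); rewrite h2 andbT.
by apply: (le_trans h1); apply: ltW; exact: good_wf (good_lf n t) j.
Qed.

Definition path_limit (t : R) (j : 'I_d) : R := limn (fun n => (lf n t).2 j).

Lemma path_nincr t j : nonincreasing_seq (fun n => (lf n t).2 j).
Proof. by move=> n n' nn'; have [] := leaf_mono t n n' j nn'. Qed.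

Lemma path_cvg t j : (fun n => (lf n t).2 j) @ \oo --> path_limit t j.
Proof.
apply: nonincreasing_is_cvgn; first exact: path_nincr.
by exists (-1) => _ [n _ <-]; have /andP[] := leaf_bound t n j.
Qed.

Lemma path_limit_le t n j : path_limit t j <= (lf n t).2 j.
Proof. by apply: nonincreasing_cvgn_ge; [exact: path_nincr|apply/cvg_ex; exists (path_limit t j); exact: path_cvg]. Qed.

Lemma measurable_path_limit : measurable_fun setT (fun t => (path_limit t : borelRd R d)).
Proof.
apply: measurable_vec => j.
apply: (proj1 (bmf_lim (fun n t => (lf n t).2 j) _ 1 _ _ _)).
- move=> n _ B mB; rewrite setTI.
  rewrite (_ : _ @^-1` B = [set t | `[< B ((lf n t).2 j) >]]); first exact: (measurable_leaf bis nu (fun x => `[< B (x.2 j) >])).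
  by apply/seteqP; split => t /=; [move/asboolP|move/asboolP].
- by move=> n t; have /andP[h1 h2] := leaf_bound t n j; rewrite ler_norml h1 h2.
- by move=> t; exact: path_cvg.
Qed.

Definition under (s : vec) (x : node) : bool := vle x.2 s.

(** If the limit is at most [u j < 1], some upper corner along the path is strictly below the grid
    point [dyadic_up n (u j)]. The lower corner of the cell at depth [d * n.+1] is then below it
    too, and as that cell is one mesh wide, its upper corner does not exceed the grid point. *)
Lemma path_under t n (u : vec) : (forall j, path_limit t j <= u j \/ 1 <= u j) ->
  (forall j, 0 <= u j) -> under (fun j => dyadic_up n (u j)) (lf (d * n.+1) t).
Proof.
move=> hu u0; apply/vleP => j.
have [u1|u1] := leP 1 (u j).
  apply: (@le_trans _ _ 1); first by have /andP[] := leaf_bound t (d * n.+1) j.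
  rewrite /dyadic_up le_min lexx /= ler_pdivlMr ?exprn_gt0// mul1r.
  apply: (le_trans _ (ltW (truncnS_gt _))); rewrite ler_peMl// exprn_ge0//.
have {}hu : path_limit t j < dyadic_up n (u j).
  by case: (hu j) => h; [apply: (le_lt_trans h); exact: dyadic_up_gt|move: u1; rewrite ltNge h].
have [k hk] : exists k, (lf k t).2 j < dyadic_up n (u j).
  apply: contrapT => /forallNP h; move: hu; rewrite ltNge => /negP; apply.
  apply: limr_ge; first by apply/cvg_ex; exists (path_limit t j); exact: path_cvg.
  by apply: nearW => k; rewrite leNgt; apply/negP; exact: h.
pose k' := maxn k (d * n.+1).
have [_ h1] := leaf_mono t _ _ j (leq_maxl k (d * n.+1)).
have [h2 _] := leaf_mono t _ _ j (leq_maxr k (d * n.+1)).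
have h3 := good_wf _ (good_lf k' t) j.
have [l [lE hE]] := desc_root n _ (leaf_desc bis nu (d * n.+1) root 0 t).
have : (lf (d * n.+1) t).1.2 j < dyadic_up n (u j).
  by apply: (le_lt_trans h2); apply: (lt_trans h3); apply: (le_lt_trans h1).
by rewrite lE hE -gpt_kup gpt_lt gpt_le.
Qed.

Definition node_mass (s : vec) (n : nat) : R := lsum bis (fun x => if under s x then nu x else 0) n root.

Lemma tree_measure : exists mp : {measure set (borelRd R d) -> \bar R},
  [/\ mp (~` cube d) = 0%E, (mp setT < +oo)%E &
      forall u, cube d u -> (fun n => node_mass (fun j => dyadic_up n (u j)) (d * n.+1)) @ \oo -->
        fine (mp (cube d `&` orthant u))].
Proof.
pose I := `[0, 0 + nu root[%classic : set R.
have mI : measurable I by exact: measurable_itv.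
have lI : lebesgue_measure I = (nu root)%:E.
  have := leaf_mass bis good nu good_ch nu_ge0 nuD predT 0 root 0 good_root.
  by rewrite /= set_true setTI.
pose lam0 : {measure set (measurableTypeR R) -> \bar R} := mrestr lebesgue_measure mI.
have lamT : (lam0 setT < +oo)%E by rewrite /lam0 /= /mrestr setTI lI ltry.
have [lam lamE] := finite_measure_pack lam0 lamT.
(* The root reaches down to -1; the projection puts the mass found at negative coordinates on the
   lower faces of the cube. *)
pose Y (t : R) : borelRd R d := clamp (path_limit t).
have mY : measurable_fun setT Y by apply: (measurableT_comp (@measurable_clamp R d)); exact: measurable_path_limit.
have mYA A : measurable A -> measurable (Y @^-1` A).
  by move=> mA; rewrite -[X in measurable X]setTI; exact: mY.
pose mp := measure_function_pushforward__canonical__measure_function_Measure lam mY.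
have mpE A : mp A = lam (Y @^-1` A) by [].
exists mp; split.
- rewrite mpE (_ : _ @^-1` _ = set0) ?measure0//.
  by apply/seteqP; split => // t /=; apply; exact: cube_clamp.
- by rewrite mpE preimage_setT lamE.
move=> u cu.
have c01 j := cu j.
pose F n := (orthant (fun j => dyadic_up n (u j)) : set (borelRd R d)).
have mF n : measurable (F n) by exact: measurable_orthant.
have FI : \bigcap_n F n = orthant u.
  apply/seteqP; split => v hv.
    move=> j.
    apply: (cvgr_to_ge (cvg_dyadic_up _ (cu j))).
    by apply: nearW => n; exact: hv.
  by move=> n _ j; apply: (le_trans (hv j)); apply: dyadic_up_ge; have /andP[] := cu j.
have mu_cvg : (fun n => fine (mp (F n))) @ \oo --> fine (mp (orthant u)).
  have fin A : measurable A -> mp A \is a fin_num.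
    by move=> mA; rewrite mpE; apply: fin_num_measure; exact: mYA.
  have := @nonincreasing_cvg_mu _ _ _ mp F; rewrite FI => h.
  apply: fine_cvg; rewrite fineK; last by apply: fin; exact: measurable_orthant.
  apply: h => //.
  - by rewrite -ge0_fin_numE//; exact: fin.
  - exact: measurable_orthant.
  - apply/nonincreasing_seqP => n; apply/subsetPset => v hv j.
    by apply: (le_trans (hv j)); apply: dyadic_up_decr; have /andP[] := cu j.
have cubeI (A : set (borelRd R d)) : measurable A -> mp (cube d `&` A) = mp A.
  move=> mA; rewrite !mpE; congr (lam _); apply/seteqP; split => t /=; first by case.
  by split => //; exact: cube_clamp.
rewrite cubeI; last exact: measurable_orthant.
have massE n s : node_mass s n = fine (lam [set t | under s (lf n t)]).
  rewrite lamE /lam0 /= /mrestr.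
  by rewrite (leaf_mass bis good nu good_ch nu_ge0 nuD (under s) n root 0 good_root).
have mU n s : measurable [set t | under s (lf n t)] by exact: measurable_leaf.
have le (A B : set (measurableTypeR R)) : measurable A -> measurable B -> A `<=` B -> fine (lam A) <= fine (lam B).
  move=> mA mB AB; apply: fine_le; [exact: fin_num_measure|exact: fin_num_measure|].
  by apply: le_measure; rewrite ?inE.
(* {Y <= u} is contained in {the n-th cell lies below dyadic_up n u}, itself contained in
   {Y <= dyadic_up n u}: no continuity of nu is needed. *)
apply: (squeeze_cvgr _ (cvg_cst _) mu_cvg).
apply: nearW => n; rewrite massE !mpE; apply/andP; split.
  apply: le; [by apply: mYA; exact: measurable_orthant|exact: mU|].
  move=> t /= ht; apply: path_under; last by move=> j; have /andP[] := cu j.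
  move=> j; have := ht j; rewrite /Y /clamp /clamp1 ge_max ge_min => /andP[_].
  by case/orP => h; [right|left].
apply: le; [exact: mU|exact: mYA|].
move=> t /= /vleP ht j; rewrite /Y /clamp /clamp1 ge_max ge_min.
have /andP[-> _] := dyadic_up_01 n (u j).
by rewrite (le_trans (path_limit_le t (d * n.+1) j) (ht j)) ?orbT.
Qed.

End sampling.

End grid_root.

(** * The measures induced by [fhat f] *)

Section induced_measure.
Context {R : realType} {d : nat}.
Hypothesis d0 : (0 < d)%N.
Variable f : ('I_d -> R) -> R.
Hypothesis rcf : right_continuous_cube f.
Hypothesis HKf : (HK_var f < +oo)%E.
Local Notation node := (nat * ('I_d -> R) * ('I_d -> R))%type.
Local Notation bis := (bisect d0).

Definition node_mu (x : node) : R := box_mu (fext f) x.1.2 x.2.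

Lemma node_muD x : node_mu x = node_mu (bis false x) + node_mu (bis true x).
Proof. exact: box_mu_split. Qed.

(** Level sums increase, and depth [n] is refined by depth [d * n.+1], where the boxes are the cells
    of a regular grid and [box_mu_total] applies. *)
Lemma root_bounded : tvar_bounded bis node_mu root.
Proof.
exists (2 ^+ d * (`|f (fun=> 1)| + \sum_(S : {set 'I_d}) fine (HK_var f))) => n.
apply: le_trans (box_mu_total f HKf (pm n)).
rewrite -(lsum_root d0 (fun lo hi => `|box_mu (fext f) lo hi|)).
apply: (tvar_nd bis node_mu node_muD).
by rewrite (leq_trans (leqnSn n))// -[leqLHS]mul1n leq_mul2r d0 orbT.
Qed.

Definition good_node (x : node) : Prop := wfbox x /\ tvar_bounded bis node_mu x.
Local Notation nup := (vmass bis node_mu).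
Definition nun (x : node) : R := nup x - node_mu x.

(** If a coordinate of [u] is 1, both sides are 0. Otherwise the approximations eventually have all
    coordinates below 1, and right-continuity of [f] applies. *)
Lemma cvg_fext u : cube d u -> (fun n => fext f (fun j => dyadic_up n (u j))) @ \oo --> fhat f u.
Proof.
move=> cu; have cup n : cube d (fun j => dyadic_up n (u j)) by move=> j; exact: dyadic_up_01.
under eq_fun do rewrite fext_fhat//.
have [/existsP[j /eqP uj]|/existsPn h] := boolP [exists j, u j == 1].
  rewrite (_ : fhat f u = 0); last by rewrite /fhat ifT//; apply/existsP; exists j; rewrite uj.
  rewrite (_ : (fun n => _) = fun=> 0); first exact: cvg_cst.
  apply/funext => n; rewrite /fhat ifT//; apply/existsP; exists j.
  by rewrite eq_le uj dyadic_up_ge// andbT; have /andP[] := dyadic_up_01 n (1 : R).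
rewrite (_ : fhat f u = f u); last by rewrite /fhat ifF//; apply/existsP => -[j]; apply/negP.
have lt : \forall n \near \oo, forall j, dyadic_up n (u j) < 1.
  apply: filter_forall => j; apply: (cvgr_lt (u j)); first exact: cvg_dyadic_up.
  by rewrite lt_neqAle h; have /andP[] := cu j.
have : (fun n => f (fun j => dyadic_up n (u j))) @ \oo --> f u.
  apply: (rcf u (fun n j => dyadic_up n (u j))) => //.
  - by move=> n j; apply: dyadic_up_decr; have /andP[] := cu j.
  - by move=> j; exact: cvg_dyadic_up.
apply: cvg_trans; apply: near_eq_cvg; apply: filterS lt => n ltn.
by rewrite /fhat ifF//; apply/existsP => -[j /eqP E]; have := ltn j; rewrite E ltxx.
Qed.

(** At depth [d * n.+1] the differences [nup - nun] over the cells below [dyadic_up n u] are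
    increments of [fext f], which telescope to its value at that grid point; letting [n] tend to
    infinity identifies the difference of the two measures on [[0, u]]. *)
Lemma induced_measure_exists : exists mp mn, induced_by (fhat f) mp mn.
Proof.
have gw x : good_node x -> wfbox x by case.
have gch b x : good_node x -> good_node (bis b x).
  by move=> [w bd]; split; [exact: wfbox_bisect|exact: tvar_bounded_ch].
have groot : good_node root by split; [exact: wfbox_root|exact: root_bounded].
have p0 x : good_node x -> 0 <= nup x.
  by move=> [_ bd]; apply: le_trans (vmass_ge _ _ node_muD x bd); exact: normr_ge0.
have n0 x : good_node x -> 0 <= nun x.
  move=> [_ bd]; rewrite /nun subr_ge0.
  by apply: le_trans (vmass_ge _ _ node_muD x bd); exact: ler_norm.
have pD x : good_node x -> nup x = nup (bis false x) + nup (bis true x).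
  by move=> [_ bd]; exact: (vmassD _ _ node_muD).
have nD x : good_node x -> nun x = nun (bis false x) + nun (bis true x).
  by move=> gx; rewrite /nun pD// node_muD; ring.
have [mp [mp1 mp2 mp3]] := tree_measure d0 good_node nup gw gch p0 pD groot.
have [mn [mn1 mn2 mn3]] := tree_measure d0 good_node nun gw gch n0 nD groot.
exists mp, mn; split => // u cu.
have h : (fun n => node_mass d0 nup (fun j => dyadic_up n (u j)) (d * n.+1) -
    node_mass d0 nun (fun j => dyadic_up n (u j)) (d * n.+1)) @ \oo -->
    fine (mp (cube d `&` orthant u)) - fine (mn (cube d `&` orthant u)).
  by apply: cvgB; [exact: mp3|exact: mn3].
rewrite -(cvg_lim (@Rhausdorff R) h); apply: cvg_lim; first exact: Rhausdorff.
rewrite (_ : (fun n => _) = fun n => fext f (fun j => dyadic_up n (u j))); first exact: cvg_fext.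
apply/funext => n; rewrite /= /node_mass -lsumB.
rewrite (_ : (fun y => _ - _) = fun x : node => (fun lo hi => if vle hi (fun j => dyadic_up n (u j))
    then box_mu (fext f) lo hi else 0) x.1.2 x.2); last first.
  by apply/funext => x; rewrite /under; case: vle; rewrite /nun /node_mu; ring.
rewrite (lsum_root d0 (fun lo hi => if vle hi (fun j => dyadic_up n (u j)) then box_mu (fext f) lo hi else 0)).
rewrite -big_mkcond.
have -> : (fun j => dyadic_up n (u j)) = fun j => gpt (pm n) (kup n (u j)).
  by apply/funext => j; rewrite gpt_kup.
rewrite -box_mu_corner; last by move=> j; exact: geq_minr.
by apply: eq_bigl => l; apply: eq_forallb => j; rewrite gpt_le.
Qed.

End induced_measure.

Lemma measure_orthant_cube {R : realType} (d : nat) (mu : {measure set (borelRd R d) -> \bar R}) u :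
  mu (~` cube d) = 0%E -> mu (cube d `&` orthant u) = mu (orthant u).
Proof.
move=> mu0; have mc := @measurable_cube R d; have mo := @measurable_orthant R d u.
rewrite -[in RHS](setIT (orthant u)) -(setUv (cube d)) setIUr measureU.
- rewrite [X in (_ + X)%E](_ : _ = 0%E) ?adde0; first by rewrite setIC.
  apply: (subset_measure0 _ _ _ mu0) => //; first exact: measurableI mo (measurableC mc).
  exact: measurableC.
- exact: measurableI.
- exact: measurableI mo (measurableC mc).
- by rewrite setIACA setICr setI0.
Qed.

Lemma eq_dint {R : realType} (d : nat) (mu1 mu2 nu1 nu2 : {measure set (borelRd R d) -> \bar R}) K :
  (forall A, mu1 A = mu2 A) -> (forall A, nu1 A = nu2 A) -> dint mu1 nu1 K = dint mu2 nu2 K.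
Proof.
move=> hmu hnu; rewrite /dint.
rewrite (_ : (fun u => Rintegral nu1 _ _) = fun u => Rintegral nu2 (cube d) (fun v => K u v)).
  by rewrite /Rintegral; congr fine; apply: eq_measure_integral => A _ _.
by apply/funext => u; rewrite /Rintegral; congr fine; apply: eq_measure_integral => A _ _.
Qed.

(** The variance is expressed through a pair of measures, so the limit is asserted for every pair
    inducing [fhat f]; that such a pair exists is part of the conclusion. *)
Theorem mainTheorem4 (R : realType) (dT : measure_display) (T : measurableType dT)
  (P : probability T R) (d : nat)
  (U : nat -> 'I_d -> T -> R) (eta : nat -> nat -> 'I_d -> T -> R)
  (dC : 'I_d -> ('I_d -> R) -> R) (f : ('I_d -> R) -> R) :
  (2 <= d)%N ->
  iid_vectors P U ->
  uniform_marginals P U ->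
  (forall n i j, measurable_fun setT (eta n i j)) ->
  (forall n i j x, 0 <= eta n i j x <= 1) ->
  (forall j u, cube d u -> is_partial_cube (copula P U) j u (dC j u)) ->
  (forall j, continuous_on_cube (dC j)) ->
  right_continuous_cube f ->
  (HK_var f < +oo)%E ->
  (exists mp mn, induced_by (fhat f) mp mn) /\
  (forall mp mn, induced_by (fhat f) mp mn ->
     let s2 := dint_signed mp mn (covG (copula P U) dC) in
     0 <= s2 /\ conv_in_law_normal P (LHSD_stat P U eta f) s2).
Proof.
move=> d2 iidU unifU meta eta01 dCP dC_cont rcf HKf; split.
  by apply: induced_measure_exists => //; exact: leq_trans d2.
move=> mp mn [mp_cube mn_cube mpT mnT mpmn] s2.
have [m1 m1E] := finite_measure_pack mp mpT.
have [m2 m2E] := finite_measure_pack mn mnT.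
have m1_cube : m1 (~` cube d) = 0%E by rewrite m1E.
have m2_cube : m2 (~` cube d) = 0%E by rewrite m2E.
have bf := right_continuous_bmf f rcf (HK_bounded f HKf).
have mf x : cube d x -> sint m1 m2 (fun u => (vle u x)%:R) = fhat f x.
  move=> cx; rewrite -(mpmn x cx) !measure_orthant_cube// /sint.
  have oE : orthant x = [set u | vle u x] by apply/seteqP; split => v /= /vleP.
  have mo : measurable ([set u | vle u x] : set (borelRd R d)) by rewrite -oE; exact: measurable_orthant.
  by rewrite !Rint_indicb// m1E m2E oE.
have s2E : s2 = dint_signed m1 m2 (covG (copula P U) dC).
  have e1 A : mp A = m1 A := esym (m1E A).
  have e2 A : mn A = m2 A := esym (m2E A).
  by rewrite /s2 /dint_signed; congr (_ - _ - _ + _); apply: eq_dint; first [exact: e1|exact: e2].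
rewrite s2E; split.
  (* [s2] is the second moment of [zstat], hence nonnegative. *)
  rewrite -(Rint_zstat2 P d U iidU unifU dC dCP dC_cont m1 m2 m1_cube m2_cube).
  by apply: Rint_ge0 => x; exact: sqr_ge0.
exact: (LHSD_clt P d U iidU unifU eta meta eta01 dC dCP dC_cont f bf m1 m2 m1_cube m2_cube mf).
Qed.
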